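(* Let $A$ be an associative locally convex topological algebra. If $r\in\mathbb{N}\cup\{\infty\}$ (with $r\geq 1$), let $X$ be a (not necessarily finite-dimensional) $C^r$-manifold; if $r=0$, let $X$ be any Hausdorff topological space. Then $C^r(X,A)$ is a locally convex topological algebra with respect to pointwise operations. Furthermore, if $X$ is a $\sigma$-compact finite-dimensional $C^r$-manifold, then $\mathcal{D}^r(X,A)$ is a locally convex topological algebra with respect to pointwise operations.
   Context: A locally convex topological algebra is an algebra over $\mathbb{K}\in\{\mathbb{R},\mathbb{C}\}$ with a locally convex (Hausdorff) vector topology for which multiplication is (jointly) continuous; no unit is required. Manifolds are Hausdorff and modelled on locally convex spaces. Differentiability is over $\mathbb{R}$ in the Michal–Bastiani sense: for locally convex $E,F$ and $U\subseteq E$ open, $f:U\to F$ is $C^0$ if continuous; $C^1$ if it is continuous, the directional derivative $df(x,h)=\lim_{t\to0}t^{-1}(f(x+th)-f(x))$ exists for all $(x,h)\in U\times E$ and $df:U\times E\to F$ is continuous; recursively $C^k$ ($k\ge2$) if $C^{k-1}$ and $d^{k-1}f:U\times E^{2^{k-1}-1}\to F$ is $C^1$, with $d^kf:=d(d^{k-1}f)$; $C^\infty$ if $C^k$ for all $k$. $C^r(X,A)$ is the space of $C^r$-maps $X\to A$. Put $T^0X:=X$, $d^0\gamma:=\gamma$ and (if $r\ge1$) $d\gamma:=\mathrm{pr}_2\circ T\gamma:TX\to A$, $d^n\gamma:=d(d^{n-1}\gamma):T^nX\to A$. $C^r(X,A)$ carries the initial topology with respect to the maps $\gamma\mapsto d^n\gamma\in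 C(T^nX,A)$ ($n\in\mathbb{N}_0$, $n\le r$), the targets having the compact-open topology. For $K\subseteq X$ compact, $C^r_K(X,A)=\{\gamma\in C^r(X,A):\gamma|_{X\setminus K}=0\}$ has the induced topology, and $\mathcal{D}^r(X,A)=\bigcup_KC^r_K(X,A)$ (for $X$ finite-dimensional and $\sigma$-compact) has the locally convex direct limit topology. *)

(* Defs.v *)
From HB Require Import structures.
From mathcomp Require Import all_boot all_order all_algebra.
From mathcomp Require Import all_classical all_reals interval_inference topology convex normedtype.
From mathcomp Require Import complex.

Set Implicit Arguments.
Unset Strict Implicit.
Unset Printing Implicit Defensive.

Import Order.TTheory GRing.Theory Num.Theory.
Import numFieldNormedType.Exports.

Local Open Scope classical_set_scope.
Local Open Scope ring_scope.

Variant scalar_kind := RealScalars | ComplexScalars.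

Definition scalars (R : realType) (k : scalar_kind) : numFieldType :=
  match k with RealScalars => R | ComplexScalars => R[i] end.

Definition of_real (R : realType) (k : scalar_kind) : R -> scalars R k :=
  match k return R -> scalars R k with
  | RealScalars => id
  | ComplexScalars => real_complex R
  end.

Section OfReal.
Variables (R : realType) (k : scalar_kind).

Lemma of_real_additive : zmod_morphism (@of_real R k).
Proof. by case: k => // x y /=; exact: rmorphB. Qed.

Lemma of_real_multiplicative : monoid_morphism (@of_real R k).
Proof.
by case: k => //; split=> [|x y] /=; [exact: rmorph1|exact: rmorphM].
Qed.

HB.instance Definition _ :=
  GRing.isZmodMorphism.Build R (scalars R k) (@of_real R k) of_real_additive.
HB.instance Definition _ :=
  GRing.isMonoidMorphism.Build R (scalars R k) (@of_real R k)
    of_real_multiplicative.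

Lemma ler_of_real (x y : R) : (of_real k x <= of_real k y) = (x <= y).
Proof. by case: k => //=; rewrite lecR. Qed.

Lemma of_real_continuous :
  continuous (@of_real R k : R^o -> (scalars R k)^o).
Proof.
case: k => [x|x] /=; first exact: cvg_id.
have posE (e : R[i]) : 0 < e -> 0 < complex.Re e /\ e = (complex.Re e)%:C%C.
  by case: e => a b; rewrite ltcE/= => /andP[/eqP -> ?].
apply/cvgrPdist_lt => e /posE[e0 eE]; near=> y.
rewrite eE -rmorphB/= normc_def/= expr0n/= addr0 sqrtr_sqr ltcR.
by near: y; exact: (@cvgr_dist_lt _ R^o).
Unshelve. all: by end_near. Qed.

End OfReal.

(* [A] with scalars restricted along [of_real]: differentiability is over the
   reals also when [A] is a complex vector space. *)
Definition realified (R : realType) (k : scalar_kind) (A : Type) : Type := A.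
Arguments realified : clear implicits.

Section Realified.
Variables (R : realType) (k : scalar_kind) (A : tvsType (scalars R k)).
Local Notation AR := (realified R k A).

HB.instance Definition _ := Uniform.copy AR A.
HB.instance Definition _ := GRing.Zmodule.copy AR A.

Definition real_scale (a : R) (x : AR) : AR := of_real k a *: (x : A).

Lemma real_scaleA a b x : real_scale a (real_scale b x) = real_scale (a * b) x.
Proof. by rewrite /real_scale scalerA rmorphM. Qed.

Lemma real_scale1 : left_id 1 real_scale.
Proof. by move=> x; rewrite /real_scale rmorph1 scale1r. Qed.

Lemma real_scaleDr : right_distributive real_scale +%R.
Proof. by move=> a x y; exact: scalerDr. Qed.

Lemma real_scaleDl x : {morph real_scale^~ x : a b / a + b}.
Proof. by move=> a b; rewrite /real_scale rmorphD; exact: scalerDl. Qed.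

HB.instance Definition _ := GRing.Zmodule_isLmodule.Build R AR
  real_scaleA real_scale1 real_scaleDr real_scaleDl.

Lemma realified_add_continuous : continuous (fun x : AR * AR => x.1 + x.2).
Proof. exact: (@add_continuous A). Qed.

Lemma realified_scale_continuous :
  continuous (fun z : R^o * AR => z.1 *: z.2).
Proof.
move=> [a x] U /(@scale_continuous _ A (of_real k a, x)) [[V W] [/= Va Wx] VW].
exists (of_real k @^-1` V, W); first by split => //; exact: of_real_continuous.
by move=> [b y] [/= Vb Wy]; exact: (VW (of_real k b, y)).
Qed.

Lemma realified_locally_convex : exists2 B : set_system AR,
  (forall b, b \in B -> convex_set b) & basis B.
Proof.
have [B Bconv Bbasis] := @locally_convex _ A.
exists B => // b /Bconv bconv x y l xb yb.
have l0 : 0 <= of_real k l%:num.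
  by rewrite -(rmorph0 (@of_real R k)) ler_of_real.
have l1 : of_real k l%:num <= 1.
  by rewrite -(rmorph1 (@of_real R k)) ler_of_real.
have := bconv _ _ (Itv01 l0 l1) xb yb.
suff <- : conv (Itv01 l0 l1) (x : convex_lmodType A) y = conv l x y by [].
have onemE (a : R) : unstable.onem (of_real k a) = of_real k (unstable.onem a).
  by rewrite rmorphB rmorph1.
by rewrite /conv/= onemE.
Qed.

HB.instance Definition _ := PreTopologicalNmodule_isTopologicalNmodule.Build
  AR realified_add_continuous.
HB.instance Definition _ := TopologicalNmodule_isTopologicalLmodule.Build
  R AR realified_scale_continuous.
HB.instance Definition _ := Uniform_isTvs.Build R AR realified_locally_convex.

End Realified.

(* Neither a unit nor associativity is required. *)
HB.mixin Record Tvs_isLcAlgebra (K : numFieldType) A & Tvs K A := {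
  lc_hausdorff : hausdorff_space A ;
  alg_mul : A -> A -> A ;
  alg_mulDl : left_distributive alg_mul +%R ;
  alg_mulDr : right_distributive alg_mul +%R ;
  alg_scaleAl : forall (a : K) x y, a *: alg_mul x y = alg_mul (a *: x) y ;
  alg_scaleAr : forall (a : K) x y, a *: alg_mul x y = alg_mul x (a *: y) ;
  alg_mul_continuous : continuous (fun p : A * A => alg_mul p.1 p.2)
}.

#[short(type="lcAlgType")]
HB.structure Definition LcAlgebra (K : numFieldType) :=
  {A of Tvs K A & Tvs_isLcAlgebra K A}.

(* The topological space [S], whose elements are viewed as functions by [ev],
   is a locally convex topological algebra for the pointwise operations:
   it is homeomorphic to some [B : lcAlgType K] whose operations become the
   pointwise ones. As [ev] is injective in all uses, this determines the
   operations on [S], and includes that [S] is stable under them. *)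
Definition pointwise_lc_algebra (K : numFieldType) (X : Type) (A : lcAlgType K)
    (S : topologicalType) (ev : S -> X -> A) : Prop :=
  exists (B : lcAlgType K) (phi : B -> S) (psi : S -> B),
    [/\ cancel phi psi, cancel psi phi, continuous phi & continuous psi] /\
    [/\ forall f g x, ev (phi (f + g)) x = ev (phi f) x + ev (phi g) x,
        forall (a : K) f x, ev (phi (a *: f)) x = a *: ev (phi f) x &
        forall f g x,
          ev (phi (alg_mul f g)) x = alg_mul (ev (phi f) x) (ev (phi g) x)].

(* [None] stands for the order of differentiability infinity. *)
Definition smoothness := option nat.

Definition order_le (n : nat) (r : smoothness) : bool :=
  if r is Some m then (n <= m)%N else true.

Section Calculus.
Variable R : realType.
Implicit Types E F : tvsType R.

Definition is_dirder E F (f : E -> F) (x h : E) (l : F) : Prop :=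
  t^-1 *: (f (x + t *: h) - f x) @[t --> (0 : R)^'] --> l.

Definition dirder E F (f : E -> F) (x h : E) : F :=
  xget 0 [set l | is_dirder f x h l].

(* Maps on an open set [U] are represented by total functions whose values
   outside [U] are irrelevant. *)
Definition C1_on E F (U : set E) (f : E -> F) : Prop :=
  [/\ {within U, continuous f},
      forall x h, U x -> exists l, is_dirder f x h l &
      {within U `*` [set: E], continuous (fun p : E * E => dirder f p.1 p.2)}].

(* E^(2^n), with E^(2^(n+1)) = E^(2^n) x E^(2^n) *)
Fixpoint iter_prod E n : tvsType R :=
  if n is m.+1 then (iter_prod E m * iter_prod E m)%type else E.

(* U x E^(2^n - 1) *)
Fixpoint iter_dom E (U : set E) n {struct n} : set (iter_prod E n) :=
  match n return set (iter_prod E n) with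
  | 0 => U
  | m.+1 => @iter_dom E U m `*` [set: iter_prod E m]
  end.
Arguments iter_dom {E} U n : rename.

Fixpoint iter_dirder E F (f : E -> F) n : iter_prod E n -> F :=
  match n return iter_prod E n -> F with
  | 0 => f
  | m.+1 => fun p => dirder (@iter_dirder E F f m) p.1 p.2
  end.
Arguments iter_dirder {E F} f n _ : rename.

Fixpoint Ck_on E F (U : set E) (f : E -> F) n : Prop :=
  if n is m.+1 then Ck_on U f m /\ C1_on (iter_dom U m) (iter_dirder f m)
  else {within U, continuous f}.

Definition finite_dimensional E : Prop :=
  exists n (b : 'I_n -> E), forall v, exists c : 'I_n -> R,
    v = \sum_(i < n) c i *: b i.

End Calculus.

(* A space with a family of charts [chart i : chart_dom i -> model i]. The
   values of [chart i] outside [chart_dom i] are irrelevant. *)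
Record charted (R : realType) := Charted {
  space :> topologicalType ;
  chart_index : Type ;
  model : chart_index -> tvsType R ;
  chart_dom : chart_index -> set space ;
  chart : forall i, space -> model i
}.

Section Manifolds.
Variable R : realType.
Implicit Types (X : charted R) (F : tvsType R) (r : smoothness).

(* [f] composed with the inverse of the chart [i], extended by 0 *)
Definition in_chart X F (i : chart_index X) (f : X -> F) (y : model i) : F :=
  if pselect (exists x, chart_dom i x /\ chart i x = y) is left yP
  then f (projT1 (cid yP)) else 0.

Definition transition X (i j : chart_index X) : model i -> model j :=
  in_chart (i := i) (chart j).

Definition is_manifold r X : Prop :=
  [/\ hausdorff_space X /\ (forall i : chart_index X, hausdorff_space (model i)),
      (forall i : chart_index X, open (chart_dom i)) /\
        \bigcup_(i in [set: chart_index X]) chart_dom i = [set: X],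
      forall i : chart_index X,
        [/\ {in chart_dom i &, injective (chart i)},
            {within chart_dom i, continuous (chart i)} &
            forall U, open U -> U `<=` chart_dom i -> open (chart i @` U)] &
      forall (i j : chart_index X) n, order_le n r ->
        Ck_on (chart i @` (chart_dom i `&` chart_dom j)) (@transition X i j) n].

Definition Cr X F r (g : X -> F) : Prop :=
  continuous g /\
  forall (i : chart_index X) n, order_le n r ->
    Ck_on (chart i @` chart_dom i) (in_chart (i := i) g) n.

(* A tangent vector at [base] is the family of its components in all charts
   around [base], related by the differentials of the transition maps; the
   components in the other charts are set to 0. *)
Record tangent_vector X := TangentVector {
  base : X ;
  comp : forall i : chart_index X, model i ;
  comp_transition : forall i j, chart_dom i base -> chart_dom j base ->
    comp j = dirder (@transition X i j) (chart i base) (comp i) ;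
  comp_out : forall i, ~ chart_dom i base -> comp i = 0
}.

HB.instance Definition _ X := gen_eqMixin (tangent_vector X).
HB.instance Definition _ X := gen_choiceMixin (tangent_vector X).

Definition tangent_dom X (i : chart_index X) : set (tangent_vector X) :=
  [set w | chart_dom i (base w)].

Definition tangent_chart X (i : chart_index X) (w : tangent_vector X) :
  (model i * model i)%type := (chart i (base w), comp w i).

Definition tangent_subbase X : set_system (tangent_vector X) :=
  [set O | exists (i : chart_index X) (W : set (model i * model i)),
     open W /\ O = tangent_dom i `&` @tangent_chart X i @^-1` W].

HB.instance Definition _ X :=
  isSubBaseTopological.Build (tangent_vector X) (@tangent_subbase X) id.

Definition tangent X : charted R :=
  @Charted R (tangent_vector X) (chart_index X)
    (fun i => (model i * model i)%type) (@tangent_dom X) (@tangent_chart X).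

(* d f = pr_2 o Tf; for a C^1-map on a C^1-manifold, the value does not depend
   on the chart chosen around the base point *)
Definition tangent_diff X F (f : X -> F) (w : tangent X) : F :=
  if pselect (exists i : chart_index X, chart_dom i (base w)) is left wP
  then let i := projT1 (cid wP) in
    dirder (in_chart (i := i) f) (chart i (base w)) (comp w i)
  else 0.

Fixpoint iter_tangent X n : charted R :=
  if n is m.+1 then tangent (iter_tangent X m) else X.

Fixpoint iter_tangent_diff X F (f : X -> F) n : iter_tangent X n -> F :=
  match n return iter_tangent X n -> F with
  | 0 => f
  | m.+1 => tangent_diff (@iter_tangent_diff X F f m)
  end.
Arguments iter_tangent_diff {X F} f n _ : rename.

(* A topological space without charts: its C^0-maps are the continuous maps,
   and [iter_tangent] is only needed at order 0. *)
Definition uncharted (X : topologicalType) : charted R :=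
  @Charted R X void (of_void _) (of_void _) (fun i => match i with end).

Definition finite_dimensional_charts X : Prop :=
  forall i : chart_index X, finite_dimensional (model i).

Definition sigma_compact (X : topologicalType) : Prop :=
  exists2 C : nat -> set X, forall n, compact (C n) & \bigcup_n C n = [set: X].

Definition Cr_space X F r : Type := {g : X -> F | Cr r g}.

HB.instance Definition _ X F r := gen_eqMixin (Cr_space X F r).
HB.instance Definition _ X F r := gen_choiceMixin (Cr_space X F r).

Definition Cr_diff X F r n (g : Cr_space X F r) :
  {compact-open, iter_tangent X n -> F} := iter_tangent_diff (sval g) n.

HB.instance Definition _ X F r := Topological.copy (Cr_space X F r)
  (sup_topology (fun n : {n | order_le n r} =>
     Topological.class (initial_topology (@Cr_diff X F r (sval n))))).

(* C^r_C(X,F); its canonical topology is the induced one *)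
Definition supported X F r (C : set X) : set (Cr_space X F r) :=
  [set g | forall x, ~ C x -> sval g x = 0].

End Manifolds.

Section TestFunctions.
Variables (R : realType) (k : scalar_kind) (X : charted R).
Variables (A : tvsType (scalars R k)) (r : smoothness).

Definition test_functions : Type :=
  set_type (\bigcup_(C in @compact X) @supported R X (realified R k A) r C).

Definition test_fun (g : test_functions) : X -> A := sval (set_val g).

Definition supported_test (C : set X) (cC : compact C)
    (g : set_type (@supported R X (realified R k A) r C)) : test_functions :=
  exist _ (set_val g) (mem_set (ex_intro2 _ _ C cC (set_valP g))).

Definition test_linear (F : tvsType (scalars R k)) (f : test_functions -> F) :=
  forall (a : scalars R k) u v w,
    (forall x, test_fun w x = a *: test_fun u x + test_fun v x) ->
    f w = a *: f u + f v.

(* The locally convex direct limit topology: the initial topology with respect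
   to all linear maps to locally convex spaces whose restrictions to all
   [C^r_C(X,A)] are continuous, that is, the finest locally convex topology
   making the inclusions of the [C^r_C(X,A)] continuous. *)
Definition test_subbase : set_system test_functions :=
  [set O | exists (F : tvsType (scalars R k)) (f : test_functions -> F)
             (V : set F),
     [/\ test_linear f,
         forall (C : set X) (cC : compact C),
           continuous (f \o @supported_test C cC),
         open V & O = f @^-1` V]].

HB.instance Definition _ := Choice.on test_functions.
HB.instance Definition _ :=
  isSubBaseTopological.Build test_functions test_subbase id.

End TestFunctions.

(* Main.v *)
Require Import Defs.
From HB Require Import structures.
From mathcomp Require Import all_boot all_order all_algebra.
From mathcomp Require Import all_classical all_reals interval_inference topology convex normedtype.
From mathcomp Require Import complex finmap ring lra.

Set Implicit Arguments.
Unset Strict Implicit.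
Unset Printing Implicit Defensive.

Import Order.TTheory GRing.Theory Num.Theory.
Import numFieldNormedType.Exports.

Local Open Scope classical_set_scope.
Local Open Scope ring_scope.

(** Why the spaces of $C^r$-maps and of test functions are topological algebras.

   The topology of $C^r(X,A)$ is that of uniform convergence of the differentials
   $d^n\gamma$ on compact subsets of $T^nX$. On a compact set $K$, uniform
   convergence of $f_z$ to a continuous map $f$ means that $f_z(x')$ tends to
   $f(x)$ for each $x\in K$ as $z$ runs along the filter and $x'\to x$ within $K$
   ([cvg_on_set], [compact_open_cvg_on_set]). In this form, every continuous
   operation on $A$ passes to limits without any estimate. As the $d^n$ are linear,
   this settles the vector space operations ([Cr_lin_continuous]); local convexity
   holds because each basic neighbourhood of $\gamma$ contains an open set of the
   form $\gamma+\{h : d^nh(K)\subseteq V\}$, $V$ convex ([Cr_convex_nbhs]).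

   For the multiplication, the product rule
   $d(\gamma\eta)=d\gamma\cdot(\eta\circ\pi)+(\gamma\circ\pi)\cdot d\eta$ calls for an
   induction on the order of differentiation. It is carried out on open subsets of
   the modelling spaces, where the bundle projection $\pi$ is a linear projection
   ([cvg_derivatives_bilinear]). Passing from $X$ to its charts is justified by
   [cvg_tangent_diffs_chart], also by induction: $TX$ is again a manifold, with one
   order of differentiability less ([tangent_manifold]), and $d\gamma$ is represented
   in its charts by the derivatives of the local representatives of $\gamma$
   ([in_tangent_chart]). Both facts rest on the chain rule. It is immediate for
   Hadamard derivatives, and $C^1$-maps have these by the mean value theorem
   ([C1_hadamard]).

   The topology of $\mathcal D^r(X,A)$ is initial for a class of linear maps $f$ to
   locally convex spaces, so that its vector space operations and, for fixed $v$,
   the maps $u\mapsto uv$ and $u\mapsto vu$ are continuous. The remaining point is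
   continuity of $(u,v)\mapsto f(uv)$ at $(0,0)$ ([test_mul_nbhs0]). It follows from
   the continuity of the multiplication of $C^r(X,A)$, because a product is
   supported in any compact set in which one of its factors is supported; what
   makes this enough is that $X$ is exhausted by a sequence of compact sets in
   which every compact set is eventually contained ([compact_exhaustion]), and that
   convex balanced sets can be tested for being neighbourhoods of $0$ on functions
   supported in one compact set at a time ([test_nbhs0]). *)

(** * Filters, products and subbases *)

Lemma cvg_eq_on (T U : Type) (Q : set_system T) (G : set_system U) {FQ : Filter Q}
    (P : set T) (f g : T -> U) :
  Q P -> (forall x, P x -> f x = g x) -> f @ Q `=>` G -> g @ Q `=>` G.
Proof.
move=> QP fg fG N GN; apply: (@filterS _ Q FQ (P `&` f @^-1` N)).
  by move=> x [Px /=]; rewrite fg.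
exact: (@filterI _ Q FQ _ _ QP (fG N GN)).
Qed.

Lemma cvg_filter_prod (T U V : Type) (Q : set_system T) (G : set_system U)
    (H : set_system V) {FQ : Filter Q} (f : T -> U) (g : T -> V) :
  f @ Q `=>` G -> g @ Q `=>` H -> (fun x => (f x, g x)) @ Q `=>` filter_prod G H.
Proof.
move=> fG gH N [[A B] [/= GA HB] AB]; have := @filterI _ Q FQ _ _ (fG A GA) (gH B HB).
by apply: filterS => x /= [Ax Bx]; exact: (AB (_, _)).
Qed.

Lemma cvg_pairP (T : Type) (Q : set_system T) {FQ : Filter Q} (E F : topologicalType)
    (f : T -> E * F) (l : E * F) :
  f @ Q --> l <-> (fst \o f) @ Q --> l.1 /\ (snd \o f) @ Q --> l.2.
Proof.
split=> [fl|[fl1 fl2]].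
  split; apply: (cvg_comp _ _ fl).
    exact: cvg_fst.
  exact: cvg_snd.
have -> : f = fun t => ((fst \o f) t, (snd \o f) t).
  by apply/funext => t /=; case: (f t).
by rewrite [l]surjective_pairing; apply: cvg_pair.
Qed.

Lemma cvg_pairI (T : Type) (Q : set_system T) {FQ : Filter Q}
    (E F : topologicalType) (f : T -> E) (g : T -> F) (a : E) (b : F) :
  f @ Q --> a -> g @ Q --> b -> (fun x => (f x, g x)) @ Q --> (a, b).
Proof. by move=> fa gb; apply/cvg_pairP. Qed.

Lemma continuous_fst (T S : topologicalType) : continuous (@fst T S).
Proof. by move=> p; exact: cvg_fst. Qed.

Lemma continuous_snd (T S : topologicalType) : continuous (@snd T S).
Proof. by move=> p; exact: cvg_snd. Qed.

Lemma open_continuousP (T S : topologicalType) (U : set T) (f : T -> S) :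
  open U -> {within U, continuous f} <-> (forall x, U x -> {for x, continuous f}).
Proof.
move=> oU; rewrite continuous_open_subspace//; split=> [fc x Ux|fc x /set_mem].
  by apply: fc; exact/mem_set.
exact: fc.
Qed.

Lemma openX (T S : topologicalType) (U : set T) (V : set S) :
  open U -> open V -> open (U `*` V).
Proof.
move=> oU oV; rewrite openE => -[x y] [/= Ux Vy].
by exists (U, V) => //=; split; exact: open_nbhs_nbhs.
Qed.

Lemma openX_setT (T S : topologicalType) (U : set T) :
  open U -> open (U `*` [set: S]).
Proof. by move=> oU; apply: openX => //; exact: openT. Qed.

Lemma cluster_nbhs_image (T S : topologicalType) (f : T -> S) x y :
  hausdorff_space S -> {for x, continuous f} -> {for y, continuous f} ->
  cluster (nbhs x) y -> f x = f y.
Proof.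
move=> hS cx cy xy; apply: hS => A B /cx fA /cy fB.
by have [z [Az Bz]] := xy _ _ fA fB; exists (f z).
Qed.

Lemma hausdorff_prod (T S : topologicalType) :
  hausdorff_space T -> hausdorff_space S -> hausdorff_space (T * S)%type.
Proof.
move=> hT hS p q pq; rewrite [p]surjective_pairing [q]surjective_pairing.
by congr (_, _); [apply: (cluster_nbhs_image hT _ _ pq)|
  apply: (cluster_nbhs_image hS _ _ pq)]; try exact: cvg_fst; exact: cvg_snd.
Qed.

Definition is_subbase (T : topologicalType) (D : set_system T) : Prop :=
  @open T = [set \bigcup_(B in D') B | D' in subset^~ (finI_from D id)].

Lemma subbase_open (T : topologicalType) (D : set_system T) (O : set T) :
  is_subbase D -> D O -> open O.
Proof.
move=> bD DO; rewrite bD; exists [set O]; last by rewrite bigcup_set1.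
move=> _ ->; exists [fset O]%fset; last by rewrite set_fset1 bigcap_set1.
by move=> B /fset1P ->; exact: mem_set.
Qed.

Lemma cvg_subbase (T : topologicalType) (D : set_system T) (F : set_system T)
    (t : T) : Filter F -> is_subbase D ->
  (forall O, D O -> O t -> F O) -> F --> t.
Proof.
move=> FF bD FO A; rewrite nbhsE => -[B [oB Bt] BA].
rewrite nbhs_simpl; apply: filterS BA _.
rewrite bD in oB; have [D' D'D BE] := oB; rewrite -BE in Bt *.
have [C D'C Ct] := Bt.
apply: (@filterS _ _ _ C) => [s Cs|]; first by exists C.
have [I ID CE] := D'D C D'C; rewrite -CE; apply: filter_bigI => O OI.
by apply: FO; [exact/set_mem/ID|move: Ct; rewrite -CE; exact].
Qed.

(** * Locally convex spaces and the mean value theorem *)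

Lemma convex_setP (K : numFieldType) (E : lmodType K) (C : set E) :
  @convex_set K E C <->
  forall (a : K) x y, 0 <= a -> a <= 1 -> C x -> C y ->
    C (a *: x + (1 - a) *: y).
Proof.
split=> [cC a x y a0 a1 Cx Cy|cC x y a /set_mem Cx /set_mem Cy].
  by have := cC x y (Itv01 a0 a1) (mem_set Cx) (mem_set Cy) => /set_mem.
by apply/mem_set; apply: cC.
Qed.

Section Tvs.
Variables (K : numFieldType) (E : tvsType K).

Lemma tvs_convex_nbhs (x : E) (N : set E) : nbhs x N ->
  exists C : set E, [/\ open C, @convex_set K E C, C x & C `<=` N].
Proof.
move=> xN; have [B Bc [Bo Bb]] := @locally_convex K E.
by have [C [BC Cx] CN] := Bb x N xN; exists C; split => //;
  [exact: Bo|apply: Bc; exact: mem_set].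
Qed.

Lemma cvgD_tvs (T : Type) (F : set_system T) {FF : Filter F} (f g : T -> E) a b :
  f @ F --> a -> g @ F --> b -> (fun x => f x + g x) @ F --> a + b.
Proof.
move=> fa gb; apply: (cvg_comp2 fa gb); exact: (@add_continuous E (a, b)).
Qed.

Lemma cvgZ_tvs (T : Type) (F : set_system T) {FF : Filter F} (c : T -> K)
    (f : T -> E) (l : K) a :
  c @ F --> l -> f @ F --> a -> (fun x => c x *: f x) @ F --> l *: a.
Proof.
move=> fa gb; apply: (cvg_comp2 fa gb); exact: (@scale_continuous K E (l, a)).
Qed.

End Tvs.

Section MeanValue.
Variables (R : realType) (F : tvsType R).

Let quotient (f : R -> F) a b := (b - a)^-1 *: (f b - f a).

Lemma quotient_split (f : R -> F) (a s b : R) : a < b ->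
  quotient f a b = ((b - s) / (b - a)) *: quotient f s b +
                   ((s - a) / (b - a)) *: quotient f a s.
Proof.
move=> ab; have ba0 : b - a != 0 by rewrite subr_eq0 gt_eqF.
rewrite /quotient !scalerA ![_ / (b - a)]mulrC -!mulrA -!scalerA -scalerDr.
congr (_ *: _).
have dv (u v : R) : (u - v) *: ((u - v)^-1 *: (f u - f v)) = f u - f v.
  have [->|uv] := eqVneq u v; first by rewrite !subrr !scaler0.
  by rewrite scalerA mulfV ?scale1r// subr_eq0.
by rewrite !dv addrA subrK.
Qed.

Lemma quotient_convex (C : set F) (f : R -> F) a s b : @convex_set R F C ->
  a < b -> a <= s -> s <= b ->
  (s < b -> C (quotient f s b)) -> (a < s -> C (quotient f a s)) ->
  C (quotient f a b).
Proof.
move=> /convex_setP cC ab as_ sb Csb Cas.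
have [asE|as'] := eqVneq a s; first by rewrite asE in ab *; exact: Csb.
have [sbE|sb'] := eqVneq s b; first by rewrite -sbE in ab *; exact: Cas.
rewrite (quotient_split _ s ab).
have ba0 : 0 < b - a by rewrite subr_gt0.
have -> : (s - a) / (b - a) = 1 - (b - s) / (b - a).
  by field; rewrite gt_eqF.
apply: cC; [| | by apply: Csb; rewrite lt_neqAle sb' sb |
  by apply: Cas; rewrite lt_neqAle as' as_].
- by rewrite divr_ge0 ?subr_ge0// ltW.
- by rewrite ler_pdivrMr// mul1r lerD2l lerN2.
Qed.

(** Difference quotients over short intervals around $s$ are convex combinations of
   two difference quotients at $s$, hence lie in [C], which contains $f'(s)$ and is
   open and convex. Quotients over adjacent intervals combine in the same way. *)
Lemma convex_mean_value (C : set F) (f g : R -> F) :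
  open C -> @convex_set R F C ->
  (forall s, 0 <= s -> s <= 1 -> C (g s)) ->
  (forall s, 0 <= s -> s <= 1 -> t^-1 *: (f (s + t) - f s) @[t --> (0 : R)^'] --> g s) ->
  C (f 1 - f 0).
Proof.
move=> oC cC Cg fg.
have loc s : 0 <= s -> s <= 1 -> exists2 d : R, 0 < d &
    forall a b, a < b -> a <= s -> s <= b -> b - a < d -> C (quotient f a b).
  move=> s0 s1; have := fg s s0 s1 C (open_nbhs_nbhs (conj oC (Cg s s0 s1))).
  move=> -[/= d d0 dC]; exists d => // a b ab as_ sb bad.
  have q t : `|t| < d -> t != 0 -> C (t^-1 *: (f (s + t) - f s)).
    by move=> td t0; apply: dC => //=; rewrite sub0r normrN.
  apply: (@quotient_convex C f a s b) => //.
    move=> sb'; have := q (b - s); rewrite subrKC; apply.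
      by rewrite ger0_norm ?subr_ge0//; apply: le_lt_trans bad; rewrite lerD2l lerN2.
    by rewrite subr_eq0 gt_eqF.
  move=> as'; have := q (a - s); rewrite subrKC => Ca.
  have -> : quotient f a s = (a - s)^-1 *: (f a - f s).
    by rewrite /quotient -(opprB a) -(opprB (f a)) invrN scaleNr scalerN opprK.
  apply: Ca.
    rewrite distrC ger0_norm ?subr_ge0//; apply: le_lt_trans bad.
    by rewrite lerD2r.
  by rewrite subr_eq0 lt_eqF.
(* The supremum [c] of the parameters reached from [0] is [1]: otherwise the
   property extends beyond [c]. *)
pose S := [set s : R | [/\ 0 <= s, s <= 1 & 0 < s -> C (quotient f 0 s)]].
have S0 : S 0 by split=> //; rewrite ltxx.
have hs : has_sup S by split; [exists 0|exists 1 => s []].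
set c := sup S.
have c0 : 0 <= c by apply: ub_le_sup => //; case: hs.
have c1 : c <= 1 by apply: ge_sup; [exists 0|move=> s []].
have [d d0 dC] := loc c c0 c1.
have [s [s0 s1 Ss] cs] := sup_adherent (divr_gt0 d0 (ltr0n _ 2)) hs.
rewrite -/c in cs.
have sc : s <= c by apply: ub_le_sup; [case: hs|split].
have step b : 0 < b -> c <= b -> b - c < d / 2 -> C (quotient f 0 b).
  move=> b0 cb bcd; apply: (@quotient_convex C f 0 s b) => //.
    exact: le_trans cb.
  move=> sb; apply: dC => //; lra.
have {}c1 : c = 1.
  apply/eqP; rewrite eq_le c1 leNgt; apply/negP => c1'.
  pose b := Num.min 1 (c + d / 4).
  have cb : c < b.
    by rewrite lt_min c1' /= ltrDl divr_gt0.
  have b0 : 0 < b by exact: le_lt_trans cb.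
  have : b <= c.
    apply: ub_le_sup; first by case: hs.
    split; [exact: ltW|by rewrite ge_min lexx|move=> _].
    apply: step => //; first exact: ltW.
    rewrite ltrBlDl (@le_lt_trans _ _ (c + d / 4))//.
      by rewrite ge_min lexx orbT.
    by rewrite ltrD2l ltr_pM2l// ltf_pV2 ?posrE// ltr_nat.
  by rewrite leNgt cb.
have := step 1 ltr01; rewrite c1 lexx subrr divr_gt0// => /(_ isT isT).
by rewrite /quotient subr0 invr1 scale1r.
Qed.

End MeanValue.

(** * Hadamard derivatives *)

Section Derivatives.
Variable R : realType.
Implicit Types E F G : tvsType R.

(** The derivative along curves $t\mapsto x+th'$ with $h'\to h$; unlike plain
   directional derivatives, these compose, see [hadamard_comp]. *)
Definition hadamard E F (f : E -> F) (x h : E) (l : F) : Prop :=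
  (fun p : R * E => p.1^-1 *: (f (x + p.1 *: p.2) - f x)) @
    filter_prod ((0 : R)^') (nbhs h) --> l.

Lemma cvg_line E (x h : E) :
  (fun p : R * E => x + p.1 *: p.2) @ filter_prod (nbhs (0 : R)) (nbhs h) --> x.
Proof.
rewrite -[X in _ --> X]addr0 -[X in x + X](scale0r h).
apply: cvgD_tvs; first exact: cvg_cst.
by apply: cvgZ_tvs; [exact: cvg_fst|exact: cvg_snd].
Qed.

Lemma cvg_dline E (x h : E) :
  (fun p : R * E => x + p.1 *: p.2) @ filter_prod ((0 : R)^') (nbhs h) --> x.
Proof.
move=> N xN; have [[A B] [/= A0 B0] AB] := @cvg_line E x h N xN.
by exists (A, B) => //; split=> //; exact: nbhs_dnbhs.
Qed.

Lemma is_dirder_unique E F (f : E -> F) x h l m : hausdorff_space F ->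
  is_dirder f x h l -> is_dirder f x h m -> l = m.
Proof. by move=> hF fl fm; exact: (cvg_unique hF fl fm). Qed.

Lemma dirderE E F (f : E -> F) x h l : hausdorff_space F ->
  is_dirder f x h l -> dirder f x h = l.
Proof.
move=> hF fl; rewrite /dirder; case: xgetP => [m _ /= fm|/(_ l)//].
exact: (is_dirder_unique hF fm fl).
Qed.

Lemma is_dirder_dirder E F (f : E -> F) x h :
  (exists l, is_dirder f x h l) -> is_dirder f x h (dirder f x h).
Proof.
by move=> [l fl]; rewrite /dirder; case: xgetP => [m _ //|/(_ l)//].
Qed.

Lemma hadamard_dirder E F (f : E -> F) x h l :
  hadamard f x h l -> is_dirder f x h l.
Proof.
move=> fl; rewrite /is_dirder.
apply: (cvg_comp (fun t : R => (t, h)) _ _ fl).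
by apply: cvg_filter_prod; [exact: cvg_id|exact: cvg_cst].
Qed.

Lemma hadamard_near E F (f g : E -> F) x h l : (\near x, f x = g x) ->
  hadamard f x h l -> hadamard g x h l.
Proof.
move=> fg; have fgx : f x = g x by exact: nbhs_singleton fg.
by apply: (@cvg_eq_on _ _ (filter_prod ((0 : R)^') (nbhs h)) _ _
  [set p | f (x + p.1 *: p.2) = g (x + p.1 *: p.2)] _ _ (@cvg_dline E x h _ fg)) =>
  p /= pE; rewrite fgx pE.
Qed.

Lemma is_dirder_near E F (f g : E -> F) x h l : (\near x, f x = g x) ->
  is_dirder f x h l -> is_dirder g x h l.
Proof.
move=> fg; have fgx : f x = g x by exact: nbhs_singleton fg.
have xh : (fun t : R => x + t *: h) @ (0 : R)^' --> x.
  apply: (cvg_comp (fun t : R => (t, h)) _ _ (@cvg_dline E x h)).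
  by apply: cvg_filter_prod; [exact: cvg_id|exact: cvg_cst].
by apply: (@cvg_eq_on _ _ ((0 : R)^') _ _
  [set t | f (x + t *: h) = g (x + t *: h)] _ _ (xh _ fg)) => p /= pE; rewrite fgx pE.
Qed.

Lemma dirder_near E F (f g : E -> F) x h : (\near x, f x = g x) ->
  dirder f x h = dirder g x h.
Proof.
move=> fg; rewrite /dirder; congr xget; apply/seteqP; split=> l /=.
  exact: is_dirder_near.
by apply: is_dirder_near; apply: filterS fg.
Qed.

Lemma dprod_neq0 E (h : E) :
  filter_prod ((0 : R)^') (nbhs h) [set p : R * E | p.1 != 0].
Proof.
exists ([set t : R | t != 0], setT) => [|[t k] [/=]//].
by split; [exact: withinT|exact: filterT].
Qed.

Lemma hadamard_id E (x h : E) : hadamard (@id E) x h h.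
Proof.
rewrite /hadamard; apply: cvg_eq_on (dprod_neq0 h) _ cvg_snd => -[t k] /= t0.
by rewrite addrC addKr scalerA mulVf// scale1r.
Qed.

(** The increment of [f] is $t$ times its difference quotient, which tends to [l]:
   so the difference quotient of the composite is one of [g] along a curve of the
   kind that the Hadamard derivative of [g] at [f x] admits. *)
Lemma hadamard_comp E F G (f : E -> F) (g : F -> G) x h l m :
  hadamard f x h l -> hadamard g (f x) l m -> hadamard (g \o f) x h m.
Proof.
move=> fl gm.
have fl' : (fun p : R * E => (p.1, p.1^-1 *: (f (x + p.1 *: p.2) - f x))) @
    filter_prod ((0 : R)^') (nbhs h) `=>` filter_prod ((0 : R)^') (nbhs l).
  by apply: cvg_filter_prod => //; exact: cvg_fst.
apply: cvg_eq_on (dprod_neq0 h) _ (cvg_comp _ _ fl' gm) => -[t k] /= t0.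
by rewrite scalerA mulfV// scale1r subrKC.
Qed.

Lemma is_dirder_pair E F G (f : E -> F) (g : E -> G) x h l :
  is_dirder (fun z => (f z, g z) : (F * G)%type) x h l <->
  is_dirder f x h l.1 /\ is_dirder g x h l.2.
Proof. by rewrite /is_dirder cvg_pairP. Qed.

(** The increment quotient $t^{-1}(f(x+tk)-f(x))$ belongs to any open convex set
   containing the derivatives $f'(x+stk,k)$, $0\le s\le1$, by the mean value
   theorem; these are close to $f'(x,h)$ for $k$ near $h$ and $t$ near $0$. *)
Lemma C1_hadamard E F (U : set E) (f : E -> F) (f' : E -> E -> F) x h :
  open U -> U x ->
  (forall y k, U y -> is_dirder f y k (f' y k)) ->
  {for (x, h), continuous (fun p : E * E => f' p.1 p.2)} ->
  hadamard f x h (f' x h).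
Proof.
move=> oU Ux ff' cf' N /tvs_convex_nbhs[C [oC cC Cl CN]].
have [[A B] [/= Ax Bh] ABC] : nbhs (x, h) [set p : E * E | C (f' p.1 p.2)].
  by apply: cf'; exact: open_nbhs_nbhs.
have [[T B'] [/= T0 B'h] TB'] := @cvg_line E x h (U `&` A)
  (filterI (open_nbhs_nbhs (conj oU Ux)) Ax).
have [e /= e0 eT] := T0.
exists ([set t : R | `|t| < e /\ t != 0], B `&` B') => /=.
  split; last exact: filterI.
  by exists e => //= t /= te t0; split=> //; move: te; rewrite sub0r normrN.
move=> [t k] [/= [te t0] [Bk B'k]]; apply: CN.
have line s : 0 <= s -> s <= 1 -> (U `&` A) (x + (s * t) *: k).
  move=> s0 s1; apply: (TB' (s * t, k)); split=> //=; apply: eT => /=.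
  rewrite sub0r normrN normrM ger0_norm//.
  by apply: le_lt_trans te; rewrite ler_piMl.
(* The factor $t^{-1}$ cancels the inner derivative of $s\mapsto x+stk$. *)
have := @convex_mean_value R F C (fun s => t^-1 *: f (x + (s * t) *: k))
  (fun s => f' (x + (s * t) *: k) k) oC cC.
rewrite mul0r scale0r addr0 mul1r scalerBr; apply.
  by move=> s s0 s1; have [_ As] := line s s0 s1; exact: (ABC (_, k)).
move=> s s0 s1; have [Us _] := line s s0 s1.
have tau : (fun r : R => r * t) @ (0 : R)^' --> (0 : R)^'.
  move=> V [d /= d0 dV]; exists (d / `|t|); first by rewrite /= divr_gt0// normr_gt0.
  move=> r /= rd r0; apply: dV => /=; last by rewrite mulf_neq0.
  by move: rd; rewrite !sub0r !normrN normrM ltr_pdivlMr// normr_gt0.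
apply: cvg_eq_on filterT _ (cvg_comp _ _ tau (ff' _ k Us)) => r _ /=.
rewrite -scalerBr scalerA invfM mulrDl scalerDl; congr (_ *: (f _ - _)).
by rewrite addrA.
Qed.

End Derivatives.

(** * Maps of class $C^m$ *)

Section SmoothMaps.
Variable R : realType.
Implicit Types E F G H : tvsType R.

Definition differential E F (f : E -> F) : (E * E)%type -> F :=
  fun p => dirder f p.1 p.2.

(** The recursion goes through the derivative of [f] on $U\times E$, and not
   through the last iterated derivative as in [Ck_on]: with all maps and domains
   general, the closure properties below follow by induction. The equivalence is
   [Ck_on_smooth]. *)
Fixpoint smooth m E F (U : set E) (f : E -> F) : Prop :=
  (forall x, U x -> {for x, continuous f}) /\
  if m is n.+1 then
    (forall x h, U x -> exists l, is_dirder f x h l) /\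
    smooth n (U `*` [set: E]) (differential f)
  else True.

Definition continuous_linear E F (f : E -> F) : Prop :=
  continuous f /\ forall (t : R) x y, f (x + t *: y) = f x + t *: f y.

Definition continuous_bilinear F G H (b : F -> G -> H) : Prop :=
  [/\ continuous (fun p : F * G => b p.1 p.2),
      forall (t : R) x y z, b (x + t *: y) z = b x z + t *: b y z &
      forall (t : R) x y z, b z (x + t *: y) = b z x + t *: b z y].

Lemma continuous_linear_fst E F : continuous_linear (@fst E F : (E * F)%type -> E).
Proof. by split=> //; exact: continuous_fst. Qed.

Lemma continuous_linear_prod E F (f : E -> F) : continuous_linear f ->
  continuous_linear (fun p : E * E => (f p.1, f p.2) : (F * F)%type).
Proof.
move=> [cf lf]; split=> [p|t x y]; last by rewrite /= !lf.
apply/cvg_pairP; split.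
  exact: (@continuous_comp _ _ _ fst f p (@continuous_fst E E p) (cf p.1)).
exact: (@continuous_comp _ _ _ snd f p (@continuous_snd E E p) (cf p.2)).
Qed.

Lemma smooth_continuous m E F (U : set E) (f : E -> F) x :
  smooth m U f -> U x -> {for x, continuous f}.
Proof. by case: m => [|m] [cf _]; exact: cf. Qed.

Lemma smooth_dirder m E F (U : set E) (f : E -> F) x h :
  smooth m.+1 U f -> U x -> is_dirder f x h (dirder f x h).
Proof. by move=> [_ [df _]] Ux; apply: is_dirder_dirder; exact: df. Qed.

Lemma smooth_sub m E F (U V : set E) (f : E -> F) :
  V `<=` U -> smooth m U f -> smooth m V f.
Proof.
elim: m E U V f => [|m IHm] E U V f VU /= [cf].
  by move=> _; split=> // x /VU; exact: cf.
move=> [df sf]; split=> [x /VU|]; first exact: cf.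
split=> [x h /VU|]; first exact: df.
by apply: IHm sf => -[x h] [/VU].
Qed.

Lemma smoothW m E F (U : set E) (f : E -> F) : smooth m.+1 U f -> smooth m U f.
Proof.
elim: m E U f => [|m IHm] E U f [cf [df sf]]; first by split.
by split=> //; split=> //; exact: IHm.
Qed.

Lemma smooth_eq m E F (U : set E) (f g : E -> F) : open U ->
  (forall x, U x -> f x = g x) -> smooth m U f -> smooth m U g.
Proof.
elim: m E U f g => [|m IHm] E U f g oU fg.
  move=> [cf _]; split=> // x Ux; rewrite /prop_for/continuous_at -fg//.
  have xU := open_nbhs_nbhs (conj oU Ux).
  exact: cvg_eq_on xU fg (cf x Ux).
move=> [cf [df sf]]; split.
  move=> x Ux; rewrite /prop_for/continuous_at -fg//.
  have xU := open_nbhs_nbhs (conj oU Ux).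
  exact: cvg_eq_on xU fg (cf x Ux).
have near_fg x : U x -> \near x, f x = g x.
  move=> Ux; apply: filterS fg _.
  exact: open_nbhs_nbhs.
split=> [x h Ux|].
  have [l fl] := df x h Ux; exists l.
  exact: is_dirder_near (near_fg x Ux) fl.
apply: IHm sf; first exact: openX_setT.
by move=> [x h] [/= Ux _]; exact: dirder_near (near_fg x Ux).
Qed.

Lemma smooth_hadamard m E F (U : set E) (f : E -> F) x h : open U ->
  smooth m.+1 U f -> U x -> hadamard f x h (dirder f x h).
Proof.
move=> oU sf Ux; apply: (@C1_hadamard _ _ _ U f (dirder f)) => //.
  by move=> y k Uy; exact: smooth_dirder sf Uy.
have [_ [_ sdf]] := sf.
exact: (smooth_continuous sdf (conj Ux I : (U `*` [set: E]) (x, h))).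
Qed.

Lemma is_dirder_precomp E F G (p : E -> F) (f : F -> G) x h l :
  continuous_linear p -> is_dirder f (p x) (p h) l -> is_dirder (f \o p) x h l.
Proof. by move=> [_ lp]; rewrite /is_dirder /=; under eq_fun do rewrite -lp. Qed.

Lemma smooth_precomp m E F G (U : set F) (V : set E) (p : E -> F) (f : F -> G) :
  hausdorff_space G -> open V -> continuous_linear p -> V `<=` p @^-1` U ->
  smooth m U f -> smooth m V (f \o p).
Proof.
move=> hG; elim: m E F U V p f => [|m IHm] E F U V p f oV lp VU sf.
  split=> // x /VU Ux; apply: continuous_comp; first by case: lp => + _; exact.
  exact: smooth_continuous sf Ux.
split.
  move=> x /VU Ux; apply: continuous_comp; first by case: lp => + _; exact.
  exact: smooth_continuous sf Ux.
have dfp x h : V x -> is_dirder (f \o p) x h (dirder f (p x) (p h)).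
  move=> /VU Ux; apply: is_dirder_precomp => //; exact: smooth_dirder sf Ux.
split=> [x h Vx|]; first by exists (dirder f (p x) (p h)); exact: dfp.
have [_ [_ sdf]] := sf.
apply: (@smooth_eq _ _ _ _
    (differential f \o (fun q : E * E => (p q.1, p q.2) : (F * F)%type))).
- exact: openX_setT.
- by move=> [x h] [/= Vx _]; rewrite /differential (dirderE hG (dfp x h Vx)).
- apply: IHm sdf; [exact: openX_setT|exact: continuous_linear_prod|].
  by move=> [x h] [/= /VU].
Qed.

Lemma is_dirder_postcomp E F G (f : E -> F) (p : F -> G) x h l :
  continuous_linear p -> is_dirder f x h l -> is_dirder (p \o f) x h (p l).
Proof.
move=> [cp lp] fl; have p0 : p 0 = 0.
  by have := lp (- 1) 0 0; rewrite scaler0 addr0 scaleN1r subrr.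
have pZ t y : p (t *: y) = t *: p y by rewrite -[t *: y]add0r lp p0 add0r.
have pB y z : p (y - z) = p y - p z by rewrite -(scaleN1r z) lp scaleN1r.
rewrite /is_dirder.
apply: cvg_eq_on filterT _
  (cvg_comp (fun t : R => t^-1 *: (f (x + t *: h) - f x)) p fl (cp l)) => t _ /=.
by rewrite pZ pB.
Qed.

Lemma smooth_postcomp m E F G (U : set E) (p : F -> G) (f : E -> F) :
  hausdorff_space G -> open U -> continuous_linear p ->
  smooth m U f -> smooth m U (p \o f).
Proof.
move=> hG; elim: m E U f => [|m IHm] E U f oU lp sf.
  split=> // x Ux; apply: continuous_comp; first exact: smooth_continuous sf Ux.
  by case: lp => + _; exact.
split.
  move=> x Ux; apply: continuous_comp; first exact: smooth_continuous sf Ux.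
  by case: lp => + _; exact.
have dfp x h : U x -> is_dirder (p \o f) x h (p (dirder f x h)).
  by move=> Ux; apply: is_dirder_postcomp => //; exact: smooth_dirder sf Ux.
split=> [x h Ux|]; first by exists (p (dirder f x h)); exact: dfp.
have [_ [_ sdf]] := sf.
apply: (@smooth_eq _ _ _ _ (p \o differential f)).
- exact: openX_setT.
- by move=> [x h] [/= Ux _]; rewrite /differential (dirderE hG (dfp x h Ux)).
- by apply: IHm sdf => //; exact: openX_setT.
Qed.

Lemma smooth_pair m E F G (U : set E) (f : E -> F) (g : E -> G) :
  hausdorff_space F -> hausdorff_space G -> open U ->
  smooth m U f -> smooth m U g ->
  smooth m U (fun x => (f x, g x) : (F * G)%type).
Proof.
move=> hF hG; elim: m E U f g => [|m IHm] E U f g oU sf sg.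
  split=> // x Ux; apply/cvg_pairP.
  by split; [exact: smooth_continuous sf Ux|exact: smooth_continuous sg Ux].
split.
  move=> x Ux; apply/cvg_pairP.
  by split; [exact: smooth_continuous sf Ux|exact: smooth_continuous sg Ux].
have dfg x h : U x -> is_dirder (fun x => (f x, g x) : (F * G)%type) x h
    (dirder f x h, dirder g x h).
  move=> Ux; apply/is_dirder_pair; split; first exact: smooth_dirder sf Ux.
  exact: smooth_dirder sg Ux.
split=> [x h Ux|]; first by eexists; exact: dfg.
have [_ [_ sdf]] := sf; have [_ [_ sdg]] := sg.
apply: (@smooth_eq _ _ _ _ (fun q => (differential f q, differential g q))).
- exact: openX_setT.
- move=> [x h] [/= Ux _]; rewrite /differential; apply/esym/dirderE; last exact: dfg.
  exact: hausdorff_prod.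
- by apply: IHm sdf sdg => //; exact: openX_setT.
Qed.

Lemma continuous_linearD E :
  continuous_linear (fun p : E * E => p.1 + p.2 : E).
Proof.
split; first exact: (@add_continuous E).
by move=> t x y /=; rewrite scalerDr addrACA.
Qed.

Lemma smoothD m E F (U : set E) (f g : E -> F) : hausdorff_space F -> open U ->
  smooth m U f -> smooth m U g -> smooth m U (fun x => f x + g x).
Proof.
move=> hF oU sf sg.
exact: smooth_postcomp hF oU (continuous_linearD F) (smooth_pair hF hF oU sf sg).
Qed.

Lemma is_dirderD E F (f g : E -> F) x h l k : is_dirder f x h l ->
  is_dirder g x h k -> is_dirder (fun x => f x + g x) x h (l + k).
Proof.
move=> fl gk.
apply: (@is_dirder_postcomp _ _ _ (fun z => (f z, g z) : (F * F)%type)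
  (fun p => p.1 + p.2) x h (l, k)); first exact: continuous_linearD.
by apply/is_dirder_pair.
Qed.

Lemma is_dirder_bilinear E F G H (b : F -> G -> H) (f : E -> F) (g : E -> G) x h l k :
  continuous_bilinear b -> is_dirder f x h l -> is_dirder g x h k ->
  is_dirder (fun x => b (f x) (g x)) x h (b l (g x) + b (f x) k).
Proof.
move=> [cb bl br] fl gk.
have bl0 z : b 0 z = 0.
  by have := bl (- 1) 0 0 z; rewrite scaler0 addr0 scaleN1r subrr.
have br0 z : b z 0 = 0.
  by have := br (- 1) 0 0 z; rewrite scaler0 addr0 scaleN1r subrr.
have gx : (fun t : R => g (x + t *: h)) @ (0 : R)^' --> g x.
  have t0 : (id : R -> R) @ (0 : R)^' --> (0 : R).
    by move=> N /nbhs_dnbhs.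
  have gl : (fun t : R => g x + t *: (t^-1 *: (g (x + t *: h) - g x))) @ (0 : R)^'
      --> g x + 0 *: k.
    by apply: cvgD_tvs; [exact: cvg_cst|exact: cvgZ_tvs].
  rewrite scale0r addr0 in gl.
  apply: (@cvg_eq_on _ _ ((0 : R)^') _ _ [set t | t != 0] _ _ _ _ gl).
    exact: withinT.
  by move=> t /= t0'; rewrite scalerA mulfV// scale1r subrKC.
(* As in the usual proof of the product rule, [g] is moved before [f]. *)
have bfg (t : R) : t^-1 *: (b (f (x + t *: h)) (g (x + t *: h)) - b (f x) (g x)) =
    b (t^-1 *: (f (x + t *: h) - f x)) (g (x + t *: h)) +
    b (f x) (t^-1 *: (g (x + t *: h) - g x)).
  set f' := f (_ + _); set g' := g (_ + _).
  rewrite -[t^-1 *: (f' - _)]add0r -[t^-1 *: (g' - _)]add0r bl br bl0 br0 !add0r.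
  rewrite -scalerDr -(scaleN1r (f x)) -(scaleN1r (g x)) bl br !scaleN1r.
  by rewrite addrA subrK.
rewrite /is_dirder; apply: cvg_eq_on filterT _ (cvgD_tvs
  (cvg_comp2 fl gx (cb (l, g x))) (cvg_comp2 (cvg_cst (f x)) gk (cb (f x, k)))) => t _ /=.
by rewrite bfg.
Qed.

Lemma dirder_bilinear m E F G H (b : F -> G -> H) (f : E -> F) (g : E -> G) (U : set E) x h :
  continuous_bilinear b -> hausdorff_space H -> smooth m.+1 U f -> smooth m.+1 U g ->
  U x -> dirder (fun x => b (f x) (g x)) x h =
         b (dirder f x h) (g x) + b (f x) (dirder g x h).
Proof.
move=> bb hH sf sg Ux; apply: dirderE => //.
by apply: is_dirder_bilinear => //; [exact: smooth_dirder sf Ux|exact: smooth_dirder sg Ux].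
Qed.

Lemma smooth_fst m E F (U : set E) (f : E -> F) : hausdorff_space F -> open U ->
  smooth m U f -> smooth m (U `*` [set: E]) (fun q => f q.1).
Proof.
move=> hF oU sf; apply: (smooth_precomp hF _ (continuous_linear_fst _ _) _ sf).
  exact: openX_setT.
by move=> [x h] [].
Qed.

(** By the product rule, the derivative is a sum of two maps of the same form,
   which is where the stability under sums and under composition with the
   projection $U\times E\to U$ comes in. *)
Lemma smooth_bilinear m E F G H (b : F -> G -> H) (U : set E) (f : E -> F) (g : E -> G) :
  continuous_bilinear b -> hausdorff_space F -> hausdorff_space G ->
  hausdorff_space H -> open U -> smooth m U f -> smooth m U g ->
  smooth m U (fun x => b (f x) (g x)).
Proof.
move=> bb hF hG hH; elim: m E U f g => [|m IHm] E U f g oU sf sg.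
  split=> // x Ux; case: bb => cb _ _.
  exact: cvg_comp2 (smooth_continuous sf Ux) (smooth_continuous sg Ux) (cb (f x, g x)).
split.
  move=> x Ux; case: bb => cb _ _.
  exact: cvg_comp2 (smooth_continuous sf Ux) (smooth_continuous sg Ux) (cb (f x, g x)).
split=> [x h Ux|].
  eexists; apply: is_dirder_bilinear => //; first exact: smooth_dirder sf Ux.
  exact: smooth_dirder sg Ux.
have [_ [_ sdf]] := sf; have [_ [_ sdg]] := sg.
apply: (@smooth_eq _ _ _ _ (fun q : (E * E)%type =>
  b (differential f q) (g q.1) + b (f q.1) (differential g q))).
- exact: openX_setT.
- by move=> [x h] [/= Ux _]; rewrite -(dirder_bilinear h bb hH sf sg Ux).
- apply: smoothD => //; first exact: openX_setT.
    by apply: IHm => //; [exact: openX_setT|apply: smooth_fst => //; exact: smoothW].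
  by apply: IHm => //; [exact: openX_setT|apply: smooth_fst => //; exact: smoothW].
Qed.

(** The $n$-th derivative of $df$ and the $(n+1)$-st derivative of [f] live on types
   that are only propositionally equal. Quantifying over the properties [P] of maps
   on open subsets of arbitrary spaces transfers statements without transport. *)
Lemma iter_dirder_shift F (P : forall E, set E -> (E -> F) -> Prop) n E
    (U : set E) (f : E -> F) :
  P (iter_prod (E * E)%type n) (@iter_dom R (E * E)%type (U `*` [set: E]) n)
    (@iter_dirder R (E * E)%type F (differential f) n) <->
  P (iter_prod E n.+1) (@iter_dom R E U n.+1) (@iter_dirder R E F f n.+1).
Proof.
elim: n P => [//|n IHn] P.
exact: (IHn (fun E U f => P (E * E)%type (U `*` [set: E]) (differential f))).
Qed.

Lemma Ck_onE E F (U : set E) (f : E -> F) n :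
  Ck_on U f n <-> {within U, continuous f} /\
    forall k, (k < n)%N -> C1_on (@iter_dom R E U k) (@iter_dirder R E F f k).
Proof.
elim: n => [|n IHn] /=; first by split=> [|[]].
rewrite IHn; split=> [[[cf Cf] Cn]|[cf Cf]].
  by split=> // k; rewrite ltnS leq_eqVlt => /orP[/eqP ->//|]; exact: Cf.
by split; [split=> // k kn; exact/Cf/ltnW|exact: Cf].
Qed.

Lemma Ck_onS E F (U : set E) (f : E -> F) n :
  Ck_on U f n.+1 <-> C1_on U f /\ Ck_on (U `*` [set: E]) (differential f) n.
Proof.
rewrite !Ck_onE; split=> [[cf Cf]|[C1f [cdf Cf]]].
  have C1f : C1_on U f by exact: (Cf 0%N).
  split=> //; split; first by case: C1f.
  move=> k kn.
  by apply/(iter_dirder_shift (fun E U f => C1_on U f)); exact: (Cf k.+1).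
split; first by case: C1f.
case=> [//|k kn].
by apply/(iter_dirder_shift (fun E U f => C1_on U f)); exact: Cf.
Qed.

Lemma Ck_on_smooth E F (U : set E) (f : E -> F) n : open U ->
  Ck_on U f n <-> smooth n U f.
Proof.
elim: n E U f => [|n IHn] E U f oU.
  by rewrite /= open_continuousP//; split=> [|[]].
rewrite Ck_onS (IHn (E * E)%type)/=; last exact: openX_setT.
have oUE : open (U `*` [set: E]) by exact: openX_setT.
split=> [[[/open_continuousP cf df _] sdf]|[cf [df sdf]]].
  by split; [exact: cf|split].
split=> //; split; [exact/open_continuousP|exact: df|apply/open_continuousP => //].
by move=> p; exact: smooth_continuous sdf.
Qed.

End SmoothMaps.

(** * Charts and tangent vectors *)

Section Charts.
Variable R : realType.
Implicit Types (X : charted R) (F : tvsType R).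

(** [is_manifold] with the transition maps required to be [smooth] of a finite
   order, so that the order can be lowered by one in passing to the tangent
   bundle *)
Definition smooth_manifold m X : Prop :=
  [/\ hausdorff_space X /\ (forall i : chart_index X, hausdorff_space (model i)),
      (forall i : chart_index X, open (chart_dom i)) /\
        \bigcup_(i in [set: chart_index X]) chart_dom i = [set: X],
      forall i : chart_index X,
        [/\ {in chart_dom i &, injective (chart i)},
            {within chart_dom i, continuous (chart i)} &
            forall U, open U -> U `<=` chart_dom i -> open (chart i @` U)] &
      forall (i j : chart_index X),
        smooth m (chart i @` (chart_dom i `&` chart_dom j)) (@transition R X i j)].

Definition smooth_on_charts m X F (g : X -> F) : Prop :=
  forall i : chart_index X,
    smooth m (chart i @` chart_dom i) (in_chart (i := i) g).

Lemma is_manifold_smooth r m X : is_manifold r X -> order_le m r ->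
  smooth_manifold m X.
Proof.
move=> [hX [oX cX] chX trX] mr; split=> // i j.
have [_ _ och] := chX i.
by apply/Ck_on_smooth; [apply: och => [|x []//]; exact: openI|exact: trX].
Qed.

Section Chart.
Variables (m : nat) (X : charted R).
Hypothesis mX : smooth_manifold m X.
Implicit Types (i j : chart_index X) (x : X).

Lemma chart_dom_open i : open (chart_dom i).
Proof. by case: mX => _ []. Qed.

Lemma chart_cover x : exists i, chart_dom i x.
Proof.
case: mX => _ [_ cX] _ _.
have : [set: X] x by [].
by rewrite -cX => -[i _ ix]; exists i.
Qed.

Lemma model_hausdorff i : hausdorff_space (model i).
Proof. by case: mX => -[]. Qed.

Lemma chart_inj i x y : chart_dom i x -> chart_dom i y ->
  chart i x = chart i y -> x = y.
Proof.
by case: mX => _ _ chX _ ix iy; have [inj _ _] := chX i; apply: inj; exact/mem_set.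
Qed.

Lemma chart_image_open i (U : set X) :
  open U -> U `<=` chart_dom i -> open (chart i @` U).
Proof. by case: mX => _ _ chX _; have [_ _] := chX i; exact. Qed.

Lemma chart_codom_open i : open (chart i @` chart_dom i).
Proof. by apply: chart_image_open => //; exact: chart_dom_open. Qed.

Lemma overlap_open i j : open (chart i @` (chart_dom i `&` chart_dom j)).
Proof.
by apply: chart_image_open => [|x []//]; apply: openI; exact: chart_dom_open.
Qed.

Lemma chart_continuous i x : chart_dom i x -> {for x, continuous (chart i)}.
Proof.
case: mX => _ _ chX _; have [_ + _] := chX i.
by rewrite open_continuousP; [apply|exact: chart_dom_open].
Qed.

Lemma chart_nbhs i x (N : set X) : chart_dom i x -> nbhs x N ->
  nbhs (chart i x) (chart i @` (N `&` chart_dom i)).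
Proof.
move=> ix; rewrite nbhsE => -[O [oO Ox] ON].
apply: (@filterS _ _ _ (chart i @` (O `&` chart_dom i))).
  by move=> _ [y [Oy iy] <-]; exists y => //; split => //; exact: ON.
apply: open_nbhs_nbhs; split; last by exists x.
by apply: chart_image_open => [|y []//]; apply: openI => //; exact: chart_dom_open.
Qed.

Lemma chart_preimage_compact i (L : set (model i)) :
  compact L -> L `<=` chart i @` chart_dom i ->
  compact (chart_dom i `&` chart i @^-1` L).
Proof.
move=> cL Li; set K := _ `&` _.
apply/compact_near_coveringP/near_covering_withinP => I G P FG KP.
have /near_covering_withinP cov := (compact_near_coveringP _).1 cL.
have := cov I G (fun k y => forall x, chart_dom i x -> chart i x = y -> P k x) FG.
have H y : L y -> \forall y' \near y & k \near G, L y' ->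
    forall x, chart_dom i x -> chart i x = y' -> P k x.
  move=> /[dup] Ly /Li [x ix xy]; have Kx : K x by split=> //=; rewrite xy.
  have [[A B] [/= xA GB] AB] := KP x Kx; rewrite -xy.
  exists (chart i @` (A `&` chart_dom i), B) => /=.
    by split=> //; exact: (chart_nbhs ix xA).
  move=> [_ k] [/= [x' [Ax' ix'] <-] Bk] Lx' x'' ix'' x''E.
  have {ix''}x''E := chart_inj ix'' ix' x''E; rewrite x''E.
  by apply: (AB (x', k)).
move=> /(_ H); apply: (@filterS _ G FG) => k kL x [ix Lx].
exact: kL Lx x ix erefl.
Qed.

Lemma in_chartE F i (f : X -> F) x : chart_dom i x ->
  in_chart (i := i) f (chart i x) = f x.
Proof.
move=> ix; rewrite /in_chart; case: pselect => [yP|[]]; last by exists x.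
by congr f; case: cid => y /= [iy /(chart_inj iy ix)].
Qed.

Lemma in_chart_continuous F i (f : X -> F) x : chart_dom i x ->
  {for chart i x, continuous (in_chart (i := i) f)} <-> {for x, continuous f}.
Proof.
move=> ix; split=> cf.
  have ixn := open_nbhs_nbhs (conj (chart_dom_open i) ix).
  rewrite /prop_for/continuous_at -(in_chartE f ix).
  apply: cvg_eq_on ixn (@in_chartE F i f) _.
  by apply: continuous_comp => //; exact: chart_continuous.
rewrite /prop_for/continuous_at in_chartE// => N /cf xN.
apply: filterS (chart_nbhs ix xN) => _ [y [Ny iy] <-].
by rewrite /= in_chartE.
Qed.

Lemma smooth_on_charts_continuous n F (g : X -> F) :
  smooth_on_charts n g -> continuous g.
Proof.
move=> sg x; have [i ix] := chart_cover x.
by apply/(in_chart_continuous g ix)/(smooth_continuous (sg i)); exists x.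
Qed.

Lemma transitionE i j x : chart_dom i x -> @transition R X i j (chart i x) = chart j x.
Proof. exact: in_chartE. Qed.

Lemma transition_smooth i j :
  smooth m (chart i @` (chart_dom i `&` chart_dom j)) (@transition R X i j).
Proof. by case: mX. Qed.

Lemma in_chart_change F (g : X -> F) i j x : chart_dom i x -> chart_dom j x ->
  \forall y \near chart i x,
    (in_chart (i := j) g \o @transition R X i j) y = in_chart (i := i) g y.
Proof.
move=> ix jx; have := chart_nbhs ix (open_nbhs_nbhs (conj (chart_dom_open j) jx)).
apply: filterS => _ [y [jy iy] <-].
by rewrite /= transitionE// !in_chartE.
Qed.

End Chart.

Section Tangent.
Variables (m : nat) (X : charted R).
Hypothesis mX : smooth_manifold m.+1 X.
Implicit Types (i j k : chart_index X) (x : X).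

Lemma transition_hadamard i j x v : chart_dom i x -> chart_dom j x ->
  hadamard (@transition R X i j) (chart i x) v (dirder (@transition R X i j) (chart i x) v).
Proof.
move=> ix jx; apply: (smooth_hadamard _ (transition_smooth mX i j)); last by exists x.
exact: overlap_open mX i j.
Qed.

(** The chain rule for the local representatives in two charts, which differ by a
   transition map near the point *)
Lemma in_chart_change_hadamard F (g : X -> F) i j x v l :
  chart_dom i x -> chart_dom j x ->
  hadamard (in_chart (i := j) g) (chart j x)
    (dirder (@transition R X i j) (chart i x) v) l ->
  hadamard (in_chart (i := i) g) (chart i x) v l.
Proof.
move=> ix jx gl; apply: hadamard_near (in_chart_change mX g ix jx) _.
rewrite -(transitionE mX j ix) in gl.
exact: hadamard_comp (transition_hadamard ix jx) gl.
Qed.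

Lemma dirder_in_chart_change F (g : X -> F) n i j x v : hausdorff_space F ->
  smooth_on_charts n.+1 g -> chart_dom i x -> chart_dom j x ->
  dirder (in_chart (i := i) g) (chart i x) v =
  dirder (in_chart (i := j) g) (chart j x)
    (dirder (@transition R X i j) (chart i x) v).
Proof.
move=> hF sg ix jx; apply: dirderE => //; apply: hadamard_dirder.
apply: (in_chart_change_hadamard ix jx) => //.
apply: (smooth_hadamard _ (sg j)); last by exists x.
exact: chart_codom_open mX j.
Qed.

(** The chart [k] is itself a map whose representative in the chart [j] is the
   transition map from [j] to [k]. *)
Lemma transition_cocycle i j k x v :
  chart_dom i x -> chart_dom j x -> chart_dom k x ->
  dirder (@transition R X i k) (chart i x) v =
  dirder (@transition R X j k) (chart j x)
    (dirder (@transition R X i j) (chart i x) v).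
Proof.
move=> ix jx kx; apply: dirderE; first exact: model_hausdorff mX k.
apply: hadamard_dirder; apply: (in_chart_change_hadamard ix jx) => //.
exact: transition_hadamard.
Qed.

Lemma transition_refl i x v : chart_dom i x ->
  dirder (@transition R X i i) (chart i x) v = v.
Proof.
move=> ix; apply: dirderE; first exact: model_hausdorff mX i.
apply: hadamard_dirder; apply: hadamard_near (@hadamard_id _ _ _ _).
apply: filterS (open_nbhs_nbhs (conj (chart_codom_open mX i) _)); last by exists x.
by move=> _ [y iy <-]; rewrite (transitionE mX).
Qed.

Section TangentVector.
Variables (i : chart_index X) (x : X) (v : model i) (ix : chart_dom i x).

Let tangent_comp j : model j :=
  if pselect (chart_dom j x) then dirder (@transition R X i j) (chart i x) v else 0.

Let tangent_compE j : chart_dom j x ->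
  tangent_comp j = dirder (@transition R X i j) (chart i x) v.
Proof. by rewrite /tangent_comp; case: pselect. Qed.

Let tangent_comp_transition j k : chart_dom j x -> chart_dom k x ->
  tangent_comp k = dirder (@transition R X j k) (chart j x) (tangent_comp j).
Proof.
by move=> jx kx; rewrite !tangent_compE//; exact: transition_cocycle.
Qed.

Let tangent_comp_out j : ~ chart_dom j x -> tangent_comp j = 0.
Proof. by rewrite /tangent_comp => jx; case: pselect. Qed.

(** The tangent vector represented by [v] in the chart [i]. Its component in the
   chart [j] is the differential of the transition map applied to [v]; that these
   components are compatible is the cocycle identity. *)
Definition vector_at : tangent X :=
  TangentVector tangent_comp_transition tangent_comp_out.

Lemma vector_at_comp j : chart_dom j x ->
  Defs.comp vector_at j = dirder (@transition R X i j) (chart i x) v.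
Proof. exact: tangent_compE. Qed.

Lemma vector_at_chart : chart (c := tangent X) i vector_at = (chart i x, v).
Proof. by rewrite /chart/= /tangent_chart vector_at_comp//= transition_refl. Qed.

End TangentVector.

(** One component determines all others by the transition rule. *)
Lemma tangent_vector_eq i (w w' : tangent X) : base w = base w' ->
  chart_dom i (base w) -> Defs.comp w i = Defs.comp w' i -> w = w'.
Proof.
case: w w' => [x c ct co] [x' c' ct' co'] /= xx'; case: x' / xx' ct' co'.
move=> ct' co' ix cc'.
have cE : c = c'.
  apply: functional_extensionality_dep => j.
  have [jx|jx] := pselect (chart_dom j x); last by rewrite co// co'.
  by rewrite (ct i j)// (ct' i j)// cc'.
by case: c' / cE ct' co' cc' => ct' co' _; congr TangentVector; exact: Prop_irrelevance.
Qed.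

End Tangent.
End Charts.

(** * The tangent bundle as a manifold *)

Section TangentManifold.
Variable R : realType.
Implicit Types (X : charted R) (F : tvsType R).

Lemma tangent_is_subbase X : @is_subbase (tangent X) (@tangent_subbase R X).
Proof. by []. Qed.

Lemma cvg_tangent X (Q : set_system (tangent X)) (w : tangent X) : Filter Q ->
  (forall (j : chart_index X) (W : set (model j * model j)), open W ->
     chart_dom j (base w) -> W (tangent_chart j w) ->
     Q (tangent_dom j `&` @tangent_chart R X j @^-1` W)) ->
  Q --> w.
Proof.
move=> FQ QO; apply: cvg_subbase (@tangent_is_subbase X) _ => O.
move=>  [j [W [oW ->]]] [/= jw Ww]; exact: QO.
Qed.

Lemma tangent_dom_open X (i : chart_index X) : open (@tangent_dom R X i).
Proof.
apply: subbase_open (@tangent_is_subbase X) _; exists i; exists setT; split; first exact: openT.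
by rewrite preimage_setT setIT.
Qed.

Lemma tangent_nbhs X (j : chart_index X) (w : tangent X) (W : set (model j * model j)) :
  chart_dom j (base w) -> nbhs (tangent_chart j w) W ->
  nbhs w (tangent_dom j `&` @tangent_chart R X j @^-1` W).
Proof.
move=> jw wW.
have [V [oV Vw] VW] : exists2 V, open_nbhs (tangent_chart j w) V & V `<=` W.
  by move: wW; rewrite nbhsE.
have : nbhs w (tangent_dom j `&` @tangent_chart R X j @^-1` V).
  apply: open_nbhs_nbhs; split=> //; apply: subbase_open (@tangent_is_subbase X) _.
  by exists j; exists V.
by apply: filterS => w' [jw' Vw']; split=> //; exact: VW.
Qed.

Section TangentOfManifold.
Variables (m : nat) (X : charted R).
Hypothesis mX : smooth_manifold m.+1 X.
Implicit Types (i j k : chart_index X).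

Lemma base_continuous : continuous (@base R X : tangent X -> X).
Proof.
move=> w N wN; have [i iw] := chart_cover mX (base w).
have := chart_nbhs mX iw wN => iN.
have /(tangent_nbhs iw) :
    nbhs (tangent_chart i w) ((chart i @` (N `&` chart_dom i)) `*` [set: model i]).
  exists (chart i @` (N `&` chart_dom i), setT) => //=.
  by split=> //; exact: filterT.
apply: filterS => w' [iw' [/= [x [Nx ix] xw'] _]].
by rewrite /= -(chart_inj mX ix iw' xw').
Qed.

(** Tangent vectors over distinct points are separated by the base points, those
   over the same point by their components in one chart. *)
Lemma tangent_hausdorff : hausdorff_space (tangent X).
Proof.
move=> w w' ww'; have [hX _] : hausdorff_space X /\ True by case: mX => -[].
have bw : base w = base w'.
  by apply: (cluster_nbhs_image hX _ _ ww'); exact: base_continuous.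
have [i iw] := chart_cover mX (base w).
apply: (tangent_vector_eq (i := i)) => //.
have ci (v : tangent X) : chart_dom i (base v) ->
    {for v, continuous (fun v : tangent X => Defs.comp v i)}.
  move=> iv N vN; have /(tangent_nbhs iv) : nbhs (tangent_chart i v) (setT `*` N).
    by exists (setT, N) => //=; split=> //; exact: filterT.
  by apply: filterS => v' [_ []].
apply: (@cluster_nbhs_image _ _ (fun v : tangent X => Defs.comp v i) _ _
  (@model_hausdorff _ _ _ mX i) _ _ ww'); apply: ci => //.
by rewrite -bw.
Qed.

Lemma tangent_codom i :
  chart (c := tangent X) i @` chart_dom (c := tangent X) i =
  (chart i @` chart_dom i) `*` [set: model i].
Proof.
apply/seteqP; split=> [_ [w iw <-]|[_ v] [/= [x ix <-] _]].
  by split=> //; exists (base w).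
by exists (vector_at mX v ix); [exact: ix|exact: vector_at_chart].
Qed.

Lemma comp_change i j (w : tangent X) : chart_dom i (base w) -> chart_dom j (base w) ->
  tangent_chart j w = (@transition R X i j (tangent_chart i w).1,
    differential (@transition R X i j) (tangent_chart i w)).
Proof.
move=> iw jw; rewrite /tangent_chart /= (transitionE mX)//; congr (_, _).
exact: comp_transition.
Qed.

Lemma tangent_transition_cvg i j (w : tangent X) :
  chart_dom i (base w) -> chart_dom j (base w) ->
  {for tangent_chart i w, continuous (fun p : model i * model i =>
     (@transition R X i j p.1, differential (@transition R X i j) p))}.
Proof.
move=> iw jw; have [ct [_ sd]] := transition_smooth mX i j.
have ow : (chart i @` (chart_dom i `&` chart_dom j)) (chart i (base w)).
  by exists (base w).
apply/cvg_pairP; split; last first.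
  have owT : ((chart i @` (chart_dom i `&` chart_dom j)) `*` [set: model i])
    (tangent_chart i w) by [].
  exact: (smooth_continuous sd owT).
apply: (@continuous_comp _ _ _ fst (@transition R X i j)); last exact: ct.
exact: continuous_fst.
Qed.

(** The inverse of a tangent chart is continuous because, in any other chart of the
   tangent bundle, it is given by a transition map and its differential. *)
Lemma tangent_chart_open i (U : set (tangent X)) :
  open U -> U `<=` tangent_dom i -> open (@tangent_chart R X i @` U).
Proof.
move=> oU Ui; rewrite openE => _ [w Uw <-]; have iw := Ui w Uw.
(* [Q] is the image of the neighbourhood filter of [y] under the inverse chart. *)
pose y := tangent_chart i w.
pose q (N : set (tangent X)) (p : model i * model i) :=
  forall w', chart_dom i (base w') -> tangent_chart i w' = p -> N w'.
pose Q : set_system (tangent X) := [set N | nbhs y (q N)].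
have FQ : Filter Q.
  split; first by apply: (@filterS _ (nbhs y) _ setT) filterT => p _ w' _ _.
    move=> A B QA QB; apply: (@filterS _ (nbhs y) _ (q A `&` q B)); last exact: filterI.
    by move=> p [Ap Bp] w' iw' pE; split; [exact: Ap|exact: Bp].
  move=> A B AB QA; apply: (@filterS _ (nbhs y) _ (q A)) QA.
  by move=> p Ap w' iw' pE; exact/AB/Ap.
have Qw : Q --> w.
  apply: cvg_tangent => j W oW jw Ww.
  have ow : nbhs (tangent_chart i w)
     ((chart i @` (chart_dom i `&` chart_dom j)) `*` [set: model i]).
    apply: open_nbhs_nbhs; split; last by split=> //; exists (base w).
    by apply: openX_setT; exact: overlap_open mX i j.
  have := tangent_transition_cvg iw jw.
  rewrite /prop_for/continuous_at -comp_change// => /(_ W).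
  move=> /(_ (open_nbhs_nbhs (conj oW Ww))); move=> WW.
  apply: (@filterS _ (nbhs y) _ _ _ _ (filterI ow WW)) => p [[{}ow _] Wp] w' iw' pE.
  have jw' : chart_dom j (base w').
    have [x [ix jx] xE] := ow.
    by rewrite -(chart_inj mX ix iw' _)// xE -pE.
  by split=> //=; rewrite (comp_change iw' jw') pE.
have QU : Q U by apply: Qw; exact: open_nbhs_nbhs.
have iU : nbhs (tangent_chart i w) ((chart i @` chart_dom i) `*` [set: model i]).
  apply: open_nbhs_nbhs; split; last by split=> //; exists (base w).
  by apply: openX_setT; exact: chart_codom_open mX i.
suff : nbhs y (@tangent_chart R X i @` U) by [].
apply: (@filterS _ (nbhs y) _ (q U `&` ((chart i @` chart_dom i) `*` [set: model i])));
  last exact: filterI.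
move=> p [Up].
rewrite -tangent_codom => -[w' iw' pE].
by exists w' => //; exact: Up.
Qed.

(** The transition maps of the tangent bundle are the tangent maps
   $(y,v)\mapsto(\tau(y),d\tau(y,v))$ of those of the manifold, and $d\tau$ costs one
   order of differentiability. *)
Lemma tangent_transition_smooth i j :
  smooth m (chart (c := tangent X) i @`
      (chart_dom (c := tangent X) i `&` chart_dom (c := tangent X) j))
    (@transition R (tangent X) i j).
Proof.
have [_ [_ sd]] := transition_smooth mX i j.
have oij := overlap_open mX i j.
have otij : open (chart (c := tangent X) i @`
    (chart_dom (c := tangent X) i `&` chart_dom (c := tangent X) j)).
  apply: tangent_chart_open => [|w []//].
  by apply: openI; exact: tangent_dom_open.
have sT : smooth m ((chart i @` (chart_dom i `&` chart_dom j)) `*` [set: model i])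
    (fun p : (model i * model i)%type => (@transition R X i j p.1,
       differential (@transition R X i j) p) : (model j * model j)%type).
  apply: smooth_pair => //; [exact: model_hausdorff mX j|exact: model_hausdorff mX j| | ].
    exact: openX_setT.
  apply: smooth_fst => //; first exact: model_hausdorff mX j.
  exact/smoothW/(transition_smooth mX i j).
apply: (smooth_eq otij _ (smooth_sub _ sT)).
  move=> _ [w [iw jw] <-].
  have -> : @transition R (tangent X) i j (chart (c := tangent X) i w) = tangent_chart j w.
    rewrite /transition /in_chart; case: pselect => [yP|[]]; last by exists w.
    case: cid => w' /= [iw' [bE cE]]; congr tangent_chart.
    apply: (@tangent_vector_eq R X i w' w) => //.
    exact: (@chart_inj _ _ _ mX i _ _ iw' iw bE).
  by rewrite (comp_change iw jw).
by move=> _ [w [iw jw] <-]; split=> //; exists (base w).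
Qed.

Lemma tangent_manifold : smooth_manifold m (tangent X).
Proof.
split; first split.
- exact: tangent_hausdorff.
- by move=> i; apply: hausdorff_prod; exact: model_hausdorff mX i.
- split=> [i|]; first exact: tangent_dom_open.
  by apply/seteqP; split=> // w _; have [i iw] := chart_cover mX (base w); exists i.
- move=> i; split; last exact: tangent_chart_open.
    move=> w w' /set_mem iw /set_mem iw' [bE cE].
    apply: (@tangent_vector_eq R X i w w') => //.
    exact: (@chart_inj _ _ _ mX i _ _ iw iw' bE).
  have odom : open (chart_dom (c := tangent X) i) by exact: tangent_dom_open.
  apply/open_continuousP => // w iw W /(tangent_nbhs iw).
  by apply: filterS => w' [].
exact: tangent_transition_smooth.
Qed.

(** [tangent_diff] refers to an arbitrary chart around the base point; by the chain
   rule and the transition rule for the components, all charts give the same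
   value. *)
Lemma tangent_diffE F (g : X -> F) i (w : tangent X) n : hausdorff_space F ->
  smooth_on_charts n.+1 g -> chart_dom i (base w) ->
  tangent_diff g w = differential (in_chart (i := i) g) (tangent_chart i w).
Proof.
move=> hF sg iw; rewrite /tangent_diff; case: pselect => [wP|[]]; last by exists i.
move: (projT1 (cid wP)) (projT2 (cid wP)) => j /= jw.
rewrite (dirder_in_chart_change mX _ hF sg jw iw); congr (dirder _ _ _).
by apply/esym; exact: comp_transition.
Qed.

Lemma in_tangent_chart F (g : X -> F) i n (p : (model i * model i)%type) :
  hausdorff_space F -> smooth_on_charts n.+1 g ->
  ((chart i @` chart_dom i) `*` [set: model i]) p ->
  in_chart (X := tangent X) (i := i) (tangent_diff g) p =
  differential (in_chart (i := i) g) p.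
Proof.
move=> hF sg; rewrite -tangent_codom => -[w iw <-].
by rewrite (in_chartE tangent_manifold)// (tangent_diffE hF sg iw).
Qed.

Lemma tangent_diff_smooth F (g : X -> F) n : hausdorff_space F ->
  smooth_on_charts n.+1 g -> smooth_on_charts (X := tangent X) n (tangent_diff g).
Proof.
move=> hF sg i; rewrite tangent_codom; have [_ [_ sd]] := sg i.
apply: smooth_eq sd; first exact/openX_setT/(chart_codom_open mX).
by move=> p pU; rewrite -(in_tangent_chart hF sg pU).
Qed.

End TangentOfManifold.

Lemma iter_tangent_manifold m n X : smooth_manifold (n + m) X ->
  smooth_manifold m (iter_tangent X n).
Proof.
elim: n m => [//|n IHn] m; rewrite addSnnS => /IHn; exact: tangent_manifold.
Qed.

Lemma iter_tangent_diff_smooth m n X F (g : X -> F) : hausdorff_space F ->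
  smooth_manifold (n + m) X -> smooth_on_charts (n + m) g ->
  smooth_on_charts (X := iter_tangent X n) m (@iter_tangent_diff R X F g n).
Proof.
move=> hF; elim: n m => [//|n IHn] m; rewrite addSnnS => mX /(IHn _ mX).
exact: (tangent_diff_smooth (iter_tangent_manifold mX) hF).
Qed.

Lemma iter_tangent_diff_continuous m n X F (g : X -> F) : hausdorff_space F ->
  smooth_manifold m X -> smooth_on_charts m g -> (n <= m)%N ->
  continuous (@iter_tangent_diff R X F g n).
Proof.
move=> hF + + /subnKC mE; rewrite -mE => mX sg.
apply: (smooth_on_charts_continuous (iter_tangent_manifold mX)).
exact: (iter_tangent_diff_smooth hF mX sg).
Qed.

End TangentManifold.

(** * Uniform convergence on compact sets *)

(** For compact [L] and continuous [f0], this is the uniform convergence on [L] of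
   the maps [f z] to [f0] along [Q], in the form of continuous convergence. *)
Definition cvg_on_set (Z : Type) (Q : set_system Z) (T S : topologicalType)
    (L : set T) (f : Z -> T -> S) (f0 : T -> S) : Prop :=
  forall y, L y ->
    (fun p : Z * T => f p.1 p.2) @ filter_prod Q (within L (nbhs y)) --> f0 y.

Section CvgOnSet.
Context (Z : Type) (Q : set_system Z) {FQ : Filter Q}.
Implicit Types (T S : topologicalType).

Lemma cvg_on_set_eq T S (L : set T) (f g : Z -> T -> S) f0 g0 :
  (forall z x, L x -> f z x = g z x) -> (forall x, L x -> f0 x = g0 x) ->
  cvg_on_set Q L f f0 -> cvg_on_set Q L g g0.
Proof.
move=> fg fg0 ff0 y Ly; rewrite -fg0//.
apply: (@cvg_eq_on _ _ _ _ _ [set p | L p.2] _ _ _ _ (ff0 y Ly)).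
  exists (setT, L) => /=; last by move=> [z x] [].
  by split; [exact: filterT|exact: withinT].
by move=> [z x]; exact: fg.
Qed.

Lemma cvg_on_set_comp T T' S (L : set T) (L' : set T') (p : T -> T') (f : Z -> T' -> S) f0 :
  (forall y, L y -> {for y, continuous p}) -> L `<=` p @^-1` L' ->
  cvg_on_set Q L' f f0 -> cvg_on_set Q L (fun z => f z \o p) (f0 \o p).
Proof.
move=> cp LL' ff0 y Ly N /(ff0 _ (LL' _ Ly)) [[A B] [/= QA B'] AB].
exists (A, L `&` p @^-1` B) => /=; last first.
  by move=> [z x] [/= Az [_ Bx]]; apply: (AB (z, p x)).
split=> //; apply: (@filterS _ (nbhs y) _ _ _ _ (cp y Ly _ B')) => x Bx Lx.
by split=> //; apply: Bx; exact: LL'.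
Qed.

Lemma cvg_on_set2 T S1 S2 S3 (L : set T) (b : S1 -> S2 -> S3)
    (f : Z -> T -> S1) (g : Z -> T -> S2) f0 g0 :
  continuous (fun p : S1 * S2 => b p.1 p.2) ->
  cvg_on_set Q L f f0 -> cvg_on_set Q L g g0 ->
  cvg_on_set Q L (fun z x => b (f z x) (g z x)) (fun x => b (f0 x) (g0 x)).
Proof.
move=> cb ff0 gg0 y Ly.
exact: (@cvg_comp2 _ _ _ _ _ _ _ _ _ _ _ (fun p => f p.1 p.2) (fun p => g p.1 p.2) b
  (ff0 y Ly) (gg0 y Ly) (cb (f0 y, g0 y))).
Qed.

Lemma cvg_on_set_near T S (L : set T) (f : Z -> T -> S) f0 (O : set S) :
  compact L -> open O -> (forall x, L x -> O (f0 x)) -> cvg_on_set Q L f f0 ->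
  \forall z \near Q, forall x, L x -> O (f z x).
Proof.
move=> /compact_near_coveringP/near_covering_withinP cL oO LO ff0.
apply: (cL _ Q (fun z x => O (f z x)) FQ) => x Lx.
have [[A B] [/= QA LB] AB] := ff0 x Lx O (open_nbhs_nbhs (conj oO (LO x Lx))).
exists ([set x' | L x' -> B x'], A) => [|[x' z] [/= Bx' Az] Lx']; first by split.
by apply: (AB (z, x')); split=> //; exact: Bx'.
Qed.

(** If [f z] is close to [f0] in the compact-open topology, regularity of [S] allows
   one to shrink [K] to a compact neighbourhood of the given point in [K] that [f0]
   maps well inside a given open set. The converse is a compactness argument. *)
Lemma compact_open_cvg_on_set T S (f : Z -> {compact-open, T -> S})
    (f0 : {compact-open, T -> S}) :
  regular_space S -> continuous (f0 : T -> S) ->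
  f @ Q --> f0 <-> forall K, compact K -> cvg_on_set Q K f f0.
Proof.
move=> regS cf0; rewrite compact_open_cvgP; split=> [ff0 K cK y Ky N yN|ff0 K O cK oO f0O].
  have [V yV VN] := regS _ _ (nbhs_interior yN).
  pose K' := K `&` f0 @^-1` closure V.
  have cK' : compact K'.
    apply: compact_closedI => //; apply: closed_comp; last exact: closed_closure.
    by move=> x _; exact: cf0.
  have K'N : f0 @` K' `<=` N° by move=> _ [x [_ Vx] <-]; exact: VN.
  exists ([set z | f z @` K' `<=` N°], K `&` f0 @^-1` V) => /=.
    split; first exact: (ff0 K' N° cK' (@open_interior _ N) K'N).
    by apply: (@filterS _ (nbhs y) _ _ _ _ (cf0 y _ yV)).
  move=> [z x] [/= zK' [Kx Vx]].
  have K'x : K' x by split=> //; exact: subset_closure.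
  by apply: interior_subset; apply: zK'; exists x.
apply: (@filterS _ _ _ [set z | forall x, K x -> O (f z x)]).
  by move=> z Oz _ [x Kx <-]; exact: Oz.
by apply: cvg_on_set_near (ff0 K cK) => // x Kx; apply: f0O; exists x.
Qed.

End CvgOnSet.

(** * Convergence with derivatives on open subsets of the modelling spaces *)

Section LocalConvergence.
Context (R : realType) (Z : Type) (Q : set_system Z) {FQ : Filter Q}.
Implicit Types E F G H : tvsType R.

(** Convergence of all derivatives up to order [m], uniformly on compact sets; as
   in [smooth], the recursion is on the derivative, seen as a map on
   $U\times E$. *)
Fixpoint cvg_derivatives m E F (U : set E) (f : Z -> E -> F) (f0 : E -> F) : Prop :=
  (forall L, compact L -> L `<=` U -> cvg_on_set Q L f f0) /\
  if m is n.+1 then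
    cvg_derivatives n (U `*` [set: E]) (fun z => differential (f z)) (differential f0)
  else True.

Lemma cvg_derivatives0 m E F (U : set E) (f : Z -> E -> F) f0 L :
  cvg_derivatives m U f f0 -> compact L -> L `<=` U -> cvg_on_set Q L f f0.
Proof. by case: m => [|m] [ff0 _]; exact: ff0. Qed.

Lemma cvg_derivativesW m E F (U : set E) (f : Z -> E -> F) f0 :
  cvg_derivatives m.+1 U f f0 -> cvg_derivatives m U f f0.
Proof.
elim: m E U f f0 => [|m IHm] E U f f0 [ff0 dff0]; first by split.
by split=> //; exact: IHm.
Qed.

Lemma differential_near E F (U : set E) (f g : E -> F) q : open U ->
  (forall x, U x -> f x = g x) -> (U `*` [set: E]) q ->
  differential f q = differential g q.
Proof.
move=> oU fg [Uq _]; apply: dirder_near; apply: filterS fg _.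
exact: open_nbhs_nbhs.
Qed.

Lemma cvg_derivatives_eq m E F (U : set E) (f g : Z -> E -> F) f0 g0 : open U ->
  (forall z x, U x -> f z x = g z x) -> (forall x, U x -> f0 x = g0 x) ->
  cvg_derivatives m U f f0 -> cvg_derivatives m U g g0.
Proof.
elim: m E U f g f0 g0 => [|m IHm] E U f g f0 g0 oU fg fg0 [ff0 dff0].
  split=> // L cL LU; apply: cvg_on_set_eq (ff0 L cL LU) => [z x /LU|x /LU];
    [exact: fg|exact: fg0].
split.
  move=> L cL LU; apply: cvg_on_set_eq (ff0 L cL LU) => [z x /LU|x /LU];
    [exact: fg|exact: fg0].
apply: IHm dff0; first exact: openX_setT.
  by move=> z q Uq; apply: differential_near Uq => // x; exact: fg.
by move=> q Uq; apply: differential_near Uq.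
Qed.

Lemma cvg_derivatives_precomp m E F G (U : set F) (V : set E) (p : E -> F)
    (f : Z -> F -> G) f0 :
  hausdorff_space G -> open V -> continuous_linear p -> V `<=` p @^-1` U ->
  (forall z, smooth m U (f z)) -> smooth m U f0 ->
  cvg_derivatives m U f f0 -> cvg_derivatives m V (fun z => f z \o p) (f0 \o p).
Proof.
move=> hG; elim: m E F U V p f f0 => [|m IHm] E F U V p f f0 oV lp VU sf sf0 ff0.
  split=> // L cL LV.
  have cp : continuous p by case: lp.
  apply: (cvg_on_set_comp (L' := p @` L)) => [y _|y Ly|]; first exact: cp.
    by exists y.
  apply: cvg_derivatives0 ff0 _ _ => [|_ [x /LV/VU Ux <-]//].
  by apply: continuous_compact => //; exact: continuous_subspaceT.
have cp : continuous p by case: lp.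
split.
  move=> L cL LV.
  apply: (cvg_on_set_comp (L' := p @` L)) => [y _|y Ly|]; first exact: cp.
    by exists y.
  apply: cvg_derivatives0 ff0 _ _ => [|_ [x /LV/VU Ux <-]//].
  by apply: continuous_compact => //; exact: continuous_subspaceT.
have dfp (g : F -> G) : smooth m.+1 U g -> forall q, (V `*` [set: E]) q ->
    differential g (p q.1, p q.2) = differential (g \o p) q.
  move=> sg [x h] [/= /VU Ux _]; apply/esym/dirderE => //.
  exact: (is_dirder_precomp lp (@smooth_dirder _ _ _ _ _ _ _ (p h) sg Ux)).
apply: (@cvg_derivatives_eq _ _ _ _
   (fun z => differential (f z) \o (fun q : E * E => (p q.1, p q.2) : (F * F)%type)) _
   (differential f0 \o (fun q : E * E => (p q.1, p q.2) : (F * F)%type))).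
- exact: openX_setT.
- by move=> z q; exact: dfp.
- exact: dfp.
- apply: (IHm _ _ (U `*` [set: F])).
  + exact: openX_setT.
  + exact: continuous_linear_prod.
  + by move=> [x h] [/= /VU].
  + by move=> z; have [_ []] := sf z.
  + by have [_ []] := sf0.
  + by case: ff0.
Qed.

Lemma cvg_derivativesD m E F (U : set E) (f g : Z -> E -> F) f0 g0 :
  hausdorff_space F -> open U ->
  (forall z, smooth m U (f z)) -> smooth m U f0 ->
  (forall z, smooth m U (g z)) -> smooth m U g0 ->
  cvg_derivatives m U f f0 -> cvg_derivatives m U g g0 ->
  cvg_derivatives m U (fun z x => f z x + g z x) (fun x => f0 x + g0 x).
Proof.
move=> hF; elim: m E U f g f0 g0 => [|m IHm] E U f g f0 g0 oU sf sf0 sg sg0 ff0 gg0.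
  split=> // L cL LU; apply: cvg_on_set2; first exact: (@add_continuous F).
    exact: cvg_derivatives0 ff0 cL LU.
  exact: cvg_derivatives0 gg0 cL LU.
split.
  move=> L cL LU; apply: cvg_on_set2; first exact: (@add_continuous F).
    exact: cvg_derivatives0 ff0 cL LU.
  exact: cvg_derivatives0 gg0 cL LU.
have dD (u v : E -> F) : smooth m.+1 U u -> smooth m.+1 U v -> forall q, (U `*` [set: E]) q ->
    differential u q + differential v q = differential (fun x => u x + v x) q.
  move=> su sv [x h] [/= Ux _]; apply/esym/dirderE => //.
  by apply: is_dirderD; [exact: smooth_dirder su Ux|exact: smooth_dirder sv Ux].
apply: (@cvg_derivatives_eq _ _ _ _
   (fun z q => differential (f z) q + differential (g z) q) _
   (fun q => differential f0 q + differential g0 q)).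
- exact: openX_setT.
- by move=> z q; exact: dD.
- exact: dD.
- apply: IHm.
  + exact: openX_setT.
  + by move=> z; have [_ []] := sf z.
  + by have [_ []] := sf0.
  + by move=> z; have [_ []] := sg z.
  + by have [_ []] := sg0.
  + by case: ff0.
  + by case: gg0.
Qed.

Lemma cvg_derivatives_fst m E F (U : set E) (f : Z -> E -> F) f0 :
  hausdorff_space F -> open U -> (forall z, smooth m U (f z)) -> smooth m U f0 ->
  cvg_derivatives m U f f0 ->
  cvg_derivatives m (U `*` [set: E]) (fun z q => f z q.1) (fun q => f0 q.1).
Proof.
move=> hF oU sf sf0; apply: cvg_derivatives_precomp sf sf0 => //.
- exact: openX_setT.
- exact: continuous_linear_fst.
- by move=> [x h] [].
Qed.

(** The induction step is the product rule, whose terms are handled by the induction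
   hypothesis after composing one factor with the projection
   $U\times E\to U$. *)
Lemma cvg_derivatives_bilinear m E F G H (b : F -> G -> H) (U : set E)
    (f : Z -> E -> F) (g : Z -> E -> G) f0 g0 :
  continuous_bilinear b -> hausdorff_space F -> hausdorff_space G ->
  hausdorff_space H -> open U ->
  (forall z, smooth m U (f z)) -> smooth m U f0 ->
  (forall z, smooth m U (g z)) -> smooth m U g0 ->
  cvg_derivatives m U f f0 -> cvg_derivatives m U g g0 ->
  cvg_derivatives m U (fun z x => b (f z x) (g z x)) (fun x => b (f0 x) (g0 x)).
Proof.
move=> bb hF hG hH; have [cb _ _] := bb.
elim: m E U f g f0 g0 => [|m IHm] E U f g f0 g0 oU sf sf0 sg sg0 ff0 gg0.
  split=> // L cL LU; apply: cvg_on_set2 => //.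
    exact: cvg_derivatives0 ff0 cL LU.
  exact: cvg_derivatives0 gg0 cL LU.
split.
  move=> L cL LU; apply: cvg_on_set2 => //.
    exact: cvg_derivatives0 ff0 cL LU.
  exact: cvg_derivatives0 gg0 cL LU.
have oUE : open (U `*` [set: E]) by exact: openX_setT.
have sd E' u : @smooth R m.+1 E E' U u -> smooth m (U `*` [set: E]) (differential u).
  by move=> [_ []].
have s1 E' u : hausdorff_space E' -> @smooth R m.+1 E E' U u ->
    smooth m (U `*` [set: E]) (fun q => u q.1).
  by move=> hE' su; apply: smooth_fst => //; exact: smoothW.
have db (u : E -> F) (v : E -> G) : smooth m.+1 U u -> smooth m.+1 U v ->
    forall q, (U `*` [set: E]) q ->
    b (differential u q) (v q.1) + b (u q.1) (differential v q) =
    differential (fun x => b (u x) (v x)) q.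
  by move=> su sv [x h] [/= Ux _]; rewrite /differential (dirder_bilinear h bb hH su sv Ux).
apply: (@cvg_derivatives_eq _ _ _ _
   (fun z q => b (differential (f z) q) (g z q.1) + b (f z q.1) (differential (g z) q)) _
   (fun q => b (differential f0 q) (g0 q.1) + b (f0 q.1) (differential g0 q))) => //.
- by move=> z q; exact: db.
- exact: db.
- apply: cvg_derivativesD => //.
  + by move=> z; apply: smooth_bilinear; auto.
  + by apply: smooth_bilinear; auto.
  + by move=> z; apply: smooth_bilinear; auto.
  + by apply: smooth_bilinear; auto.
  + apply: IHm => //; auto.
    * by case: ff0.
    * apply: cvg_derivatives_fst => // [z||];
        [exact: smoothW|exact: smoothW|exact: cvg_derivativesW].
  + apply: IHm => //; auto.
    * apply: cvg_derivatives_fst => // [z||];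
        [exact: smoothW|exact: smoothW|exact: cvg_derivativesW].
    * by case: gg0.
Qed.

End LocalConvergence.

(** * Convergence with differentials on manifolds *)

(** A point of [O] has a neighbourhood [B] whose closure misses the compact set
   $K\setminus O$, since it can be separated from each point of that set. *)
Lemma compact_shrink (T : topologicalType) (K O : set T) x : hausdorff_space T ->
  compact K -> open O -> O x ->
  exists2 K' : set T, compact K' /\ K' `<=` K `&` O &
    exists2 P, nbhs x P & P `&` K `<=` K'.
Proof.
move=> hT cK oO Ox.
have cC : compact (K `&` ~` O) by apply: compact_closedI => //; exact: open_closedC.
have [B xB BC] : exists2 B, nbhs x B & K `&` ~` O `<=` ~` closure B.
  (* A neighbourhood [B] that is small enough works for all [c] at once. *)
  have /near_covering_withinP cov := (compact_near_coveringP _).1 cC.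
  have [|V [Vx _ [B VB]] VC] := cov _ (powerset_filter_from (nbhs x))
      (fun B c => ~ closure B c) (powerset_filter_from_filter _).
    move=> c [_ Oc]; have cx : c != x by apply/eqP => cE; apply: Oc; rewrite cE.
    move: (hT); rewrite open_hausdorff => /(_ _ _ cx) [[A B] /= [cA xB] [oA oB AB]].
    move: cA xB => /set_mem cA /set_mem xB.
    exists (A, [set W | nbhs x W /\ W `<=` B]) => /=.
      split; first exact: open_nbhs_nbhs.
      by apply: (@powerset_filter_fromP _ (nbhs x)); exact: open_nbhs_nbhs.
    move=> [c' W] [/= Ac' [_ WB]] _ /(_ A (open_nbhs_nbhs (conj oA Ac'))) [y [Wy Ay]].
    by move/eqP : AB; rewrite -subset0 => /(_ y); apply; split=> //; exact: WB.
  by exists B; [exact: Vx|exact: (VC B VB)].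
exists (K `&` closure B).
  split; first by apply: compact_closedI => //; exact: closed_closure.
  by move=> y [Ky By]; split=> //; apply: contrapT => Oy; exact: (BC y).
by exists B => // y [By Ky]; split=> //; exact: subset_closure.
Qed.

Section GlobalConvergence.
Context (R : realType) (Z : Type) (Q : set_system Z) {FQ : Filter Q}.
Implicit Types (X : charted R) (F : tvsType R).

(** Compact subsets of a chart codomain pull back to compact subsets of [X].
   Conversely, each point of a compact [K] has a compact neighbourhood in [K] that is
   contained in a chart domain, and convergence is a local matter on [K]. *)
Lemma cvg_on_set_chart m X F (f : Z -> X -> F) f0 : smooth_manifold m X ->
  (forall K, compact K -> cvg_on_set Q K f f0) <->
  forall (i : chart_index X) L, compact L -> L `<=` chart i @` chart_dom i ->
    cvg_on_set Q L (fun z => in_chart (i := i) (f z)) (in_chart (i := i) f0).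
Proof.
move=> mX; split=> [ff0 i L cL Li|ff0 K cK x Kx].
  pose K := chart_dom i `&` chart i @^-1` L.
  have cK : compact K by exact: (chart_preimage_compact mX cL Li).
  move=> y Ly; have [x ix xy] := Li y Ly.
  have Kx : K x by split=> //=; rewrite xy.
  rewrite -xy (in_chartE mX)// => N /(ff0 K cK x Kx) [[A B] [/= QA xB] AB].
  exists (A, [set y | exists x', [/\ chart_dom i x', chart i x' = y & B x']]) => /=.
    split=> //; apply: (@filterS _ (nbhs (chart i x)) _ _ _ _ (chart_nbhs mX ix xB)).
    move=> _ [x' [Bx' ix'] <-] Lx'; exists x'; split=> //.
    exact: Bx'.
  move=> [z _] [/= Az [x' [ix' <- Bx']]]; rewrite (in_chartE mX)//.
  by apply: (AB (z, x')).
have [i ix] := chart_cover mX x.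
have [hX _] : hausdorff_space X /\ True by case: mX => -[].
have [K' [cK' K'K] [P xP PK]] := compact_shrink hX cK (chart_dom_open mX i) ix.
have cL : compact (chart i @` K').
  apply: continuous_compact => //; apply/subspace_continuousP => y /K'K[_ iy].
  by apply: cvg_within_filter; exact: (chart_continuous mX iy).
have LD : chart i @` K' `<=` chart i @` chart_dom i.
  by move=> _ [y /K'K[_ iy] <-]; exists y.
have K'x : K' x by apply: PK; split=> //; exact: nbhs_singleton.
move=> N xN; have := ff0 i _ cL LD (chart i x); rewrite (in_chartE mX)//.
move=> /(_ (ex_intro2 _ _ x K'x erefl) N xN) [[A B] [/= QA xB] AB].
exists (A, [set y | K' y /\ B (chart i y)]) => /=.
  split=> //; have := chart_continuous mX ix xB => iB.
  apply: (@filterS _ (nbhs x) _ _ _ _ (filterI xP iB)) => y [Py By] Ky.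
  have K'y : K' y by exact: PK.
  by split=> //; apply: By; exists y.
move=> [z y] [/= Az [K'y By]]; have [_ iy] := K'K y K'y.
by have := AB (z, chart i y) (conj Az By); rewrite /= (in_chartE mX).
Qed.

(** The recursion replaces [X] by its tangent bundle and [f z] by its differential;
   [cvg_tangent_diffsE] relates this to the iterated differentials. *)
Fixpoint cvg_tangent_diffs m X F (f : Z -> X -> F) (f0 : X -> F) : Prop :=
  (forall K, compact K -> cvg_on_set Q K f f0) /\
  if m is n.+1 then
    cvg_tangent_diffs n (X := tangent X) (fun z => tangent_diff (f z)) (tangent_diff f0)
  else True.

(** As for [iter_dirder_shift], the property [P] spares a transport between the two
   iterated tangent bundles. *)
Lemma iter_tangent_shift F (P : forall X, (Z -> X -> F) -> (X -> F) -> Prop) n X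
    (f : Z -> X -> F) f0 :
  P (iter_tangent (tangent X) n)
    (fun z => @iter_tangent_diff R (tangent X) F (tangent_diff (f z)) n)
    (@iter_tangent_diff R (tangent X) F (tangent_diff f0) n) <->
  P (iter_tangent X n.+1) (fun z => @iter_tangent_diff R X F (f z) n.+1)
    (@iter_tangent_diff R X F f0 n.+1).
Proof.
elim: n P => [//|n IHn] P.
exact: (IHn (fun X f f0 => P (tangent X) (fun z => tangent_diff (f z)) (tangent_diff f0))).
Qed.

Lemma cvg_tangent_diffsE m X F (f : Z -> X -> F) f0 :
  cvg_tangent_diffs m f f0 <->
  forall n, (n <= m)%N -> forall K : set (iter_tangent X n), compact K ->
    cvg_on_set Q K (fun z => @iter_tangent_diff R X F (f z) n)
      (@iter_tangent_diff R X F f0 n).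
Proof.
pose P X (f : Z -> X -> F) (f0 : X -> F) := forall K, compact K -> cvg_on_set Q K f f0.
elim: m X f f0 => [|m IHm] X f f0 /=.
  split=> [[ff0 _]|ff0]; last by split=> //; exact: (ff0 0%N).
  by case.
rewrite (IHm (tangent X)); split=> [[ff0 dff0] [_|n nm]|ff0]; first exact: ff0.
  exact/(iter_tangent_shift P)/dff0.
split; first exact: (ff0 0%N).
by move=> n nm; exact/(iter_tangent_shift P)/ff0.
Qed.

(** One differential at a time: the differential of [f z] is represented in the
   charts of the tangent bundle by the derivative of the representative
   of [f z]. *)
Lemma cvg_tangent_diffs_chart m X F (f : Z -> X -> F) f0 : hausdorff_space F ->
  smooth_manifold m X -> (forall z, smooth_on_charts m (f z)) -> smooth_on_charts m f0 ->
  cvg_tangent_diffs m f f0 <->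
  forall i : chart_index X, cvg_derivatives Q m (chart i @` chart_dom i)
    (fun z => in_chart (i := i) (f z)) (in_chart (i := i) f0).
Proof.
move=> hF; elim: m X f f0 => [|m IHm] X f f0 mX sf sf0.
  split=> [[ff0 _] i|ff0]; last first.
    by split=> //; apply/(cvg_on_set_chart _ _ mX) => i; case: (ff0 i).
  by split=> // L cL LU; apply: (cvg_on_set_chart f f0 mX).1.
have eqv : cvg_tangent_diffs m (X := tangent X) (fun z => tangent_diff (f z)) (tangent_diff f0) <->
    forall i : chart_index X, cvg_derivatives Q m ((chart i @` chart_dom i) `*` [set: model i])
      (fun z => differential (in_chart (i := i) (f z))) (differential (in_chart (i := i) f0)).
  rewrite (IHm (tangent X)); first last.
  - exact: (tangent_diff_smooth mX hF sf0).
  - by move=> z; exact: (tangent_diff_smooth mX hF (sf z)).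
  - exact: tangent_manifold mX.
  split=> ff0 i.
    have := ff0 i; rewrite (tangent_codom mX); apply: cvg_derivatives_eq.
    - exact/openX_setT/(chart_codom_open mX).
    - by move=> z q qU; exact: (in_tangent_chart mX hF (sf z)).
    - by move=> q qU; exact: (in_tangent_chart mX hF sf0).
  rewrite (tangent_codom mX); apply: cvg_derivatives_eq (ff0 i).
  - exact/openX_setT/(chart_codom_open mX).
  - by move=> z q qU; apply/esym; exact: (in_tangent_chart mX hF (sf z)).
  - by move=> q qU; apply/esym; exact: (in_tangent_chart mX hF sf0).
split=> [[ff0 /eqv dff0] i|ff0].
  by split=> // L cL LU; exact: (cvg_on_set_chart f f0 mX).1.
split; first by apply/(cvg_on_set_chart _ _ mX) => i; case: (ff0 i).
by apply/eqv => i; case: (ff0 i).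
Qed.

End GlobalConvergence.

(** * Algebras of functions with pointwise operations *)

Record pointwise_linear (K : numFieldType) (X : Type) (A : lmodType K)
    (S : choiceType) (ev : S -> X -> A) := PointwiseLinear {
  pzero : S ;
  padd : S -> S -> S ;
  pscale : K -> S -> S ;
  pointwise_inj : forall f g, (forall x, ev f x = ev g x) -> f = g ;
  pzeroE : forall x, ev pzero x = 0 ;
  paddE : forall f g x, ev (padd f g) x = ev f x + ev g x ;
  pscaleE : forall a f x, ev (pscale a f) x = a *: ev f x
}.

Section PointwiseModule.
Variables (K : numFieldType) (X : Type) (A : lmodType K).
Variables (S : choiceType) (ev : S -> X -> A).
Variable D : pointwise_linear ev.

(* The parameter [D] makes the operations inferable from the type. *)
Definition pointwise_module : Type := let _ := D in S.

HB.instance Definition _ := Choice.copy pointwise_module S.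

Local Ltac pointwise :=
  apply: (pointwise_inj D) => x; rewrite ?(paddE, pscaleE, pzeroE).

Lemma paddA : associative (padd D).
Proof. by move=> f g h; pointwise; exact: addrA. Qed.

Lemma paddC : commutative (padd D).
Proof. by move=> f g; pointwise; exact: addrC. Qed.

Lemma padd0 : left_id (pzero D) (padd D).
Proof. by move=> f; pointwise; exact: add0r. Qed.

Lemma paddN : left_inverse (pzero D) (pscale D (- 1)) (padd D).
Proof. by move=> f; pointwise; rewrite scaleN1r addNr. Qed.

HB.instance Definition _ :=
  GRing.isZmodule.Build pointwise_module paddA paddC padd0 paddN.

Lemma pscaleA a b f : pscale D a (pscale D b f) = pscale D (a * b) f.
Proof. by pointwise; exact: scalerA. Qed.

Lemma pscale1 : left_id 1 (pscale D).
Proof. by move=> f; pointwise; exact: scale1r. Qed.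

Lemma pscaleDr : right_distributive (pscale D) (padd D).
Proof. by move=> a f g; pointwise; exact: scalerDr. Qed.

Lemma pscaleDl f : {morph (pscale D)^~ f : a b / a + b >-> padd D a b}.
Proof. by move=> a b; pointwise; exact: scalerDl. Qed.

HB.instance Definition _ := GRing.Zmodule_isLmodule.Build K pointwise_module
  pscaleA pscale1 pscaleDr pscaleDl.

End PointwiseModule.

(** The pointwise identities and the injectivity of [ev] imply the axioms of an
   algebra, so that only topological properties remain to be supplied. *)
Record pointwise_operations (K : numFieldType) (X : Type) (A : lcAlgType K)
    (S : topologicalType) (ev : S -> X -> A) := PointwiseOperations {
  plinear :> pointwise_linear ev ;
  pmul : S -> S -> S ;
  pmulE : forall f g x, ev (pmul f g) x = alg_mul (ev f x) (ev g x) ;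
  padd_continuous : continuous (fun p : S * S => padd plinear p.1 p.2) ;
  pscale_continuous : continuous (fun p : K^o * S => pscale plinear p.1 p.2) ;
  pmul_continuous : continuous (fun p : S * S => pmul p.1 p.2) ;
  pointwise_hausdorff : hausdorff_space S ;
  pointwise_convex_nbhs : forall (f : S) (N : set S), nbhs f N ->
    exists C : set S, [/\ open C, C f, C `<=` N &
      forall a g h, 0 <= a -> a <= 1 -> C g -> C h ->
        C (padd plinear (pscale plinear a g) (pscale plinear (1 - a) h))]
}.

Section PointwiseAlgebra.
Variables (K : numFieldType) (X : Type) (A : lcAlgType K).
Variables (S : topologicalType) (ev : S -> X -> A).
Variable D : pointwise_operations ev.

Definition pointwise_space : Type := pointwise_module D.

HB.instance Definition _ := Topological.copy pointwise_space S.
HB.instance Definition _ := GRing.Lmodule.copy pointwise_space (pointwise_module D).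

Local Ltac pointwise :=
  apply: (pointwise_inj D) => x; rewrite ?(pmulE, paddE, pscaleE, pzeroE).

Lemma pointwise_locally_convex : exists2 B : set_system pointwise_space,
  (forall b, b \in B -> @convex_set K pointwise_space b) & basis B.
Proof.
exists [set C | open C /\ @convex_set K pointwise_space C].
  by move=> C /set_mem[].
split=> [C []//|f N /(pointwise_convex_nbhs D)[C [oC Cf CN cC]]].
exists C => //; split=> //; split=> //; apply/convex_setP => a x y a0 a1 Cx Cy.
exact: cC.
Qed.

HB.instance Definition _ := PreTopologicalNmodule_isTopologicalNmodule.Build
  pointwise_space (@padd_continuous _ _ _ _ _ D).
HB.instance Definition _ := TopologicalNmodule_isTopologicalLmodule.Build K
  pointwise_space (@pscale_continuous _ _ _ _ _ D).
(* This provides the uniform structure of the translations. *)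
HB.instance Definition _ := PreTopologicalLmod_isTvs.Build K pointwise_space
  (@padd_continuous _ _ _ _ _ D) (@pscale_continuous _ _ _ _ _ D)
  pointwise_locally_convex.
HB.instance Definition _ := Uniform_isTvs.Build K pointwise_space
  pointwise_locally_convex.

Lemma pmulDl : left_distributive (pmul D) (padd D).
Proof. by move=> f g h; pointwise; exact: alg_mulDl. Qed.

Lemma pmulDr : right_distributive (pmul D) (padd D).
Proof. by move=> f g h; pointwise; exact: alg_mulDr. Qed.

Lemma pscaleAl a f g : pscale D a (pmul D f g) = pmul D (pscale D a f) g.
Proof. by pointwise; exact: alg_scaleAl. Qed.

Lemma pscaleAr a f g : pscale D a (pmul D f g) = pmul D f (pscale D a g).
Proof. by pointwise; exact: alg_scaleAr. Qed.

HB.instance Definition _ := Tvs_isLcAlgebra.Build K pointwise_space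
  (@pointwise_hausdorff _ _ _ _ _ D) pmulDl pmulDr pscaleAl pscaleAr (@pmul_continuous _ _ _ _ _ D).

Lemma pointwise_operations_lc_algebra : pointwise_lc_algebra (A := A) ev.
Proof.
exists (pointwise_space : lcAlgType K), id, id; split; split=> //.
- by move=> x; exact: cvg_id.
- by move=> x; exact: cvg_id.
- exact: (paddE D).
- exact: (pscaleE D).
- exact: (pmulE D).
Qed.

End PointwiseAlgebra.

(** * The topology of the space of $C^r$-maps *)

Section CrTopology.
Variables (R : realType) (X : charted R) (F : tvsType R) (r : smoothness).
Local Notation CrX := (Cr_space X F r).

Lemma order_le0 : order_le 0 r. Proof. by case: r. Qed.

Lemma cvg_Cr_diff (Q : set_system CrX) (g0 : CrX) : Filter Q ->
  Q --> g0 <-> forall n, order_le n r -> @Cr_diff R X F r n @ Q --> @Cr_diff R X F r n g0.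
Proof.
move=> FQ; rewrite cvg_sup; split=> [Qg n nr N Ng|Qg [n nr] N].
  move: Ng; rewrite nbhsE => -[O [oO Og] ON].
  apply: (@filterS _ Q _ (@Cr_diff R X F r n @^-1` O)); first by move=> f; exact: ON.
  apply: (Qg (exist _ n nr)); apply: open_nbhs_nbhs; split; first by exists O.
  exact: Og.
rewrite nbhsE => -[_ [[O oO <-] Og] ON].
apply: (@filterS _ Q _ _ _ ON); apply: (Qg n nr).
by apply: open_nbhs_nbhs; split.
Qed.

Lemma Cr_diff_continuous n : order_le n r -> continuous (@Cr_diff R X F r n).
Proof. by move=> nr g; have [H _] := @cvg_Cr_diff (nbhs g) g _; exact: H. Qed.

Hypothesis diff_continuous : forall n (g : X -> F), order_le n r -> Cr r g ->
  continuous (@iter_tangent_diff R X F g n).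

Lemma cvg_CrP (Z : Type) (Q : set_system Z) (g : Z -> CrX) g0 : Filter Q ->
  g @ Q --> g0 <->
  forall n, order_le n r -> forall K, compact K ->
    cvg_on_set Q K (fun z => @Cr_diff R X F r n (g z)) (@Cr_diff R X F r n g0).
Proof.
move=> FQ; rewrite cvg_Cr_diff; split=> Qg n nr.
  apply/(compact_open_cvg_on_set (@Cr_diff R X F r n \o g)); last exact: Qg.
    exact: uniform_regular.
  exact/diff_continuous/svalP.
apply/(compact_open_cvg_on_set (@Cr_diff R X F r n \o g)); last exact: Qg.
  exact: uniform_regular.
exact/diff_continuous/svalP.
Qed.

(** Points are compact sets, and the differential of order $0$ is the map itself. *)
Lemma Cr_eval_continuous x : continuous (fun g : CrX => sval g x).
Proof.
move=> g; have cx : compact [set x] by exact: compact_set1.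
have gx := (@cvg_CrP CrX (nbhs g) id g _).1 (@cvg_id _ _) 0%N order_le0 _ cx x erefl.
move=> N /gx [[A B] [/= gA xB] AB]; apply: filterS gA => h Ah.
by apply: (AB (h, x)); split=> //; exact: (nbhs_singleton xB).
Qed.

Lemma Cr_eq (g h : CrX) : (forall x, sval g x = sval h x) -> g = h.
Proof.
case: g h => [g Cg] [h Ch] /= /funext gh; case: h / gh Ch => Ch.
by congr exist; exact: Prop_irrelevance.
Qed.

Lemma Cr_hausdorff : hausdorff_space F -> hausdorff_space CrX.
Proof.
move=> hF g h gh; apply: Cr_eq => x.
by apply: (@cluster_nbhs_image _ _ (fun g : CrX => sval g x) _ _ hF _ _ gh);
  exact: Cr_eval_continuous.
Qed.

End CrTopology.

(** * Operations on $C^r$-maps *)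

Section CrOperations.
Variables (R : realType) (k : scalar_kind) (A : lcAlgType (scalars R k)).
Variables (X : charted R) (r : smoothness).
Local Notation AR := (realified R k A).
Local Notation K := (scalars R k).
Local Notation CrX := (Cr_space X AR r).

Hypothesis Cr0 : Cr r (fun _ : X => 0 : AR).
Hypothesis CrL : forall (a : K) (f g : X -> A), @Cr R X AR r f -> @Cr R X AR r g ->
  @Cr R X AR r (fun x => a *: f x + g x).
Hypothesis CrM : forall f g : X -> A, @Cr R X AR r f -> @Cr R X AR r g ->
  @Cr R X AR r (fun x => alg_mul (f x) (g x)).
Hypothesis diff_continuous : forall n (g : X -> AR), order_le n r -> Cr r g ->
  continuous (@iter_tangent_diff R X AR g n).
Hypothesis diffL : forall n (a : K) (f g : X -> A) w, order_le n r ->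
  @Cr R X AR r f -> @Cr R X AR r g ->
  @iter_tangent_diff R X AR (fun x => a *: f x + g x) n w =
  a *: (@iter_tangent_diff R X AR f n w : A) + @iter_tangent_diff R X AR g n w.

Definition Cr_zero : CrX := exist _ _ Cr0.
Definition Cr_lin (a : K) (f g : CrX) : CrX :=
  exist _ _ (CrL a (svalP f) (svalP g)).
Definition Cr_mul (f g : CrX) : CrX := exist _ _ (CrM (svalP f) (svalP g)).

Lemma Cr_diff_lin n a f g w : order_le n r ->
  @Cr_diff R X AR r n (Cr_lin a f g) w =
  a *: (@Cr_diff R X AR r n f w : A) + @Cr_diff R X AR r n g w.
Proof. by move=> nr; exact: diffL nr (svalP f) (svalP g). Qed.

Lemma Cr_diff0 n w : order_le n r -> @Cr_diff R X AR r n Cr_zero w = 0.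
Proof.
move=> nr; have := Cr_diff_lin 1 Cr_zero Cr_zero w nr; rewrite scale1r.
have -> : Cr_lin 1 Cr_zero Cr_zero = Cr_zero.
  by apply: Cr_eq => x /=; rewrite scaler0 addr0.
by move=> /esym/eqP; rewrite -subr_eq0 addrK => /eqP.
Qed.

Hypothesis Cr_mul_continuous : continuous (fun p : CrX * CrX => Cr_mul p.1 p.2).

(** Linearity of the differentials reduces the claim to the continuity of the vector
   space operations of [A]. *)
Lemma Cr_lin_continuous :
  continuous (fun p : K^o * (CrX * CrX) => Cr_lin p.1 p.2.1 p.2.2).
Proof.
move=> [a0 [f0 g0]].
pose Q : set_system (K^o * (CrX * CrX)) := nbhs (a0, (f0, g0)).
have FQ : Filter Q by exact: nbhs_filter.
apply: (@cvg_CrP R X AR r diff_continuous _ Q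
  (fun p => Cr_lin p.1 p.2.1 p.2.2) (Cr_lin a0 f0 g0) FQ).2 => n nr L cL.
have Qf : (fun z : K^o * (CrX * CrX) => z.2.1) @ Q --> f0.
  exact: (@continuous_comp _ _ _ snd fst _ (@continuous_snd K^o (CrX * CrX)%type (a0, (f0, g0)))
    (@continuous_fst CrX CrX (f0, g0))).
have Qg : (fun z : K^o * (CrX * CrX) => z.2.2) @ Q --> g0.
  exact: (@continuous_comp _ _ _ snd snd _ (@continuous_snd K^o (CrX * CrX)%type (a0, (f0, g0)))
    (@continuous_snd CrX CrX (f0, g0))).
have {}Qf := (cvg_CrP diff_continuous _ f0 FQ).1 Qf n nr L cL.
have {}Qg := (cvg_CrP diff_continuous _ g0 FQ).1 Qg n nr L cL.
have Qa : @cvg_on_set _ Q _ K^o L (fun z _ => z.1) (fun _ => a0).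
  move=> y Ly; apply: (@cvg_comp _ _ _ fst (fun z : K^o * (CrX * CrX) => z.1)).
    exact: cvg_fst.
  exact: (@continuous_fst K^o (CrX * CrX)%type (a0, (f0, g0))).
apply: (cvg_on_set_eq (f := fun z w =>
    z.1 *: (@Cr_diff R X AR r n z.2.1 w : A) + @Cr_diff R X AR r n z.2.2 w)
  (f0 := fun w => a0 *: (@Cr_diff R X AR r n f0 w : A) + @Cr_diff R X AR r n g0 w)).
- by move=> [a [f g]] w _ /=; rewrite -(diffL a w nr (svalP f) (svalP g)).
- by move=> w _ /=; rewrite -(diffL a0 w nr (svalP f0) (svalP g0)).
- apply: (@cvg_on_set2 _ Q _ _ A A A L (fun u v => u + v)) => //; first exact: add_continuous.
  apply: (@cvg_on_set2 _ Q _ _ K^o A A L (fun u v => u *: v)) => //.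
  exact: scale_continuous.
Qed.

(** Let [Q] be the filter generated by the convex open sets containing [f0]. The
   claim is that [Q] converges to [f0], which can be checked on one differential
   and one compact set at a time. *)
Lemma Cr_convex_nbhs (f0 : CrX) (N : set CrX) : nbhs f0 N ->
  exists C : set CrX, [/\ open C, C f0, C `<=` N &
    forall a g h, 0 <= a -> a <= 1 -> C g -> C h ->
      C (Cr_lin a g (Cr_lin (1 - a) h Cr_zero))].
Proof.
pose cvx (C : set CrX) := forall a g h, 0 <= a -> a <= 1 -> C g -> C h ->
      C (Cr_lin a g (Cr_lin (1 - a) h Cr_zero)).
pose Q : set_system CrX := filter_from [set C | [/\ open C, C f0 & cvx C]] id.
have FQ : Filter Q.
  apply: filter_from_filter; first by exists setT; split=> //; exact: openT.
  move=> C D [oC Cf cC] [oD Df cD]; exists (C `&` D) => //; split.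
  - exact: openI.
  - by [].
  - by move=> a g h a0 a1 [Cg Dg] [Ch Dh]; split; [exact: cC|exact: cD].
suff Qf : Q --> f0 by move=> /Qf[C [oC Cf cC] CN]; exists C.
apply: (@cvg_CrP R X AR r diff_continuous CrX Q id f0 FQ).2 => n nr L cL y Ly O yO.
pose d f : iter_tangent X n -> A := @Cr_diff R X AR r n f.
have [[U V1] [/= yU V10] UV] : nbhs (d f0 y, 0 : A) [set p | O (p.1 + p.2)].
  by apply: (@add_continuous A (d f0 y, 0)); rewrite /= addr0.
have [V [oV cV V0 VV1]] := tvs_convex_nbhs V10.
pose C := [set f : CrX | forall x, L x -> V (d f x - d f0 x)].
have dN f x : d (Cr_lin (- 1) f0 f) x = d f x - d f0 x.
  by rewrite /d Cr_diff_lin// scaleN1r addrC.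
have oC : open C.
  (* a translate of a subbasic set of the compact-open topology *)
  have -> : C = (fun f => Cr_lin (- 1) f0 f) @^-1` [set h | d h @` L `<=` V].
    apply/seteqP; split=> f /= Cf; first by move=> _ [x Lx <-]; rewrite dN; exact: Cf.
    by move=> x Lx; rewrite -dN; apply: Cf; exists x.
  apply: open_comp => [f _|]; last first.
    have := compact_open_open cL (oV : @open AR V).
    by apply: open_comp => h _; exact: Cr_diff_continuous nr h.
  apply: (@continuous_comp _ _ _ (fun f => (- 1 : K^o, (f0, f))) (fun p => Cr_lin p.1 p.2.1 p.2.2)).
    apply: (@cvg_pairI _ (nbhs f)); first exact: cvg_cst.
    by apply: (@cvg_pairI _ (nbhs f)); [exact: cvg_cst|exact: cvg_id].
  exact: Cr_lin_continuous.
exists (C, [set x | L x /\ U (d f0 x)]) => /=.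
  split.
    exists C => //; split=> //; first by move=> x _; rewrite subrr.
    move=> a g h a0 a1 Cg Ch x Lx.
    rewrite /d !Cr_diff_lin// Cr_diff0 // addr0.
    have -> : a *: d g x + (1 - a) *: d h x - d f0 x =
        a *: (d g x - d f0 x) + (1 - a) *: (d h x - d f0 x).
      by rewrite !scalerBr addrACA -opprD -scalerDl subrKC scale1r.
    by move/convex_setP: cV; apply=> //; [exact: Cg|exact: Ch].
  have cd : {for y, continuous (d f0)} by exact/diff_continuous/svalP.
  by apply: (@filterS _ (nbhs y) _ _ _ _ (cd _ yU)).
move=> [f x] [/= Cf [Lx Ux]].
have := UV (d f0 x, d f x - d f0 x); rewrite /= subrKC; apply; split=> //.
by apply: VV1; exact: Cf.
Qed.

Lemma Cr_add_continuous : continuous (fun p : CrX * CrX => Cr_lin 1 p.1 p.2).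
Proof.
move=> p; apply: (@continuous_comp _ _ _ (fun p : CrX * CrX => (1 : K^o, p))
  (fun p => Cr_lin p.1 p.2.1 p.2.2)).
  by apply: (@cvg_pairI _ (nbhs p)); [exact: cvg_cst|exact: cvg_id].
exact: Cr_lin_continuous.
Qed.

Lemma Cr_scale_continuous : continuous (fun p : K^o * CrX => Cr_lin p.1 p.2 Cr_zero).
Proof.
move=> p; apply: (@continuous_comp _ _ _
  (fun p : K^o * CrX => (p.1, (p.2, Cr_zero))) (fun p => Cr_lin p.1 p.2.1 p.2.2)).
  apply: (@cvg_pairI _ (nbhs p)); first exact: continuous_fst.
  by apply: (@cvg_pairI _ (nbhs p)); [exact: continuous_snd|exact: cvg_cst].
exact: Cr_lin_continuous.
Qed.

Definition Cr_linear : pointwise_linear (A := A) (fun g : CrX => sval g).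
Proof.
apply: (@PointwiseLinear _ _ _ _ _ Cr_zero (Cr_lin 1)
  (fun a f => Cr_lin a f Cr_zero)).
- exact: Cr_eq.
- by [].
- by move=> f g x /=; rewrite scale1r.
- by move=> a f x /=; rewrite addr0.
Defined.

Definition Cr_operations : pointwise_operations (A := A) (fun g : CrX => sval g).
Proof.
apply: (@PointwiseOperations _ _ _ _ _ Cr_linear Cr_mul).
- by [].
- exact: Cr_add_continuous.
- exact: Cr_scale_continuous.
- exact: Cr_mul_continuous.
- by apply: Cr_hausdorff => //; exact: (@lc_hausdorff _ A).
- move=> f N /Cr_convex_nbhs[C [oC Cf CN cC]]; exists C; split=> // a g h a0 a1 Cg Ch /=.
  have -> : Cr_lin 1 (Cr_lin a g Cr_zero) (Cr_lin (1 - a) h Cr_zero) =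
    Cr_lin a g (Cr_lin (1 - a) h Cr_zero).
    by apply: Cr_eq => x /=; rewrite scale1r addr0.
  exact: cC.
Defined.

End CrOperations.

(** * The algebras of $C^r$-maps on manifolds and of continuous maps *)

Lemma is_dirder_cst (R : realType) (E F : tvsType R) (c : F) (x h : E) :
  is_dirder (fun=> c) x h 0.
Proof.
rewrite /is_dirder (_ : (fun t : R => _) = fun=> 0); first exact: cvg_cst.
by apply/funext => t; rewrite subrr scaler0.
Qed.

Lemma smooth_cst (R : realType) m (E F : tvsType R) (U : set E) (c : F) :
  hausdorff_space F -> open U -> smooth m U (fun=> c).
Proof.
move=> hF; elim: m E U c => [|m IHm] E U c oU; first by split=> // x _; exact: cvg_cst.
split=> [x _|]; first exact: cvg_cst.
split=> [x h _|]; first by exists 0; exact: is_dirder_cst.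
apply: (smooth_eq _ _ (IHm _ _ 0 _)); [exact: openX_setT| |exact: openX_setT].
by move=> q _; apply/esym/dirderE => //; exact: is_dirder_cst.
Qed.

Lemma alg_mul0l (K : numFieldType) (A : lcAlgType K) (x : A) : alg_mul 0 x = 0.
Proof. by rewrite -[X in alg_mul X _](scale0r (0 : A)) -alg_scaleAl scale0r. Qed.

Lemma alg_mul0r (K : numFieldType) (A : lcAlgType K) (x : A) : alg_mul x 0 = 0.
Proof. by rewrite -[X in alg_mul _ X](scale0r (0 : A)) -alg_scaleAr scale0r. Qed.

Section RealifiedAlgebra.
Variables (R : realType) (k : scalar_kind) (A : lcAlgType (scalars R k)).
Local Notation AR := (realified R k A).
Local Notation K := (scalars R k).

Lemma realified_hausdorff : hausdorff_space AR.
Proof. exact: (@lc_hausdorff _ A). Qed.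

Lemma real_scaleE (t : R) (x : AR) : t *: x = (of_real k t *: (x : A) : AR).
Proof. by []. Qed.

Lemma continuous_linear_scale (a : K) :
  continuous_linear (fun x : AR => (a *: (x : A) : AR)).
Proof.
split=> [x|t x y].
  have ca : (fun _ : A => a : K^o) @ nbhs (x : A) --> (a : K^o) by exact: cvg_cst.
  exact: (@cvgZ_tvs K A _ (nbhs (x : A)) _ _ _ _ _ ca cvg_id).
by rewrite !real_scaleE scalerDr !scalerA mulrC.
Qed.

Lemma continuous_bilinear_mul :
  @continuous_bilinear R AR AR AR (fun x y => alg_mul (x : A) (y : A)).
Proof.
split; first exact: (@alg_mul_continuous _ A).
  by move=> t x y z; rewrite !real_scaleE alg_mulDl alg_scaleAl.
by move=> t x y z; rewrite !real_scaleE alg_mulDr alg_scaleAr.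
Qed.

Section OnManifold.
Variables (X : charted R).
Implicit Types (f g : X -> A) (i : chart_index X).

Lemma in_chart_lin (a : K) f g i :
  in_chart (X := X) (F := AR) (i := i) (fun x => a *: f x + g x) =
  (fun y => a *: (in_chart (F := AR) (i := i) f y : A) + in_chart (F := AR) (i := i) g y).
Proof.
by apply/funext => y; rewrite /in_chart; case: pselect => //; rewrite scaler0 addr0.
Qed.

Lemma in_chart_mul f g i :
  in_chart (X := X) (F := AR) (i := i) (fun x => alg_mul (f x) (g x)) =
  (fun y => alg_mul (in_chart (F := AR) (i := i) f y : A) (in_chart (F := AR) (i := i) g y)).
Proof.
apply/funext => y; rewrite /in_chart; case: pselect => //.
by rewrite alg_mul0l.
Qed.

Lemma smooth_on_charts_lin m (mX : smooth_manifold 0 X) (a : K) f g :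
  smooth_on_charts (F := AR) m f -> smooth_on_charts (F := AR) m g ->
  smooth_on_charts (F := AR) m (fun x => a *: f x + g x).
Proof.
move=> sf sg i; rewrite in_chart_lin.
have oU := chart_codom_open mX i.
apply: (@smoothD R m _ AR) => //; first exact: realified_hausdorff.
exact: (smooth_postcomp realified_hausdorff oU (continuous_linear_scale a) (sf i)).
Qed.

Lemma smooth_on_charts_mul m (mX : smooth_manifold 0 X) f g :
  smooth_on_charts (F := AR) m f -> smooth_on_charts (F := AR) m g ->
  smooth_on_charts (F := AR) m (fun x => alg_mul (f x) (g x)).
Proof.
move=> sf sg i; rewrite in_chart_mul.
have oU := chart_codom_open mX i; have hA := realified_hausdorff.
exact: (smooth_bilinear continuous_bilinear_mul hA hA hA oU (sf i) (sg i)).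
Qed.

Lemma tangent_diff_lin (a : K) f g w :
  smooth_on_charts (F := AR) 1 f -> smooth_on_charts (F := AR) 1 g ->
  tangent_diff (F := AR) (fun x => a *: f x + g x) w =
  a *: (tangent_diff (F := AR) f w : A) + tangent_diff (F := AR) g w.
Proof.
move=> sf sg; rewrite /tangent_diff; case: pselect => [wP|]; last first.
  by move=> _; rewrite scaler0 addr0.
move: (projT1 (cid wP)) (projT2 (cid wP)) => i /= iw.
have U : (chart i @` chart_dom i) (chart i (base w)) by exists (base w).
rewrite in_chart_lin; apply: (@dirderE R _ AR); first exact: realified_hausdorff.
apply: (@is_dirderD R _ AR); last exact: smooth_dirder (sg i) U.
apply: (is_dirder_postcomp (continuous_linear_scale a)).
exact: smooth_dirder (sf i) U.
Qed.

End OnManifold.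

Section CrAlgebra.
Variables (r : smoothness) (X : charted R).
Hypothesis mX : is_manifold r X.

Lemma manifold_leq m : order_le m r -> smooth_manifold m X.
Proof. exact: is_manifold_smooth. Qed.

Let mX0 : smooth_manifold 0 X := manifold_leq (order_le0 r).

Lemma CrP (F : tvsType R) (g : X -> F) :
  @Cr R X F r g <-> forall m, order_le m r -> smooth_on_charts m g.
Proof.
split=> [[cg sg] m mr i|sg].
  by apply/Ck_on_smooth; [exact: chart_codom_open mX0 i|exact: sg].
split=> [|i m mr].
  exact: (smooth_on_charts_continuous mX0 (sg _ (order_le0 r))).
by apply/Ck_on_smooth; [exact: chart_codom_open mX0 i|exact: sg].
Qed.

Lemma Cr_lin_closed (a : K) (f g : X -> A) : @Cr R X AR r f -> @Cr R X AR r g ->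
  @Cr R X AR r (fun x => a *: f x + g x).
Proof.
move=> /CrP sf /CrP sg; apply/CrP => m mr.
by apply: smooth_on_charts_lin => //; [exact: sf|exact: sg].
Qed.

Lemma Cr_mul_closed (f g : X -> A) : @Cr R X AR r f -> @Cr R X AR r g ->
  @Cr R X AR r (fun x => alg_mul (f x) (g x)).
Proof.
move=> /CrP sf /CrP sg; apply/CrP => m mr.
by apply: smooth_on_charts_mul => //; [exact: sf|exact: sg].
Qed.

Lemma Cr0_closed : Cr r (fun _ : X => 0 : AR).
Proof.
apply/CrP => m mr i; have oU := chart_codom_open mX0 i.
apply: (@smooth_eq _ _ _ _ _ (fun=> 0)) => //; last first.
  by apply: smooth_cst => //; exact: realified_hausdorff.
by move=> y _; rewrite /in_chart; case: pselect.
Qed.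

(** The differentials of order [n] are $C^1$ on the [n]-th tangent bundle when the
   order $n+1$ is admissible, so that one more differential is linear. *)
Lemma Cr_diff_lin_closed n (a : K) (f g : X -> A) w : order_le n r ->
  @Cr R X AR r f -> @Cr R X AR r g ->
  @iter_tangent_diff R X AR (fun x => a *: f x + g x) n w =
  a *: (@iter_tangent_diff R X AR f n w : A) + @iter_tangent_diff R X AR g n w.
Proof.
move=> nr /CrP sf /CrP sg; elim: n nr w => [//|n IHn] nr w.
have nr' : order_le n r by move: nr; case: (r) => //= m; exact: ltnW.
rewrite /= (_ : @iter_tangent_diff R X AR (fun x => a *: f x + g x) n = fun w =>
  a *: (@iter_tangent_diff R X AR f n w : A) + @iter_tangent_diff R X AR g n w).
  have s1 (h : X -> AR) : (forall m, order_le m r -> smooth_on_charts m h) ->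
      smooth_on_charts (X := iter_tangent X n) 1 (@iter_tangent_diff R X AR h n).
    move=> sh; apply: iter_tangent_diff_smooth; first exact: realified_hausdorff.
      by rewrite addn1; exact: manifold_leq.
    by rewrite addn1; exact: sh.
  by apply: tangent_diff_lin; exact: s1.
by apply/funext => v; exact: IHn.
Qed.

Lemma Cr_diff_continuous_closed n (g : X -> AR) : order_le n r -> Cr r g ->
  continuous (@iter_tangent_diff R X AR g n).
Proof.
move=> nr /CrP sg; apply: (iter_tangent_diff_continuous realified_hausdorff) (leqnn n).
  exact: manifold_leq.
exact: sg.
Qed.

(** The description of the topology from which the continuity of the multiplication
   follows, since products are formed separately in each chart *)
Lemma cvg_Cr_chartP (Z : Type) (Q : set_system Z) (g : Z -> Cr_space X AR r)
    (g0 : Cr_space X AR r) : Filter Q ->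
  g @ Q --> g0 <->
  forall m, order_le m r -> forall i : chart_index X,
    cvg_derivatives Q m (chart i @` chart_dom i)
      (fun z => in_chart (i := i) (sval (g z))) (in_chart (i := i) (sval g0)).
Proof.
move=> FQ; rewrite (cvg_CrP Cr_diff_continuous_closed) //.
have eqv m : order_le m r -> cvg_tangent_diffs Q m (fun z => sval (g z)) (sval g0) <->
    forall i : chart_index X, cvg_derivatives Q m (chart i @` chart_dom i)
      (fun z => in_chart (i := i) (sval (g z))) (in_chart (i := i) (sval g0)).
  move=> mr; apply: cvg_tangent_diffs_chart; first exact: realified_hausdorff.
  - exact: manifold_leq.
  - by move=> z; exact: (CrP _).1 (svalP (g z)) m mr.
  - exact: (CrP _).1 (svalP g0) m mr.
split=> [gg0 m mr|gg0 n nr].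
  apply/(eqv m mr)/cvg_tangent_diffsE => n nm; apply: gg0.
  by move: mr; case: (r) => //= j; exact: leq_trans.
exact: (cvg_tangent_diffsE _ _ _ _).1 ((eqv n nr).2 (gg0 n nr)) n (leqnn n).
Qed.

Lemma Cr_mul_continuous_manifold :
  continuous (fun p : Cr_space X AR r * Cr_space X AR r =>
    Cr_mul Cr_mul_closed p.1 p.2).
Proof.
move=> [f0 g0]; set CrX := Cr_space X AR r.
pose Q : set_system (CrX * CrX) := nbhs (f0, g0).
have FQ : Filter Q by exact: nbhs_filter.
apply: (@cvg_Cr_chartP _ Q (fun p => Cr_mul Cr_mul_closed p.1 p.2)
  (Cr_mul Cr_mul_closed f0 g0) FQ).2 => m mr i.
have Qf := (@cvg_Cr_chartP _ Q fst f0 FQ).1 (@continuous_fst CrX CrX (f0, g0)) m mr i.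
have Qg := (@cvg_Cr_chartP _ Q snd g0 FQ).1 (@continuous_snd CrX CrX (f0, g0)) m mr i.
have hA := realified_hausdorff; have oU := chart_codom_open mX0 i.
have sC (h : CrX) := (CrP _).1 (svalP h) m mr i.
have Qfg := cvg_derivatives_bilinear continuous_bilinear_mul hA hA hA oU
  (fun z => sC z.1) (sC f0) (fun z => sC z.2) (sC g0) Qf Qg.
by apply: (cvg_derivatives_eq oU _ _ (Qfg FQ)) => [z y _|y _] /=; rewrite in_chart_mul.
Qed.

Definition Cr_manifold_operations :=
  Cr_operations Cr0_closed Cr_lin_closed Cr_diff_continuous_closed Cr_diff_lin_closed
    Cr_mul_continuous_manifold.

End CrAlgebra.

Section Uncharted.
Variable X : topologicalType.
Local Notation X0 := (uncharted R X).

Lemma Cr_uncharted (F : tvsType R) (g : X -> F) :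
  @Cr R X0 F (Some 0%N) g <-> continuous g.
Proof. by split=> [[]//|cg]; split=> // -[]. Qed.

Lemma Cr0_uncharted : @Cr R X0 AR (Some 0%N) (fun=> 0).
Proof. by apply/Cr_uncharted => x; exact: cvg_cst. Qed.

Lemma Cr_lin_uncharted (a : K) (f g : X -> A) : @Cr R X0 AR (Some 0%N) f ->
  @Cr R X0 AR (Some 0%N) g -> @Cr R X0 AR (Some 0%N) (fun x => a *: f x + g x).
Proof.
move=> /Cr_uncharted cf /Cr_uncharted cg; apply/Cr_uncharted => x.
apply: (@cvgD_tvs _ AR) (cg x).
have [cZ _] := continuous_linear_scale a.
exact: (@continuous_comp _ _ _ f _ x (cf x) (cZ (f x))).
Qed.

Lemma Cr_mul_uncharted (f g : X -> A) : @Cr R X0 AR (Some 0%N) f ->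
  @Cr R X0 AR (Some 0%N) g -> @Cr R X0 AR (Some 0%N) (fun x => alg_mul (f x) (g x)).
Proof.
move=> /Cr_uncharted cf /Cr_uncharted cg; apply/Cr_uncharted => x.
exact: cvg_comp2 (cf x) (cg x) (@alg_mul_continuous _ A (f x, g x)).
Qed.

Lemma diff_continuous_uncharted n (g : X -> AR) : order_le n (Some 0%N) ->
  @Cr R X0 AR (Some 0%N) g -> continuous (@iter_tangent_diff R X0 AR g n).
Proof. by case: n => // _ /Cr_uncharted. Qed.

Lemma diff_lin_uncharted n (a : K) (f g : X -> A) w : order_le n (Some 0%N) ->
  @Cr R X0 AR (Some 0%N) f -> @Cr R X0 AR (Some 0%N) g ->
  @iter_tangent_diff R X0 AR (fun x => a *: f x + g x) n w =
  a *: (@iter_tangent_diff R X0 AR f n w : A) + @iter_tangent_diff R X0 AR g n w.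
Proof. by case: n w. Qed.

Lemma Cr_mul_continuous_uncharted :
  continuous (fun p : Cr_space X0 AR (Some 0%N) * Cr_space X0 AR (Some 0%N) =>
    @Cr_mul R k A X0 (Some 0%N) Cr_mul_uncharted p.1 p.2).
Proof.
move=> [f0 g0]; pose CrX := Cr_space X0 AR (Some 0%N).
pose Q : set_system (CrX * CrX) := nbhs (f0, g0).
have FQ : Filter Q by exact: nbhs_filter.
apply: (@cvg_CrP R X0 AR (Some 0%N) diff_continuous_uncharted _ Q
  (fun p => @Cr_mul R k A X0 (Some 0%N) Cr_mul_uncharted p.1 p.2)
  (@Cr_mul R k A X0 (Some 0%N) Cr_mul_uncharted f0 g0) FQ).2.
move=> [|//] n0 L cL.
have Qf := (@cvg_CrP R X0 AR (Some 0%N) diff_continuous_uncharted _ Q fst f0 FQ).1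
  (@continuous_fst CrX CrX (f0, g0)) 0%N n0 L cL.
have Qg := (@cvg_CrP R X0 AR (Some 0%N) diff_continuous_uncharted _ Q snd g0 FQ).1
  (@continuous_snd CrX CrX (f0, g0)) 0%N n0 L cL.
exact: (cvg_on_set2 (@alg_mul_continuous _ A) Qf Qg).
Qed.

Definition Cr_uncharted_operations :=
  @Cr_operations R k A X0 (Some 0%N) Cr0_uncharted Cr_lin_uncharted Cr_mul_uncharted
    diff_continuous_uncharted diff_lin_uncharted
    Cr_mul_continuous_uncharted.

End Uncharted.

End RealifiedAlgebra.

(** * Local compactness and exhaustion by compact sets *)

Definition balanced (K : numFieldType) (E : lmodType K) (W : set E) : Prop :=
  forall a x, `|a| <= 1 -> W x -> W (a *: x).

(** The largest balanced subset of a convex neighbourhood of $0$ is convex, being an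
   intersection of convex sets, and is a neighbourhood of $0$ since the
   multiplication by scalars is jointly continuous at $(0,0)$. *)
Lemma tvs_balanced_nbhs (K : numFieldType) (E : tvsType K) (N : set E) : nbhs 0 N ->
  exists V : set E, [/\ nbhs 0 V, @convex_set K E V, balanced V & V `<=` N].
Proof.
move=> /tvs_convex_nbhs[C [oC cC C0 CN]].
pose V := [set x | forall a : K, `|a| <= 1 -> C (a *: x)].
have [[A B] [/= A0 B0] AB] : nbhs (0 : K^o, 0 : E) [set z | C (z.1 *: z.2)].
  apply: (@scale_continuous K E (0, 0)); rewrite /= scale0r.
  exact: open_nbhs_nbhs.
have [e /= e0 eA] := A0.
exists V; split.
- have e2 : e / 2 != 0 by rewrite gt_eqF// divr_gt0.
  apply: filterS (nbhs0Z e2 B0) => _ [y By <-] a a1.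
  rewrite scalerA; apply: (AB (_, y)); split=> //=; apply: eA => /=.
  rewrite sub0r normrN normrM (@gtr0_norm _ (e / 2)) ?divr_gt0//.
  rewrite (@le_lt_trans _ _ (e / 2))//; first by rewrite ler_piMl// ltW// divr_gt0.
  by rewrite ltr_pdivrMr// ltr_pMr// ltr1n.
- apply/convex_setP => a x y a0 a1 Vx Vy b b1.
  rewrite scalerDr !scalerA ![b * _]mulrC -!scalerA.
  by move/convex_setP: cC; apply=> //; [exact: Vx|exact: Vy].
- by move=> a x a1 Vx b b1; rewrite scalerA; apply: Vx; rewrite normrM mulr_ile1.
- by move=> x /(_ 1); rewrite normr1 lexx scale1r => /(_ isT)/CN.
Qed.

Section FiniteDimensional.
Variables (R : realType) (E : tvsType R).

Lemma cvg_sum_tvs (T : Type) (Q : set_system T) {FQ : Filter Q} (I : Type)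
    (s : seq I) (f : I -> T -> E) (l : I -> E) :
  (forall i, f i @ Q --> l i) -> (fun x => \sum_(i <- s) f i x) @ Q --> \sum_(i <- s) l i.
Proof.
move=> fl; elim: s => [|i s IHs].
  rewrite big_nil (_ : (fun x => _) = fun=> 0); first exact: cvg_cst.
  by apply/funext => x; rewrite big_nil.
rewrite big_cons (_ : (fun x => _) = fun x => f i x + \sum_(j <- s) f j x).
  exact: cvgD_tvs.
by apply/funext => x; rewrite big_cons.
Qed.

Definition spanning n (b : 'I_n -> E) : Prop :=
  forall v, exists c : 'I_n -> R, v = \sum_(i < n) c i *: b i.

(** A spanning family of minimal length is independent. *)
Lemma finite_dimensional_basis : finite_dimensional E ->
  exists n (b : 'I_n -> E), spanning b /\
    forall c : 'I_n -> R, \sum_(i < n) c i *: b i = 0 -> forall i, c i = 0.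
Proof.
move=> [n0 [b0 sb0]].
have exn : exists n, `[< exists b : 'I_n -> E, spanning b >].
  by exists n0; apply/asboolP; exists b0.
have [n /asboolP [b sb] nmin] := ex_minnP exn.
exists n, b; split=> // c cb i; apply/eqP/negPn/negP => ci.
case: n b sb nmin c cb i ci => [|n] b sb nmin c cb i ci; first by case: i ci.
(* If [c i] is nonzero, then [b i] is a combination of the other vectors. *)
suff : (n.+1 <= n)%N by rewrite ltnn.
apply: nmin; apply/asboolP; exists (fun j => b (lift i j)) => v.
have [d ->] := sb v.
have bi : b i = \sum_(j < n) (- (c i)^-1 * c (lift i j)) *: b (lift i j).
  move: cb; rewrite (bigD1_ord i)//= => /eqP; rewrite addr_eq0 => /eqP cb.
  rewrite -[LHS]scale1r -(mulVf ci) -scalerA cb scalerN -scaleNr scaler_sumr.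
  by apply: eq_bigr => j _; rewrite scalerA.
exists (fun j => d i * (- (c i)^-1 * c (lift i j)) + d (lift i j)).
rewrite (bigD1_ord i)//= {1}bi scaler_sumr -big_split /=.
by apply: eq_bigr => j _; rewrite scalerA scalerDl.
Qed.

(** For an isomorphism $\phi$ from $\mathbb R^n$, the image of the boundary of the
   unit cube is compact and misses $0$, so that it misses a balanced neighbourhood of
   $0$. By scaling, this neighbourhood lies in the image of the cube. *)
Lemma finite_dimensional_compact_nbhs : hausdorff_space E -> finite_dimensional E ->
  exists2 N : set E, nbhs 0 N & compact N.
Proof.
move=> hE /finite_dimensional_basis[n [b [sb fb]]].
pose phi (v : 'rV[R]_n) : E := \sum_(i < n) v ord0 i *: b i.
have cphi : continuous phi.
  move=> v; apply: (@cvg_sum_tvs _ (nbhs v)) => i.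
  by apply: (@cvgZ_tvs R E _ (nbhs v)); [exact: coord_continuous|exact: cvg_cst].
pose cube : set 'rV[R]_n := [set v | forall i, `[-1, 1]%classic (v ord0 i)].
have ccube : compact cube.
  apply: (@rV_compact R n (fun=> `[-1, 1]%classic)) => i.
  exact: segment_compact.
(* A face is itself a product of compact sets. *)
pose face (i : 'I_n) (s : R) : set 'rV[R]_n :=
  [set v | forall j, (if j == i then [set s] else `[-1, 1]%classic) (v ord0 j)].
have cface i s : compact (face i s).
  apply: (@rV_compact R n (fun j => if j == i then [set s] else `[-1, 1]%classic)) => j.
  by case: ifP => _; [exact: compact_set1|exact: segment_compact].
have phi_compact (D : set 'rV[R]_n) : compact D -> compact (phi @` D).
  by apply: continuous_compact; exact: continuous_subspaceT.
have face_nbhs i (s : R) : s != 0 -> nbhs (0 : E) (~` (phi @` face i s)).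
  move=> s0; apply: open_nbhs_nbhs; split.
    by apply: closed_openC; apply: compact_closed => //; exact: phi_compact.
  move=> [v vf phi0]; have := fb _ phi0 i; have := vf i; rewrite eqxx => -> /eqP.
  by rewrite (negbTE s0).
have O0 : nbhs (0 : E) [set x | forall i, ~ (phi @` face i 1) x /\ ~ (phi @` face i (- 1)) x].
  apply: filter_forall => i; apply: filterI; apply: face_nbhs.
    exact: oner_neq0.
  by rewrite oppr_eq0 oner_neq0.
have [V [V0 _ bV VO]] := tvs_balanced_nbhs O0.
exists (phi @` cube); last exact: phi_compact.
apply: filterS V0 => x Vx; have [c xE] := sb x.
exists (\row_i c i); last by rewrite xE /phi; apply: eq_bigr => i _; rewrite mxE.
apply: contrapT => /existsNP[i0 ci0].
have [i _ imax] := @arg_maxP _ R _ i0 xpredT (fun i => `|c i|) isT.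
set M := `|c i| in imax.
have M1 : 1 < M.
  rewrite (lt_le_trans _ (imax i0 isT))// ltNge; apply/negP => ci1; apply: ci0.
  by rewrite /= in_itv/= -ler_norml mxE.
have M0 : 0 < M by exact: lt_trans M1.
have VM : V (M^-1 *: x).
  by apply: bV => //; rewrite normfV (gtr0_norm M0) invf_le1// ltW.
have facex s : c i = s * M -> (phi @` face i s) (M^-1 *: x).
  move=> sM; exists (\row_j (M^-1 * c j)); last first.
    by rewrite xE scaler_sumr; apply: eq_bigr => j _; rewrite mxE scalerA.
  move=> j; rewrite mxE; case: eqP => [->|_] /=.
    by rewrite sM mulrCA mulVf ?mulr1// gt_eqF.
  rewrite in_itv/= -ler_norml normrM normfV (gtr0_norm M0) ler_pdivrMl// mulr1.
  exact: imax.
have [f1 fN1] := VO _ VM i.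
have [ci|ci] := leP 0 (c i).
  by apply: f1; apply: facex; rewrite mul1r /M ger0_norm.
by apply: fN1; apply: facex; rewrite mulN1r /M ltr0_norm// opprK.
Qed.

End FiniteDimensional.

Section Exhaustion.
Variable R : realType.

Lemma manifold_compact_nbhs m (X : charted R) (x : X) : smooth_manifold m X ->
  finite_dimensional_charts X -> exists2 N : set X, nbhs x N & compact N.
Proof.
move=> mX fX; have [i ix] := chart_cover mX x.
have hE := @model_hausdorff _ _ _ mX i.
have [N N0 cN] := finite_dimensional_compact_nbhs hE (fX i).
set y := chart i x.
have cyN : compact (+%R y @` N).
  apply: continuous_compact => //; apply: continuous_subspaceT => z.
  by apply: cvgD_tvs; [exact: cvg_cst|exact: cvg_id].
have Uy : (chart i @` chart_dom i) y by exists x.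
have [L [cL LN] [P yP PL]] := compact_shrink hE cyN (chart_codom_open mX i) Uy.
have yL : nbhs y L by apply: filterS PL _; apply: filterI => //; exact: nbhsT.
exists (chart_dom i `&` chart i @^-1` L).
  apply: filterI; last exact: (chart_continuous mX ix).
  by apply: open_nbhs_nbhs; split=> //; exact: chart_dom_open mX i.
by apply: (chart_preimage_compact mX) => // z /LN[].
Qed.

(** Compact sets are directed under inclusion. By compactness of [K], all points of
   [K] are eventually interior along this directed family. *)
Lemma compact_interior_compact (X : topologicalType) (K : set X) :
  (forall x : X, exists2 N, nbhs x N & compact N) -> compact K ->
  exists2 D : set X, compact D & K `<=` D°.
Proof.
move=> lX cK; have cov := (compact_near_coveringP _).1 cK.
pose F : set_system (set X) :=
  filter_from (@compact X) (fun D => [set D' | compact D' /\ D `<=` D']).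
have FF : Filter F.
  apply: filter_from_filter; first by exists set0; exact: compact0.
  move=> D D' cD cD'; exists (D `|` D'); first exact: compactU.
  by move=> B [cB DB]; split; split=> // x Dx; apply: DB; [left|right].
have [|D cD DK] := cov _ F (fun D x => D° x) FF.
  move=> x _; have [N xN cN] := lX x.
  exists (N°, [set D' | compact D' /\ N `<=` D']) => /=.
    by split; [exact: nbhs_interior|exists N].
  by move=> [x' D'] [/= Nx' [_ ND']]; exact: (interiorS ND').
exists D => //; exact: (DK D (conj cD (@subset_refl _ D))).
Qed.

(** Compact sets $D_i$ whose interiors contain the members of a countable compact
   cover have interiors covering [X]; hence a compact set is contained in a finite
   union of the $D_i$. *)
Lemma compact_exhaustion (X : topologicalType) :
  (forall x : X, exists2 N, nbhs x N & compact N) -> sigma_compact X ->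
  exists E : nat -> set X, (forall n, compact (E n)) /\
    forall K, compact K -> exists n, K `<=` E n.
Proof.
move=> lX [C cC CX].
have exD n : exists D, compact D /\ C n `<=` D°.
  by have [D cD CD] := compact_interior_compact lX (cC n); exists D.
have [D DC] := choice exD.
pose E n := \big[setU/set0]_(i < n.+1) D i.
exists E; split=> [n|K cK].
  by apply: bigsetU_compact => i _; have [] := DC i.
have cov := (compact_near_coveringP _).1 cK.
have [|n _ KE] := cov _ \oo (fun n x => E n x) _.
  move=> x _; have : [set: X] x by [].
  rewrite -CX => -[m _ Cx]; have [_ CD] := DC m.
  exists ((D m)°, [set n | (m <= n)%N]) => /=.
    by split; [apply: open_nbhs_nbhs; split; [exact: open_interior|exact: CD]|exists m].
  move=> [x' n] [/= /interior_subset Dx' mn].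
  by rewrite /E -bigcup_mkord; exists m.
by exists n; apply: KE => /=.
Qed.

End Exhaustion.

(** * The topology given by a convex balanced absorbing set *)

Definition absorbing (K : numFieldType) (V : lmodType K) (W : set V) : Prop :=
  forall x, exists2 t : K, 0 < t & W (t *: x).

Record gauge (K : numFieldType) (V : lmodType K) := Gauge {
  gauge_set : set V ;
  gauge_convex : @convex_set K V gauge_set ;
  gauge_balanced : balanced gauge_set ;
  gauge_absorbing : absorbing gauge_set
}.

(** The multiples of [W] are to be a base of neighbourhoods of $0$: this is the
   locally convex topology, possibly not Hausdorff, given by the Minkowski functional
   of [W]. *)
Definition gauge_space (K : numFieldType) (V : lmodType K) (W : gauge V) : Type :=
  let _ := W in V.

Section GaugeSpace.
Variables (K : numFieldType) (V : lmodType K) (W : gauge V).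
Local Notation G := (gauge_space W).
Local Notation Ws := (gauge_set W).

HB.instance Definition _ := GRing.Lmodule.copy G V.

Let cvx (a : K) x y : 0 <= a -> a <= 1 -> Ws x -> Ws y -> Ws (a *: x + (1 - a) *: y).
Proof. by move=> a0 a1; have /convex_setP := @gauge_convex K V W; apply. Qed.

Let bal (a : K) x : `|a| <= 1 -> Ws x -> Ws (a *: x).
Proof. by move=> a1; have /(_ a x a1) := @gauge_balanced K V W. Qed.

Let gauge0 : Ws 0.
Proof.
by have [t _] := gauge_absorbing W 0; rewrite scaler0.
Qed.

Definition gauge_open : set_system G :=
  [set O | forall x : V, O x -> exists2 e : K, 0 < e & forall w, Ws w -> O (x + e *: w)].

Let gauge_openT : gauge_open setT.
Proof. by move=> x _; exists 1. Qed.

Let gauge_openI : setI_closed gauge_open.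
Proof.
move=> O O' oO oO' x [/oO[e e0 eO] /oO'[e' e'0 eO']].
(* Half the harmonic mean of [e] and [e'] is smaller than both; the order of [K] is
   partial, so that the minimum is avoided. *)
pose d := e * e' / (e + e'); have ee : 0 < e + e' by exact: addr_gt0.
have d0 : 0 < d by rewrite divr_gt0// mulr_gt0.
have shrink (c : K) w : 0 < c -> d <= c -> Ws w -> exists2 w', Ws w' & d *: w = c *: w'.
  move=> c0 dc Ww; exists ((d / c) *: w).
    have dc0 : 0 <= d / c by rewrite ltW// divr_gt0.
    by apply: bal => //; rewrite ger0_norm// ler_pdivrMr// mul1r.
  by rewrite scalerA mulrCA mulfV ?mulr1// gt_eqF.
exists d => // w Ww; split.
  have [|w' Ww' ->] := shrink e w e0 _ Ww; last exact: eO.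
  by rewrite /d ler_pdivrMr// ler_pM2l// lerDr ltW.
have [|w' Ww' ->] := shrink e' w e'0 _ Ww; last exact: eO'.
by rewrite /d ler_pdivrMr// mulrC ler_pM2l// lerDl ltW.
Qed.

Let gauge_open_bigU (I : Type) (f : I -> set G) :
  (forall i, gauge_open (f i)) -> gauge_open (\bigcup_i f i).
Proof.
move=> oO x [i _ /oO[e e0 eO]]; exists e => // w Ww; exists i => //; exact: eO.
Qed.

HB.instance Definition _ := isOpenTopological.Build G
  gauge_openT gauge_openI gauge_open_bigU.

Let gauge_interior (X : set V) : set V :=
  [set z | exists2 d : K, 0 < d & forall w, Ws w -> X (z + d *: w)].

Let half_convex w w' : Ws w -> Ws w' -> Ws (2^-1 *: w + 2^-1 *: w').
Proof.
move=> Ww Ww'; have h : 1 - 2^-1 = 2^-1 :> K by rewrite {1}(splitr 1) mul1r addrK.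
rewrite -[X in _ + X *: _]h; by apply: cvx => //; rewrite invf_le1// ler1n.
Qed.

(** For $z+dW\subseteq X$, each point of $z+\frac d2W$ has its translate of
   $\frac d2W$ in [X], since $\frac12W+\frac12W\subseteq W$ by convexity. *)
Lemma gauge_interior_open (X : set V) : open (gauge_interior X : set G).
Proof.
move=> z [d d0 dX]; exists (d / 2); first exact: divr_gt0.
move=> w Ww; exists (d / 2); first exact: divr_gt0.
move=> w' Ww'; rewrite -addrA -!(scalerA d) -scalerDr; apply: dX.
exact: half_convex.
Qed.

Lemma nbhs_gaugeP (x : G) (N : set G) :
  nbhs x N <-> exists2 e : K, 0 < e & forall w, Ws w -> N ((x : V) + e *: w).
Proof.
split=> [|[e e0 eN]].
  by rewrite nbhsE => -[O [oO Ox] ON]; have [e e0 eO] := oO x Ox; exists e => // w /eO/ON.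
apply: (@filterS _ (nbhs x) _ (gauge_interior N)).
  by move=> z [d d0 dN]; have := dN 0 gauge0; rewrite scaler0 addr0.
by apply: open_nbhs_nbhs; split; [exact: gauge_interior_open|exists e].
Qed.

Lemma gauge_add_continuous : continuous (fun p : G * G => p.1 + p.2).
Proof.
move=> [x y] N /nbhs_gaugeP[e e0 eN].
have e2 : 0 < e / 2 by exact: divr_gt0.
exists ([set z | exists2 w, Ws w & z = (x : V) + (e / 2) *: w],
        [set z | exists2 w, Ws w & z = (y : V) + (e / 2) *: w]) => /=.
  by split; apply/nbhs_gaugeP; exists (e / 2) => // w Ww; exists w.
move=> [_ _] [/= [w Ww ->] [w' Ww' ->]].
rewrite /= addrACA -!(scalerA e) -scalerDr; apply: eN; exact: half_convex.
Qed.

Lemma gauge_scale_continuous : continuous (fun z : K^o * G => z.1 *: z.2).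
Proof.
move=> [a x] N /nbhs_gaugeP[e e0 eN].
have [t t0 Wt] := gauge_absorbing W x.
pose M := `|a| + 1; have M0 : 0 < M by rewrite ltr_wpDl.
have s0 : 0 < e / 2 * t by rewrite mulr_gt0// divr_gt0.
have d0 : 0 < e / 2 / M by rewrite divr_gt0// divr_gt0.
exists ([set b : K | `|a - b| < 1] `&` [set b : K | `|a - b| < e / 2 * t],
        [set z | exists2 w, Ws w & z = (x : V) + (e / 2 / M) *: w]) => /=.
  split; last by apply/nbhs_gaugeP; exists (e / 2 / M) => // w Ww; exists w.
  by apply: (@filterI _ (nbhs (a : K^o))); [exists 1 => //=|exists (e / 2 * t) => //=].
move=> [b _] [/= [b1 bt] [w Ww ->]].
have bM : `|b| <= M.
  by rewrite -[b](subKr a) (le_trans (ler_normB _ _))// /M lerD2l ltW.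
have -> : b *: (x + (e / 2 / M) *: w) = a *: x + e *:
    (2^-1 *: (((b - a) / (e / 2 * t)) *: (t *: x)) + 2^-1 *: ((b / M) *: w)).
  have -> : e *: (2^-1 *: (((b - a) / (e / 2 * t)) *: (t *: x)) +
      2^-1 *: ((b / M) *: w)) = (b - a) *: (x : V) + b *: ((e / 2 / M) *: w).
    rewrite scalerDr !scalerA; congr (_ *: _ + _ *: _); field.
      by rewrite !gt_eqF.
    by rewrite gt_eqF.
  by rewrite addrA -scalerDl subrKC -scalerDr.
apply: eN; apply: half_convex; apply: bal => //.
  rewrite normrM normfV (gtr0_norm s0) distrC ler_pdivrMr// mul1r.
  exact: ltW.
by rewrite normrM normfV (gtr0_norm M0) ler_pdivrMr// mul1r.
Qed.

Lemma gauge_interior_convex (X : set V) : @convex_set K V X ->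
  @convex_set K V (gauge_interior X).
Proof.
move=> /convex_setP cX; apply/convex_setP => a x y a0 a1 [d d0 dX] [d' d'0 dX'].
have [->|an0] := eqVneq a 0.
  by rewrite scale0r add0r subr0 scale1r; exists d'.
have ap : 0 < a by rewrite lt_def an0.
exists (a * d + (1 - a) * d').
  by rewrite ltr_wpDr ?mulr_gt0// mulr_ge0 ?subr_ge0// ltW.
move=> w Ww; rewrite [(a * d + _) *: w]scalerDl addrACA -!(scalerA _ _ w) -!scalerDr.
by apply: cX => //; [exact: dX|exact: dX'].
Qed.

Lemma gauge_locally_convex : exists2 B : set_system G,
  (forall b, b \in B -> @convex_set K G b) & basis B.
Proof.
exists [set C | open C /\ @convex_set K G C]; first by move=> C /set_mem[].
split=> [C []//|x N /nbhs_gaugeP[e e0 eN]].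
pose X : set V := [set z | exists2 w, Ws w & z = (x : V) + e *: w].
exists (gauge_interior X : set G) => /=.
  split; last by exists e => // w Ww; exists w.
  split; first exact: gauge_interior_open.
  apply: gauge_interior_convex; apply/convex_setP => a _ _ a0 a1 [w Ww ->] [w' Ww' ->].
  exists (a *: w + (1 - a) *: w'); first exact: cvx.
  rewrite !scalerDr addrACA -scalerDl subrKC scale1r; congr (_ + _).
  by rewrite !scalerA ![_ * e]mulrC.
move=> z [d d0 /(_ 0 gauge0)[w Ww]]; rewrite scaler0 addr0 => ->.
exact: eN.
Qed.

HB.instance Definition _ := PreTopologicalNmodule_isTopologicalNmodule.Build
  G gauge_add_continuous.
HB.instance Definition _ := TopologicalNmodule_isTopologicalLmodule.Build K
  G gauge_scale_continuous.
(* This provides the uniform structure of the translations. *)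
HB.instance Definition _ := PreTopologicalLmod_isTvs.Build K G
  gauge_add_continuous gauge_scale_continuous gauge_locally_convex.
HB.instance Definition _ := Uniform_isTvs.Build K G gauge_locally_convex.

Lemma gauge_set_nbhs : nbhs (0 : G) (Ws : set G).
Proof. by apply/nbhs_gaugeP; exists 1 => // w Ww; rewrite scale1r add0r. Qed.

End GaugeSpace.

(** * Test functions *)

Lemma nbhs_set_type (T : topologicalType) (B : set T) (e : set_type B) (N : set (set_type B)) :
  nbhs e N <-> exists2 P, nbhs (set_val e) P & forall e', P (set_val e') -> N e'.
Proof.
split=> [|[P eP PN]].
  rewrite nbhsE => -[_ [[P oP <-] Pe] PN]; exists P => //.
  by exists P.
apply: (filterS PN); exact: (@initial_continuous _ _ set_val e P eP).
Qed.

Section TestFunctions.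
Variables (R : realType) (k : scalar_kind) (A : lcAlgType (scalars R k)).
Variables (X : charted R) (r : smoothness).
Hypothesis mX : is_manifold r X.
Local Notation AR := (realified R k A).
Local Notation K := (scalars R k).
Local Notation CrX := (Cr_space X AR r).
Local Notation TF := (test_functions X A r).

Let lin (a : K) (f g : CrX) : CrX := Cr_lin (Cr_lin_closed mX) a f g.
Let mul (f g : CrX) : CrX := Cr_mul (Cr_mul_closed mX) f g.
Let zero : CrX := Cr_zero (Cr0_closed A mX).

Let lin_continuous : continuous (fun p : K^o * (CrX * CrX) => lin p.1 p.2.1 p.2.2).
Proof. exact: Cr_lin_continuous (Cr_diff_continuous_closed mX) (Cr_diff_lin_closed mX). Qed.

Let mul_continuous : continuous (fun p : CrX * CrX => mul p.1 p.2).
Proof. exact: Cr_mul_continuous_manifold. Qed.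

Definition test_val (u : TF) : CrX := set_val u.

Lemma test_supported (u : TF) :
  exists2 C, compact C & @supported R X AR r C (test_val u).
Proof. by have [C cC uC] := set_valP u; exists C. Qed.

Definition mk_test (f : CrX) (sf : exists2 C, compact C & @supported R X AR r C f) : TF :=
  exist _ f (mem_set (let: ex_intro2 C cC fC := sf in ex_intro2 _ _ C cC fC)).

Lemma test_eq (u v : TF) : (forall x, test_fun u x = test_fun v x) -> u = v.
Proof. by move=> uv; apply: val_inj; apply: Cr_eq. Qed.

Lemma lin_supported C a f g : @supported R X AR r C f -> @supported R X AR r C g ->
  @supported R X AR r C (lin a f g).
Proof. by move=> sf sg x Cx /=; rewrite sf// sg// scaler0 addr0. Qed.

Lemma mul_supportedl C f g : @supported R X AR r C f ->
  @supported R X AR r C (mul f g).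
Proof. by move=> sf x Cx /=; rewrite sf// alg_mul0l. Qed.

Lemma mul_supportedr C f g : @supported R X AR r C g ->
  @supported R X AR r C (mul f g).
Proof. by move=> sg x Cx /=; rewrite sg// alg_mul0r. Qed.

Lemma supportedS C D (f : CrX) : C `<=` D -> supported C f -> supported D f.
Proof. by move=> CD sf x Dx; apply: sf => /CD. Qed.

Lemma test_lin_subproof a (u v : TF) :
  exists2 C, compact C & @supported R X AR r C (lin a (test_val u) (test_val v)).
Proof.
have [C cC uC] := test_supported u; have [D cD vD] := test_supported v.
exists (C `|` D); first exact: compactU.
by apply: lin_supported; [apply: supportedS uC|apply: supportedS vD] => x; [left|right].
Qed.

Lemma test_mul_subproof (u v : TF) :
  exists2 C, compact C & @supported R X AR r C (mul (test_val u) (test_val v)).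
Proof.
by have [C cC uC] := test_supported u; exists C => //; exact: mul_supportedl.
Qed.

Lemma test_zero_subproof : exists2 C, compact C & @supported R X AR r C zero.
Proof. by exists set0 => //; exact: compact0. Qed.

Definition test_lin a u v : TF := mk_test (test_lin_subproof a u v).
Definition test_mul u v : TF := mk_test (test_mul_subproof u v).
Definition test_zero : TF := mk_test test_zero_subproof.

Lemma test_linE a u v x : test_fun (test_lin a u v) x = a *: test_fun u x + test_fun v x.
Proof. by []. Qed.

Lemma test_mulE u v x : test_fun (test_mul u v) x = alg_mul (test_fun u x) (test_fun v x).
Proof. by []. Qed.

Lemma test_zeroE x : test_fun test_zero x = 0.
Proof. by []. Qed.

Definition test_pointwise_linear : pointwise_linear (A := A) (fun u : TF => test_fun u).
Proof.
apply: (@PointwiseLinear _ _ _ _ _ test_zero (test_lin 1) (fun a u => test_lin a u test_zero)).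
- exact: test_eq.
- exact: test_zeroE.
- by move=> u v x; rewrite test_linE scale1r.
- by move=> a u x; rewrite test_linE test_zeroE addr0.
Defined.

Local Notation TV := (pointwise_module test_pointwise_linear).

(** The continuous linear maps on the space of test functions; the continuity on the
   functions supported in a compact set [C] is expressed by neighbourhoods in the
   space of all $C^r$-maps, which avoids the subtypes. The equivalence with the
   conditions in [test_subbase] is [test_mapP]. *)
Definition test_map (F : tvsType K) (f : TF -> F) : Prop :=
  test_linear f /\
  forall C u0 N, compact C -> supported C (test_val u0) -> nbhs (f u0) N ->
    exists2 P, nbhs (test_val u0) P &
      forall u, supported C (test_val u) -> P (test_val u) -> N (f u).

Lemma test_mapP (F : tvsType K) (f : TF -> F) : test_map f <->
  test_linear f /\ forall C (cC : compact C), continuous (f \o @supported_test R k X A r C cC).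
Proof.
split=> -[lf cf]; split=> //.
  move=> C cC e N eN; apply/nbhs_set_type.
  have [P eP PN] := cf C (supported_test cC e) N cC (set_valP e) eN.
  by exists P => // e' Pe'; apply: PN => //; exact: (set_valP e').
move=> C u0 N cC u0C u0N.
pose el (u : TF) (uC : supported C (test_val u)) :
  set_type (@supported R X AR r C) := exist _ (test_val u) (mem_set uC).
have elE u uC : supported_test cC (@el u uC) = u by exact: val_inj.
have /nbhs_set_type[P u0P PN] :
    nbhs (@el u0 u0C) ((f \o @supported_test R k X A r C cC) @^-1` N).
  by apply: cf; rewrite /= elE.
exists P => // u uC Pu; rewrite -(elE u uC); exact: (PN (@el u uC)).
Qed.

Lemma test_linearP (F : tvsType K) (f : TF -> F) a (u v : TV) :
  test_linear f -> f (a *: u + v) = a *: f u + f v.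
Proof.
move=> lf; apply: lf => x.
by rewrite (paddE test_pointwise_linear) (pscaleE test_pointwise_linear).
Qed.

Lemma test_linear0 (F : tvsType K) (f : TF -> F) : test_linear f -> f (0 : TV) = 0.
Proof.
move=> lf; have := test_linearP 1 0 0 lf; rewrite scaler0 addr0 scale1r.
by move=> /esym/eqP; rewrite -subr_eq0 addrK => /eqP.
Qed.

Lemma test_linearZ (F : tvsType K) (f : TF -> F) a (u : TV) :
  test_linear f -> f (a *: u) = a *: f u.
Proof. by move=> lf; rewrite -[a *: u]addr0 test_linearP// test_linear0// addr0. Qed.

Lemma test_convex_preimage (F : tvsType K) (f : TF -> F) (V : set F) :
  test_linear f -> @convex_set K F V -> @convex_set K TV (f @^-1` V).
Proof.
move=> lf /convex_setP cV; apply/convex_setP => a u v a0 a1 Vu Vv.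
by rewrite /= test_linearP// test_linearZ//; exact: cV.
Qed.

Lemma test_balanced_preimage (F : tvsType K) (f : TF -> F) (V : set F) :
  test_linear f -> balanced V -> @balanced K TV (f @^-1` V).
Proof. by move=> lf bV a u a1 Vu; rewrite /= test_linearZ//; exact: bV. Qed.

Lemma test_linear_lin (F : tvsType K) (f : TF -> F) a u v :
  test_linear f -> f (test_lin a u v) = a *: f u + f v.
Proof. by apply=> x; rewrite test_linE. Qed.

Lemma test_is_subbase : @is_subbase TF (@test_subbase R k X A r).
Proof. by []. Qed.

Lemma test_map_continuous (F : tvsType K) (f : TF -> F) : test_map f -> continuous f.
Proof.
move=> /test_mapP[lf cf]; apply/continuousP => V oV.
by apply: subbase_open test_is_subbase _; exists F, f, V.
Qed.

Lemma cvg_test (Z : Type) (Q : set_system Z) (g : Z -> TF) u0 : Filter Q ->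
  (forall (F : tvsType K) (f : TF -> F), test_map f -> (f \o g) @ Q --> f u0) ->
  g @ Q --> u0.
Proof.
move=> FQ gu; apply: cvg_subbase test_is_subbase _ => //.
move=> _ [F [f [V [lf cf oV ->]]]] /= Vu0.
have /gu : test_map f by apply/test_mapP.
by apply; exact: open_nbhs_nbhs.
Qed.

Lemma test_eval_map x : test_map (fun u : TF => test_fun u x).
Proof.
split=> [a u v w -> //|C u0 N cC u0C u0N].
exists ((fun g : CrX => sval g x) @^-1` N) => //.
exact: (@Cr_eval_continuous R X AR r (Cr_diff_continuous_closed mX) x (test_val u0) N).
Qed.

Lemma test_hausdorff : hausdorff_space TF.
Proof.
move=> u v uv; apply: test_eq => x.
by apply: (@cluster_nbhs_image _ _ (fun u : TF => test_fun u x) _ _ (@lc_hausdorff _ A) _ _ uv);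
  exact: (test_map_continuous (test_eval_map x)).
Qed.

Lemma test_lin_continuous :
  continuous (fun p : K^o * (TF * TF) => test_lin p.1 p.2.1 p.2.2).
Proof.
move=> [a0 [u0 v0]].
pose Q : set_system (K^o * (TF * TF)) := nbhs (a0, (u0, v0)).
have FQ : Filter Q by exact: nbhs_filter.
apply: (@cvg_test _ Q) => F f mf; have [lf _] := mf; have cf := test_map_continuous mf.
have Qa : fst @ Q --> (a0 : K^o).
  exact: (@continuous_fst K^o (TF * TF)%type (a0, (u0, v0))).
have Q2 : snd @ Q --> (u0, v0).
  exact: (@continuous_snd K^o (TF * TF)%type (a0, (u0, v0))).
have Qu : (fun z => f z.2.1) @ Q --> f u0.
  exact: (cvg_comp (fst \o snd) f (cvg_comp snd fst Q2 (@continuous_fst TF TF (u0, v0))) (cf u0)).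
have Qv : (fun z => f z.2.2) @ Q --> f v0.
  exact: (cvg_comp (snd \o snd) f (cvg_comp snd snd Q2 (@continuous_snd TF TF (u0, v0))) (cf v0)).
rewrite test_linear_lin//.
rewrite (_ : f \o _ = fun z => z.1 *: f z.2.1 + f z.2.2); last first.
  by apply/funext => z /=; rewrite test_linear_lin.
by apply: (@cvgD_tvs K F _ Q) => //; exact: (@cvgZ_tvs K F _ Q).
Qed.

Lemma test_convex_nbhs (u0 : TF) (N : set TF) : nbhs u0 N ->
  exists C : set TF, [/\ open C, C u0, C `<=` N & @convex_set K TV C].
Proof.
pose Q : set_system TF :=
  filter_from [set C | [/\ open C, C u0 & @convex_set K TV C]] id.
have FQ : Filter Q.
  apply: filter_from_filter.
    by exists setT; split; [exact: openT|by []|apply/convex_setP].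
  move=> C D [oC Cu /convex_setP cC] [oD Du /convex_setP cD]; exists (C `&` D) => //; split.
  - exact: openI.
  - by [].
  - by apply/convex_setP => a x y a0 a1 [Cx Dx] [Cy Dy]; split; [exact: cC|exact: cD].
suff Qu : Q --> u0 by move=> /Qu[C [oC Cf cC] CN]; exists C.
apply: (@cvg_test _ Q id) => F f mf V /tvs_convex_nbhs[V' [oV' cV' V'u V'V]].
have [lf _] := mf; exists (f @^-1` V'); last by move=> u; exact: V'V.
split=> //.
  by apply: open_comp => // u _; exact: test_map_continuous mf u.
exact: test_convex_preimage.
Qed.

(** The identity map to the space of test functions with the topology given by [W] is
   linear and continuous on the functions supported in any compact set, hence is one
   of the maps defining the topology; and [W] is a neighbourhood of $0$ in its
   target. *)
Lemma test_nbhs0 (W : set TV) : @convex_set K TV W -> balanced W ->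
  (forall C, compact C -> exists2 P, nbhs zero P &
     forall u : TF, supported C (test_val u) -> P (test_val u) -> W u) ->
  nbhs test_zero (W : set TF).
Proof.
move=> cW bW WP.
have scaleE (a : K) (u : TF) : test_val (a *: (u : TV)) = lin a (test_val u) zero by [].
have aW : absorbing W.
  move=> u; have [C cC uC] := test_supported u; have [P P0 PW] := WP C cC.
  have [[B D] [/= B0 Du] BD] : nbhs (0 : K^o, (test_val u, zero))
      [set z | P (lin z.1 z.2.1 z.2.2)].
    apply: (@lin_continuous (0 : K^o, (test_val u, zero)) P).
    have -> : lin 0 (test_val u) zero = zero; last exact: P0.
    by apply: Cr_eq => x /=; rewrite scale0r addr0.
  have [e /= e0 eB] := B0; exists (e / 2); first exact: divr_gt0.
  apply: PW.
    by rewrite scaleE; apply: lin_supported => // x _.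
  rewrite scaleE; apply: (BD (e / 2, (test_val u, zero))); split=> /=.
    apply: eB; rewrite /= sub0r normrN gtr0_norm ?divr_gt0//.
    by rewrite ltr_pdivrMr// ltr_pMr// ltr1n.
  exact: nbhs_singleton.
pose G : tvsType K := gauge_space (Gauge cW bW aW).
have mi : @test_map G id.
  split=> [a u v w wE|C u0 N cC u0C /nbhs_gaugeP[e e0 eN]].
    apply: test_eq => x; rewrite wE.
    by rewrite (paddE test_pointwise_linear) (pscaleE test_pointwise_linear).
  have [P P0 PW] := WP C cC.
  pose sh (f : CrX) := lin e^-1 (lin (- 1) (test_val u0) f) zero.
  have csh : continuous sh.
    move=> f; apply: (@continuous_comp _ _ _
      (fun f => (e^-1 : K^o, (lin (- 1) (test_val u0) f, zero)))
      (fun p => lin p.1 p.2.1 p.2.2)); last exact: lin_continuous.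
    apply: (@cvg_pairI _ (nbhs f)); first exact: cvg_cst.
    apply: (@cvg_pairI _ (nbhs f)); last exact: cvg_cst.
    apply: (@continuous_comp _ _ _ (fun f => (- 1 : K^o, (test_val u0, f)))
      (fun p => lin p.1 p.2.1 p.2.2)); last exact: lin_continuous.
    apply: (@cvg_pairI _ (nbhs f)); first exact: cvg_cst.
    by apply: (@cvg_pairI _ (nbhs f)); [exact: cvg_cst|exact: cvg_id].
  exists (sh @^-1` P).
    apply: csh; rewrite /sh (_ : lin _ (lin _ _ _) _ = zero)//.
    by apply: Cr_eq => x /=; rewrite scaleN1r addNr scaler0 addr0.
  move=> u uC Pu.
  have -> : u = (u0 : TV) + e *: (e^-1 *: (- 1 *: (u0 : TV) + (u : TV))).
    by rewrite scalerA mulfV ?gt_eqF// scale1r scaleN1r addrA subrr add0r.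
  have shE : test_val (e^-1 *: (- 1 *: (u0 : TV) + (u : TV))) = sh (test_val u).
    by apply: Cr_eq => x /=; rewrite scale1r (addr0 (- 1 *: _)).
  apply: eN; apply: PW; rewrite shE//.
  by apply: lin_supported => //; exact: lin_supported.
apply: (@test_map_continuous G id mi test_zero).
exact: (@gauge_set_nbhs _ _ (Gauge cW bW aW)).
Qed.

Section Multiplication.
Variables (F : tvsType K) (f : TF -> F).
Hypothesis mf : test_map f.

Lemma test_map_mull v : test_map (fun u => f (test_mul u v)).
Proof.
have [lf cf] := mf; split=> [a u u' w wE|C u0 N cC u0C u0N].
  by apply: lf => x; rewrite !test_mulE wE alg_mulDl alg_scaleAl.
have [P u0P PN] := cf C (test_mul u0 v) N cC (@mul_supportedl _ _ _ u0C) u0N.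
exists ((fun g => mul g (test_val v)) @^-1` P).
  apply: (@continuous_comp _ _ _ (fun g => (g, test_val v)) (fun p => mul p.1 p.2)) u0P.
    by apply: (@cvg_pairI _ (nbhs (test_val u0))); [exact: cvg_id|exact: cvg_cst].
  exact: mul_continuous.
by move=> u uC Pu; apply: PN => //; exact: mul_supportedl.
Qed.

Lemma test_map_mulr v : test_map (fun u => f (test_mul v u)).
Proof.
have [lf cf] := mf; split=> [a u u' w wE|C u0 N cC u0C u0N].
  by apply: lf => x; rewrite !test_mulE wE alg_mulDr alg_scaleAr.
have [P u0P PN] := cf C (test_mul v u0) N cC (@mul_supportedr _ _ _ u0C) u0N.
exists ((fun g => mul (test_val v) g) @^-1` P).
  apply: (@continuous_comp _ _ _ (fun g => (test_val v, g)) (fun p => mul p.1 p.2)) u0P.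
    by apply: (@cvg_pairI _ (nbhs (test_val u0))); [exact: cvg_cst|exact: cvg_id].
  exact: mul_continuous.
by move=> u uC Pu; apply: PN => //; exact: mul_supportedr.
Qed.


Variable E : nat -> set X.
Hypothesis cE : forall n, compact (E n).
Hypothesis exhaustE : forall C, compact C -> exists n, C `<=` E n.

(** As a product is supported wherever one of its factors is, there are neighbourhoods
   $Q_n$ of $0$ in $C^r(X,A)$ such that $f(uv)\in V$ for $u,v\in Q_n$ if one of $u$ and
   $v$ is supported in $E_n$. Let $B_n$ be the set of all functions in
   $Q_0\cap\dots\cap Q_n$ supported in $E_n$. For $u\in B_i$ and $v\in B_j$ both belong
   to $Q_n$ with $n=\min(i,j)$ and one of them is supported in $E_n$, whence
   $f(uv)\in V$. For [V] convex and balanced, this carries over to the convex balanced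
   hull $W$ of the union of all $B_n$. *)
Lemma test_mul_nbhs0 (V : set F) : nbhs (0 : F) V ->
  exists2 W : set TF, nbhs test_zero W & forall u v, W u -> W v -> V (f (test_mul u v)).
Proof.
have [lf cf] := mf; have f0 : f test_zero = 0 by exact: test_linear0 lf.
move=> /tvs_balanced_nbhs[V' [V'0 cV' bV' V'V]].
have exQ n : exists Q, nbhs zero Q /\ forall u v, Q (test_val u) -> Q (test_val v) ->
    supported (E n) (test_val u) \/ supported (E n) (test_val v) ->
    V' (f (test_mul u v)).
  have [//||P P0 PV] := cf (E n) test_zero V' (@cE n); first by rewrite f0.
  have [[Q1 Q2] [/= Q10 Q20] QP] : nbhs (zero, zero) [set p | P (mul p.1 p.2)].
    apply: (@mul_continuous (zero, zero) P).
    have -> : mul zero zero = zero; last exact: P0.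
    by apply: Cr_eq => x /=; rewrite alg_mul0l.
  exists (Q1 `&` Q2); split; first exact: filterI.
  move=> u v [Q1u _] [_ Q2v] uv; apply: PV; last exact: (QP (_, _)).
  by case: uv => s; [exact: mul_supportedl|exact: mul_supportedr].
have [Q QP] := choice exQ.
pose B n : set TV := [set u | supported (E n) (test_val u) /\
  forall l, (l <= n)%N -> Q l (test_val u)].
have BV i j u v : B i u -> B j v -> V' (f (test_mul u v)).
  move=> [ui Qu] [vj Qv]; have [ij|/ltnW ji] := leqP i j.
    by apply: (QP i).2; [exact: (Qu i)|exact: (Qv i)|left].
  by apply: (QP j).2; [exact: (Qu j)|exact: (Qv j)|right].
pose W : set TV := [set u | forall S : set TV, @convex_set K TV S -> balanced S ->
  (forall n, B n `<=` S) -> S u].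
have cW : @convex_set K TV W.
  apply/convex_setP => a u v a0 a1 Wu Wv S cS bS BS.
  by move/convex_setP: (cS); apply=> //; [exact: Wu|exact: Wv].
have bW : balanced W by move=> a u a1 Wu S cS bS BS; apply: bS a1 (Wu S cS bS BS).
exists W.
  apply: test_nbhs0 => // C cC; have [n CE] := exhaustE cC.
  exists [set g | forall l : 'I_n.+1, Q l g].
    apply: (@filter_forall _ _ (fun l : 'I_n.+1 => Q l) (nbhs zero)) => l.
    exact: (QP l).1.
  move=> u uC Qu S _ _ BS; apply: (BS n); split=> [|l ln]; first exact: supportedS uC.
  exact: (Qu (Ordinal (ln : (l < n.+1)%N))).
have WB u v j : W u -> B j v -> V' (f (test_mul u v)).
  move=> Wu Bv; have [lv _] := test_map_mull v.
  apply: (Wu [set u | V' (f (test_mul u v))]).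
  - exact: test_convex_preimage lv cV'.
  - exact: test_balanced_preimage lv bV'.
  - by move=> n u' Bu'; exact: BV Bu' Bv.
move=> u v Wu Wv; apply: V'V; have [lu _] := test_map_mulr u.
apply: (Wv [set v | V' (f (test_mul u v))]).
- exact: test_convex_preimage lu cV'.
- exact: test_balanced_preimage lu bV'.
- by move=> n v' Bv'; exact: WB Wu Bv'.
Qed.

(** Expanding $(u-u_0)(v-v_0)$ reduces the joint continuity to that at $0$ and to the
   continuity in each variable. *)
Lemma cvg_test_mul u0 v0 :
  (fun p : TF * TF => f (test_mul p.1 p.2)) @ nbhs (u0, v0) --> f (test_mul u0 v0).
Proof.
have [lf _] := mf.
(* [sub u1 u] is $u-u_1$. *)
pose sub u1 u := test_lin (- 1) u1 u.
have Q1 : fst @ nbhs (u0, v0) --> u0 by exact: (@continuous_fst TF TF (u0, v0)).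
have Q2 : snd @ nbhs (u0, v0) --> v0 by exact: (@continuous_snd TF TF (u0, v0)).
have sub0 u1 : sub u1 @ nbhs u1 --> test_zero.
  have <- : sub u1 u1 = test_zero.
    by apply: test_eq => x; rewrite test_linE test_zeroE scaleN1r addNr.
  apply: (@continuous_comp _ _ _ (fun u => (- 1 : K^o, (u1, u)))
    (fun p => test_lin p.1 p.2.1 p.2.2)); last exact: test_lin_continuous.
  apply: (@cvg_pairI _ (nbhs u1)); first exact: cvg_cst.
  by apply: (@cvg_pairI _ (nbhs u1)); [exact: cvg_cst|exact: cvg_id].
have main : (fun p => f (test_mul (sub u0 p.1) (sub v0 p.2))) @ nbhs (u0, v0) --> (0 : F).
  move=> N /test_mul_nbhs0[W W0 WN].
  exists (sub u0 @^-1` W, sub v0 @^-1` W) => /=.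
    by split; exact: sub0.
  by move=> [u v] [/= Wu Wv]; exact: WN.
have fl : (fun p => f (test_mul p.1 v0)) @ nbhs (u0, v0) --> f (test_mul u0 v0).
  exact: (cvg_comp fst (fun u => f (test_mul u v0)) Q1
    (@test_map_continuous _ _ (test_map_mull v0) u0)).
have fr : (fun p => f (test_mul u0 p.2)) @ nbhs (u0, v0) --> f (test_mul u0 v0).
  exact: (cvg_comp snd (fun v => f (test_mul u0 v)) Q2
    (@test_map_continuous _ _ (test_map_mulr u0) v0)).
have fE u v : f (test_mul u v) = f (test_mul (sub u0 u) (sub v0 v)) +
    (f (test_mul u v0) + (- f (test_mul u0 v0) + f (test_mul u0 v))).
  have -> : test_mul u v = 1 *: (test_mul (sub u0 u) (sub v0 v) : TV) +
     (1 *: (test_mul u v0 : TV) + (- 1 *: (test_mul u0 v0 : TV) + test_mul u0 v)).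
    apply: test_eq => x.
    rewrite !(paddE test_pointwise_linear) !(pscaleE test_pointwise_linear) !test_mulE !test_linE.
    rewrite !test_zeroE ?scale1r !addr0 alg_mulDl !alg_mulDr.
    rewrite -!alg_scaleAl -!alg_scaleAr !scaleN1r opprK.
    set p := alg_mul (test_fun u0 x) (test_fun v0 x).
    set q := alg_mul (test_fun u0 x) (test_fun v x).
    set s := alg_mul (test_fun u x) (test_fun v0 x).
    have -> : - p + q = - (p - q) by rewrite opprB addrC.
    by rewrite [s - _]addrC addrACA subrr add0r addrAC addNr add0r.
  by rewrite !test_linearP// !scale1r scaleN1r.
rewrite (_ : (fun p => _) = fun p => f (test_mul (sub u0 p.1) (sub v0 p.2)) +
    (f (test_mul p.1 v0) + (- f (test_mul u0 v0) + f (test_mul u0 p.2)))); last first.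
  by apply/funext => p; exact: fE.
rewrite -[X in _ --> X]add0r -[X in 0 + X]addr0.
rewrite -[X in 0 + (_ + X)](addNr (f (test_mul u0 v0))).
do 3![apply: (@cvgD_tvs K F _ (nbhs (u0, v0))) => //].
exact: cvg_cst.
Qed.

End Multiplication.

Lemma test_mul_continuous : finite_dimensional_charts X -> sigma_compact X ->
  continuous (fun p : TF * TF => test_mul p.1 p.2).
Proof.
move=> fX sX [u0 v0].
have mX0 := manifold_leq mX (order_le0 r).
have [E [cE exE]] := compact_exhaustion (fun x => manifold_compact_nbhs x mX0 fX) sX.
pose Q : set_system (TF * TF) := nbhs (u0, v0).
have FQ : Filter Q by exact: nbhs_filter.
apply: (@cvg_test _ Q) => F f mf; exact: (@cvg_test_mul F f mf E cE exE u0 v0).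
Qed.

Definition test_operations (fX : finite_dimensional_charts X) (sX : sigma_compact X) :
  pointwise_operations (A := A) (fun u : TF => test_fun u).
Proof.
apply: (@PointwiseOperations _ _ _ _ _ test_pointwise_linear test_mul).
- exact: test_mulE.
- move=> p; apply: (@continuous_comp _ _ _ (fun p : TF * TF => (1 : K^o, p))
    (fun p => test_lin p.1 p.2.1 p.2.2)); last exact: test_lin_continuous.
  by apply: (@cvg_pairI _ (nbhs p)); [exact: cvg_cst|exact: cvg_id].
- move=> p; apply: (@continuous_comp _ _ _ (fun p : K^o * TF => (p.1, (p.2, test_zero)))
    (fun p => test_lin p.1 p.2.1 p.2.2)); last exact: test_lin_continuous.
  apply: (@cvg_pairI _ (nbhs p)); first exact: continuous_fst.
  by apply: (@cvg_pairI _ (nbhs p)); [exact: continuous_snd|exact: cvg_cst].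
- exact: test_mul_continuous.
- exact: test_hausdorff.
- move=> u N /test_convex_nbhs[C [oC Cu CN /convex_setP cC]]; by exists C.
Defined.

End TestFunctions.

(** * Spaces of maps as topological algebras *)

Theorem proposition7p1 (R : realType) (k : scalar_kind)
    (A : lcAlgType (scalars R k))
    (mulA : associative (alg_mul : A -> A -> A)) :
  [/\ forall (r : smoothness) (X : charted R),
        order_le 1 r -> is_manifold r X ->
        pointwise_lc_algebra (A := A)
          (fun g : Cr_space X (realified R k A) r => sval g),
      forall X : topologicalType, hausdorff_space X ->
        pointwise_lc_algebra (A := A)
          (fun g : Cr_space (uncharted R X) (realified R k A) (Some 0%N) =>
             sval g) &
      forall (r : smoothness) (X : charted R),
        is_manifold r X -> finite_dimensional_charts X -> sigma_compact X ->
        pointwise_lc_algebra (A := A)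
          (fun g : test_functions X A r => test_fun g)].
Proof.
split=> [r X _ mX|X _|r X mX fX sX].
- exact: pointwise_operations_lc_algebra (Cr_manifold_operations A mX).
- exact: pointwise_operations_lc_algebra (Cr_uncharted_operations A X).
- exact: pointwise_operations_lc_algebra (test_operations A mX fX sX).
Qed.
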